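(* Let $\mathbf{u}\in C^2([0,T];X)$ be the solution of $$\rho\,\ddot{\mathbf{u}}(t,\mathbf{x})+\mathcal{L}^\epsilon[\mathbf{u}](t,\mathbf{x})=\mathbf{b}(t,\mathbf{x}),\qquad \mathbf{u}(0)=\mathbf{u}_0,\quad \dot{\mathbf{u}}(0)=\mathbf{v}_0,$$ with $\mathbf{u}_0,\mathbf{v}_0\in X$ and $\mathbf{b}\in C([0,T];X)$, where $\gamma$ is either of the degradation factors (a), (b) of the context. Let the process zone $PZ^\epsilon(t)$ be the set of pairs $(\mathbf{x},\mathbf{y})\in\Omega\times(\Omega\cap H_\epsilon(\mathbf{x}))$ for which $-\partial_t\gamma(\mathbf{u})(\mathbf{y},\mathbf{x},t)>0$. Then for almost every $t\in[0,T]$ (every $t$ in case (a)), $$\partial_t\mathcal{D}^\epsilon(t)=\int_\Omega\int_\Omega\rho^\epsilon(\mathbf{y},\mathbf{x})\,C^+\,\big(-\partial_t\gamma(\mathbf{u})(\mathbf{y},\mathbf{x},t)\big)\,d\mathbf{y}\,d\mathbf{x}=\int_\Omega\mathbf{b}(t)\cdot\dot{\mathbf{u}}(t)\,d\mathbf{x}-\partial_t\mathcal{K}(t)-\partial_t\mathcal{E}^\epsilon(t).$$ Only pairs in $PZ^\epsilon(t)$ contribute to the double integral, and this common value is $>0$ when $PZ^\epsilon(t)$ has positive measure, and is zero otherwise.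
   Context: Let $d\in\{2,3\}$, $\Omega\subset\mathbb{R}^d$ a bounded domain, $T>0$, $\epsilon>0$ and $\rho>0$ constants. Put $H_\epsilon(\mathbf{x})=\{\mathbf{y}:|\mathbf{y}-\mathbf{x}|<\epsilon\}$, let $\omega_d$ be the volume of the unit ball of $\mathbb{R}^d$ and $V_d^\epsilon=\omega_d\epsilon^d$. Function space: $\mathcal{U}=\{\mathbf{w}:\mathbf{w}(\mathbf{x})=\mathbb{Q}\mathbf{x}+\mathbf{c},\ \mathbb{Q}\in\mathbb{R}^{d\times d},\ \mathbb{Q}^T=-\mathbb{Q},\ \mathbf{c}\in\mathbb{R}^d\}$, and $X=\{\mathbf{u}\in L^\infty(\Omega;\mathbb{R}^d):\int_\Omega\mathbf{u}\cdot\mathbf{w}\,d\mathbf{x}=0\ \text{for all }\mathbf{w}\in\mathcal{U}\}$ with the $L^\infty$ norm. Kernel: $\rho^\epsilon(\mathbf{y},\mathbf{x})=\chi_\Omega(\mathbf{y})J(|\mathbf{y}-\mathbf{x}|/\epsilon)/(\epsilon V_d^\epsilon)$, where $J:[0,\infty)\to[0,\infty)$ is decreasing, positive on $[0,1)$, with $J(0)=M<\infty$ and $J=0$ on $[1,\infty)$. Strain: $\mathbf{e}=(\mathbf{y}-\mathbf{x})/|\mathbf{y}-\mathbf{x}|$, $S(\mathbf{y},\mathbf{x},\mathbf{u}(t))=\frac{\mathbf{u}(t,\mathbf{y})-\mathbf{u}(t,\mathbf{x})}{|\mathbf{y}-\mathbf{x}|}\cdot\mathbf{e}$, and $r(t,\mathbf{u})=\sqrt{|\mathbf{y}-\mathbf{x}|}\,S(\mathbf{y},\mathbf{x},\mathbf{u}(t))$.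 Potential: there are constants $r^-<r^e<0<r^c<r^+$; $g:\mathbb{R}\to\mathbb{R}$ is $C^2$, with $g',g''$ bounded, $g=C^-$ for $r\le r^-$, $g=C^+$ for $r\ge r^+$, $C^+>0$; $g$ is convex on $[r^e,r^c]$ and concave on $[r^-,r^e]$ and on $[r^c,r^+]$; $g(0)=g'(0)=0$. Degradation factor, one of the following: (a) $\gamma(\mathbf{u})(\mathbf{y},\mathbf{x},t)=h\big(\int_0^t(r(\tau,\mathbf{u})-r^+)^+\,d\tau\big)$, where $(\cdot)^+$ is the positive part and $h\ge 0$ is smooth, equal to $1$ for negative arguments, decreasing to zero on $[0,x^D)$, and zero on $[x^D,\infty)$, for some $x^D>0$; (b) $\gamma(\mathbf{u})(\mathbf{y},\mathbf{x},t)=h\big(\sqrt{|\mathbf{y}-\mathbf{x}|}\,S^*(t,\mathbf{y},\mathbf{x},\mathbf{u})\big)$, where $S^*(t,\mathbf{y},\mathbf{x},\mathbf{u})=\max_{0\le\tau\le t}S(\mathbf{y},\mathbf{x},\mathbf{u}(\tau))$ and $h\ge0$ is smooth, equal to $1$ on $(-\infty,r^+]$, decreasing to zero on $[r^+,r^D]$, and zero on $[r^D,\infty)$, for some $r^D>r^+$. (In case (b), for the solution $\mathbf u$, $\gamma(\mathbf u)(\mathbf y,\mathbf x,\cdot)$ is Lipschitz in time and $\partial_t\gamma$ is its a.e. derivative.) Force density: $\mathcal{L}^\epsilon[\mathbf{u}](t,\mathbf{x})=-\int_\Omega\frac{2\rho^\epsilon(\mathbf{y},\mathbf{x})}{\sqrt{|\mathbf{y}-\mathbf{x}|}}\,\gamma(\mathbf{u})(\mathbf{y},\mathbf{x},t)\,g'(r(t,\mathbf{u}))\,\mathbf{e}\,d\mathbf{y}$.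 Energies: kinetic $\mathcal{K}(t)=\int_\Omega\rho\frac{|\dot{\mathbf{u}}(t)|^2}{2}d\mathbf{x}$; elastic $\mathcal{E}^\epsilon(t)=\int_\Omega\int_\Omega\rho^\epsilon(\mathbf{y},\mathbf{x})\gamma(\mathbf{u})(\mathbf{y},\mathbf{x},t)g(r(t,\mathbf{u}))\,d\mathbf{y}\,d\mathbf{x}$; damage $\mathcal{D}^\epsilon(t)=-\int_0^t\int_\Omega\int_\Omega\rho^\epsilon(\mathbf{y},\mathbf{x})\,\partial_t\gamma(\mathbf{u})(\mathbf{y},\mathbf{x},\tau)\,g(r(\tau,\mathbf{u}))\,d\mathbf{y}\,d\mathbf{x}\,d\tau$. *)

(* Defs.v *)
From HB Require Import structures.
From mathcomp Require Import all_boot all_order all_algebra.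
From mathcomp Require Import all_classical all_reals all_analysis.

Set Implicit Arguments.
Unset Strict Implicit.
Unset Printing Implicit Defensive.

Import Order.TTheory GRing.Theory Num.Theory.
Import numFieldNormedType.Exports.

Local Open Scope classical_set_scope.
Local Open Scope ring_scope.

Definition rV_display : measure_display.
Proof. exact: default_measure_display. Qed.

(* The sigma-algebra generated by the coordinates, i.e. the Borel one. *)
Section rV_measurable.
Variables (R : realType) (n : nat).

Let coord : 'I_n -> 'rV[R]_n -> measurableTypeR R := fun i x => x ord0 i.

Let rV_measurable0 : g_sigma_preimage coord set0.
Proof. exact: sigma_algebra0. Qed.

Let rV_measurableC A : g_sigma_preimage coord A -> g_sigma_preimage coord (~` A).
Proof. exact: sigma_algebraC. Qed.

Let rV_measurable_bigcup (F : (set 'rV[R]_n)^nat) :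
  (forall i, g_sigma_preimage coord (F i)) ->
  g_sigma_preimage coord (\bigcup_i F i).
Proof. exact: sigma_algebra_bigcup. Qed.

HB.instance Definition _ := @isMeasurable.Build rV_display
  'rV[R]_n (g_sigma_preimage coord)
  rV_measurable0 rV_measurableC rV_measurable_bigcup.

End rV_measurable.

Lemma measurable_coord (R : realType) n (i : 'I_n) :
  measurable_fun [set: 'rV[R]_n] (fun x => x ord0 i).
Proof.
move=> _ Y mY; rewrite setTI; apply: sub_sigma_algebra => /=.
rewrite -bigcup_seq/=; exists i => /=; first by rewrite mem_index_enum.
by exists Y => //; rewrite setTI.
Qed.

Lemma measurable_fun_rV d (T : measurableType d) (R : realType) n
    (f : T -> 'rV[R]_n) :
  (forall i, measurable_fun setT (fun x => f x ord0 i)) -> measurable_fun setT f.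
Proof.
move=> mf; suff : g_sigma_preimage
    (fun (i : 'I_n) (x : T) => f x ord0 i : measurableTypeR R) `<=` measurable.
  move=> sub _ A mA; rewrite setTI; apply: sub.
  rewrite (g_sigma_preimage_comp (fun i (x : 'rV[R]_n) => x ord0 i : measurableTypeR R)).
  by exists A => //; rewrite setTI.
apply: smallest_sub; first exact: sigma_algebra_measurable.
rewrite -bigcup_seq; apply: bigcup_sub => i _ B [C mC <-].
exact: mf.
Qed.

Definition row_cons (R : Type) n (a : R) (x : 'rV[R]_n) : 'rV[R]_n.+1 :=
  \row_i oapp (x ord0) a (unlift ord0 i).

Lemma row_cons0 (R : Type) n (a : R) (x : 'rV[R]_n) :
  row_cons a x ord0 ord0 = a.
Proof. by rewrite mxE unlift_none. Qed.

Lemma row_consS (R : Type) n (a : R) (x : 'rV[R]_n) i :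
  row_cons a x ord0 (lift ord0 i) = x ord0 i.
Proof. by rewrite mxE liftK. Qed.

(* Lebesgue measure on R^n as an iterated product: see lebesgue_rV_box. *)
Fixpoint lebesgue_rV (R : realType) (n : nat) : set 'rV[R]_n -> \bar R :=
  if n is m.+1 then
    pushforward (@lebesgue_rV R m \x @lebesgue_measure R)%E
      (fun p => row_cons p.2 p.1)
  else \d_(0 : 'rV[R]_0).

Lemma measurable_row_cons (R : realType) m :
  measurable_fun [set: 'rV[R]_m * R] (fun p => row_cons p.2 p.1).
Proof.
apply: measurable_fun_rV => i; case: (unliftP ord0 i) => [j|] ->.
  under eq_fun do rewrite row_consS.
  apply: (@measurableT_comp _ _ _ _ _ _ (fun x : 'rV[R]_m => x ord0 j)) => //=.
  exact: measurable_coord.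
under eq_fun do rewrite row_cons0.
exact: measurable_snd.
Qed.

Lemma measurable_rV_box (R : realType) n (A : 'I_n -> set R) :
  (forall i, measurable (A i)) ->
  measurable [set x : 'rV[R]_n | forall i, A i (x ord0 i)].
Proof.
move=> mA.
rewrite (_ : [set x | _] = \bigcap_(i in [set: 'I_n]) ((fun x : 'rV[R]_n => x ord0 i) @^-1` A i)).
  apply: fin_bigcap_measurable => // i _.
  by rewrite -[X in measurable X]setTI; exact: measurable_coord.
by apply/seteqP; split => x /= h i => [_|]; exact: h.
Qed.

Lemma lebesgue_rV_spec (R : realType) n :
  exists2 mu : {measure set 'rV[R]_n -> \bar R},
    @lebesgue_rV R n = mu &
    forall A : 'I_n -> set R, (forall i, measurable (A i)) ->
      mu [set x | forall i, A i (x ord0 i)] =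
      (\prod_(i < n) (@lebesgue_measure R (A i)))%E.
Proof.
elim: n => [|n [mu /= muE boxE]].
  exists (\d_(0 : 'rV[R]_0)) => //= A mA.
  by rewrite big_ord0 diracE mem_set// => -[].
exists (measure_function_pushforward__canonical__measure_function_Measure
  (mu \x @lebesgue_measure R)%E (@measurable_row_cons R n)); first by rewrite /= muE.
move=> A mA.
rewrite big_ord_recl [RHS]muleC -(boxE (fun i => A (lift ord0 i)))//.
rewrite -product_measure1E; last 2 first.
- by apply: (@measurable_rV_box _ _ (fun i => A (lift ord0 i))) => i; exact: mA.
- exact: mA.
rewrite /= /pushforward; congr (_ _); apply/seteqP; split => -[x r] /=.
  move=> h; split=> [i|]; last by have := h ord0; rewrite row_cons0.
  by have := h (lift ord0 i); rewrite row_consS.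
move=> [xA rA] i; case: (unliftP ord0 i) => [j|] ->.
  by rewrite row_consS; exact: xA.
by rewrite row_cons0.
Qed.

Section lebesgue_rV_measure.
Variables (R : realType) (n : nat).
Local Notation leb := (@lebesgue_rV R n).

Let leb0 : leb set0 = 0%E.
Proof. by have [mu -> _] := lebesgue_rV_spec R n; exact: measure0. Qed.

Let leb_ge0 A : (0 <= leb A)%E.
Proof. by have [mu -> _] := lebesgue_rV_spec R n; exact: measure_ge0. Qed.

Let leb_sigma_additive : semi_sigma_additive leb.
Proof.
by have [mu -> _] := lebesgue_rV_spec R n; exact: measure_semi_sigma_additive.
Qed.

HB.instance Definition _ := isMeasure.Build _ _ _ leb
  leb0 leb_ge0 leb_sigma_additive.

Lemma lebesgue_rV_box (A : 'I_n -> set R) : (forall i, measurable (A i)) ->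
  leb [set x | forall i, A i (x ord0 i)] =
  (\prod_(i < n) (@lebesgue_measure R (A i)))%E.
Proof. by move=> mA; have [mu -> ->] := lebesgue_rV_spec R n. Qed.

Let leb_sigma_finite : sigma_finite setT leb.
Proof.
exists (fun k => [set x : 'rV[R]_n | forall i, `[- k%:R, k%:R]%classic (x ord0 i)]).
  apply/esym; rewrite -subTset => x _.
  have [k xk] : exists k : nat, forall i, `|x ord0 i| <= k%:R.
    exists (\max_(j < n) (Num.Def.trunc `|x ord0 j|).+1)%N => i.
    apply/ltW/(lt_le_trans (truncnS_gt `|x ord0 i|)).
    rewrite ler_nat.
    exact: (@leq_bigmax _ (fun j => (Num.Def.trunc `|x ord0 j|).+1)).
  by exists k => // i; rewrite /= in_itv/= -ler_norml.
move=> k; split.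
  by apply: (@measurable_rV_box _ _ (fun=> `[- k%:R, k%:R]%classic)) => i.
rewrite (lebesgue_rV_box (A := fun=> `[- k%:R, k%:R]%classic))//.
rewrite ltey_eq prode_fin_num// => i _.
by rewrite lebesgue_measure_itv/=; case: ifP.
Qed.

HB.instance Definition _ := @Measure_isSigmaFinite.Build _ _ _ leb leb_sigma_finite.

End lebesgue_rV_measure.

Section euclidean.
Variables (R : realType) (d : nat).
Local Notation E := 'rV[R]_d.

Definition dotv (x y : E) : R := \sum_(i < d) x ord0 i * y ord0 i.

(* The library norm on row vectors is the sup norm, not the Euclidean one. *)
Definition enorm (x : E) : R := Num.sqrt (dotv x x).

Definition bounded_domain (Omega : set E) : Prop :=
  [/\ open Omega, connected Omega, Omega !=set0 & bounded_set Omega].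

Definition unit_ball_volume : R :=
  fine (@lebesgue_rV R d [set y | enorm y < 1]).

(* Row vectors: the transpose of Q x + c is x^T Q^T + c^T. *)
Definition rigid_motion : set (E -> E) :=
  [set w | exists (Q : 'M[R]_d) (c : E),
     Q^T = - Q /\ w = (fun x => x *m Q^T + c)].

Definition Linf_norm (Omega : set E) (f : E -> E) : \bar R :=
  Lnorm (@lebesgue_rV R d) +oo%E ((fun x => (enorm (f x))%:E) \_ Omega).

(* Elements of X are represented by functions, identified when they agree
   almost everywhere on Omega. *)
Definition space_X (Omega : set E) : set (E -> E) :=
  [set f | [/\ measurable_fun Omega f, (Linf_norm Omega f < +oo)%E &
     forall w, rigid_motion w ->
       \int[@lebesgue_rV R d]_(x in Omega) dotv (f x) (w x) = 0]].

Definition eqX (Omega : set E) (f f' : E -> E) : Prop :=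
  {ae @lebesgue_rV R d, forall x, Omega x -> f x = f' x}.

End euclidean.

Section time.
Variables (R : realType) (d : nat).
Local Notation E := 'rV[R]_d.
Implicit Types (T t : R) (Omega : set E) (u v w : R -> E -> E).

(* At t = 0 and t = T these are the one-sided derivatives. *)
Definition is_time_deriv T (f : R -> R) t (l : R) : Prop :=
  (s - t)^-1 * (f s - f t) @[s --> within `[0, T]%classic t^'] --> l.

(* 0 where the derivative does not exist. *)
Definition time_deriv T (f : R -> R) t : R :=
  xget 0 [set l | is_time_deriv T f t l].

Definition continuous_X Omega T u : Prop :=
  forall t, t \in `[0, T] -> space_X Omega (u t) /\
    Linf_norm Omega (fun x => u s x - u t x)
      @[s --> within `[0, T]%classic (nbhs t)] --> 0%E.

Definition is_deriv_X Omega T u v : Prop :=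
  forall t, t \in `[0, T] ->
    Linf_norm Omega (fun x => (s - t)^-1 *: (u s x - u t x) - v t x)
      @[s --> within `[0, T]%classic t^'] --> 0%E.

(* u is in C^2([0, T]; X), with first and second derivatives v and w. *)
Definition C2_X Omega T u v w : Prop :=
  [/\ continuous_X Omega T u, continuous_X Omega T v, continuous_X Omega T w,
      is_deriv_X Omega T u v & is_deriv_X Omega T v w].

(* Every u in C([0, T]; X) has a representative with this property.
   The degradation factors involve u(tau, x) for a fixed x and all tau in
   [0, t], so they are meaningful only for such a representative. *)
Definition time_continuous_version Omega T u : Prop :=
  forall x, Omega x -> {within `[0, T]%classic, continuous (u ^~ x)}.

End time.

Section constitutive.
Variable R : realType.
Implicit Types (J g h : R -> R).

Definition smooth h : Prop := forall n x, derivable (h^`(n))%classic x 1.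

(* Only the values of J on [0, +oo[ matter. *)
Definition influence_function J (M : R) : Prop :=
  [/\ forall s, 0 <= s -> 0 <= J s,
      forall s s', 0 <= s -> s <= s' -> J s' <= J s,
      forall s, 0 <= s -> s < 1 -> 0 < J s,
      J 0 = M &
      forall s, 1 <= s -> J s = 0].

Definition C2_bounded_derivatives g : Prop :=
  [/\ forall x, derivable g x 1, forall x, derivable g^`()%classic x 1,
      continuous g^`()^`()%classic,
      exists B : R, forall x, `|g^`()%classic x| <= B &
      exists B : R, forall x, `|g^`()^`()%classic x| <= B].

Definition convex_on (a b : R) g : Prop := @convex_function R R^o `[a, b] g.

Definition concave_on (a b : R) g : Prop := convex_on a b (fun x => - g x).

Record bond_potential g (rm re rc rp Cm Cp : R) : Prop := {
  potential_thresholds : [/\ rm < re, re < 0, 0 < rc & rc < rp] ;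
  potential_C2 : C2_bounded_derivatives g ;
  potential_left : forall r, r <= rm -> g r = Cm ;
  potential_right : forall r, rp <= r -> g r = Cp ;
  potential_Cp_gt0 : 0 < Cp ;
  potential_convex : convex_on re rc g ;
  potential_concave_left : concave_on rm re g ;
  potential_concave_right : concave_on rc rp g ;
  potential_at0 : g 0 = 0 /\ g^`()%classic 0 = 0 }.

(* [excess_integral h xD] degrades a bond through the time integral of its excess
   strain, [peak_strain h rD] through its largest strain so far. *)
Inductive degradation : Type :=
  | excess_integral of (R -> R) & R
  | peak_strain of (R -> R) & R.

Definition is_excess_integral (k : degradation) : bool :=
  if k is excess_integral _ _ then true else false.

Definition degradation_law (rp : R) (k : degradation) : Prop :=
  match k with
  | excess_integral h xD =>
      [/\ 0 < xD, smooth h, forall x, 0 <= h x &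
       [/\ forall x, x < 0 -> h x = 1,
           {in `[0, xD[ &, {homo h : x y /~ x <= y}} &
           forall x, xD <= x -> h x = 0]]
  | peak_strain h rD =>
      [/\ rp < rD, smooth h, forall x, 0 <= h x &
       [/\ forall x, x <= rp -> h x = 1,
           {in `[rp, rD] &, {homo h : x y /~ x <= y}} &
           forall x, rD <= x -> h x = 0]]
  end.

End constitutive.

Section peridynamics.
Variables (R : realType) (d : nat).
Local Notation E := 'rV[R]_d.
Local Notation leb := (@lebesgue_rV R d).
Variables (Omega : set E) (T eps : R) (J g : R -> R) (rp : R).
Variable k : degradation R.
Implicit Types (u v : R -> E -> E) (x y : E) (t : R).

Definition bond_kernel y x : R :=
  \1_Omega y * J (enorm (y - x) / eps) /
  (eps * (unit_ball_volume R d * eps ^+ d)).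

Definition bond_direction y x : E := (enorm (y - x))^-1 *: (y - x).

Definition strain y x (f : E -> E) : R :=
  dotv ((enorm (y - x))^-1 *: (f y - f x)) (bond_direction y x).

Definition scaled_strain u y x t : R :=
  Num.sqrt (enorm (y - x)) * strain y x (u t).

(* For a time-continuous version the supremum is attained. *)
Definition max_strain u y x t : R :=
  sup [set strain y x (u tau) | tau in `[0, t]%classic].

Definition degradation_factor u y x t : R :=
  match k with
  | excess_integral h _ =>
      h (\int[@lebesgue_measure R]_(tau in `[0, t])
           Num.max (scaled_strain u y x tau - rp) 0)
  | peak_strain h _ => h (Num.sqrt (enorm (y - x)) * max_strain u y x t)
  end.

Definition degradation_rate u y x t : R :=
  time_deriv T (degradation_factor u y x) t.

Definition force_density u t x : E :=
  - \row_i \int[leb]_(y in Omega)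
      (2 * bond_kernel y x / Num.sqrt (enorm (y - x)) *
       degradation_factor u y x t * g^`()%classic (scaled_strain u y x t) *
       bond_direction y x ord0 i).

Definition kinetic_energy (rho : R) v t : R :=
  \int[leb]_(x in Omega) (rho * (enorm (v t x) ^+ 2 / 2)).

Definition elastic_energy u t : R :=
  \int[leb]_(x in Omega) \int[leb]_(y in Omega)
    (bond_kernel y x * degradation_factor u y x t * g (scaled_strain u y x t)).

Definition damage_energy u t : R :=
  - \int[@lebesgue_measure R]_(tau in `[0, t])
      \int[leb]_(x in Omega) \int[leb]_(y in Omega)
        (bond_kernel y x * degradation_rate u y x tau *
         g (scaled_strain u y x tau)).

Definition process_zone u t : set (E * E) :=
  [set p | [/\ Omega p.1, Omega p.2, enorm (p.2 - p.1) < eps &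
     0 < - degradation_rate u p.2 p.1 t]].

Definition dissipation_density (Cp : R) u t y x : R :=
  bond_kernel y x * Cp * - degradation_rate u y x t.

Definition dissipation (Cp : R) u t : R :=
  \int[leb]_(x in Omega) \int[leb]_(y in Omega) dissipation_density Cp u t y x.

(* u solves rho u'' + L[u] = b with initial data u0, v0, where v = u' and
   w = u''. *)
Record is_solution (rho : R) (b : R -> E -> E) (u0 v0 : E -> E) u v
    (w : R -> E -> E) : Prop := {
  solution_C2 : C2_X Omega T u v w ;
  solution_version : time_continuous_version Omega T u ;
  solution_source : continuous_X Omega T b ;
  solution_data : space_X Omega u0 /\ space_X Omega v0 ;
  solution_initial : eqX Omega (u 0) u0 /\ eqX Omega (v 0) v0 ;
  solution_eq : forall t, t \in `[0, T] ->
    eqX Omega (fun x => rho *: w t x + force_density u t x) (b t) }.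

End peridynamics.

(* Main.v *)
(* Each bond is treated separately.  Its factor gamma can change only while
   r >= r^+, where g takes the value C^+; hence the damage energy is the time
   integral of the dissipation, and the product rule turns the derivative of
   gamma g(r) into gamma g'(r) r' plus C^+ times the derivative of gamma.  All
   difference quotients over Omega x Omega are dominated by a multiple of
   |y - x|^(-1/2), which is integrable, so that the energies may be differentiated
   under the integral sign.  The bond forces are odd under exchange of x and y,
   whence the first term integrates to the power of the force density, and the
   equation of motion tested with the velocity gives the balance.

   In case (a) gamma is differentiable at every time and the dissipation is
   continuous.  In case (b) a running maximum fails to be differentiable only at
   the right end of one of its plateaus; for different times these events carve
   out disjoint sets of bonds, so outside countably many times gamma is
   differentiable for almost every bond, and Lebesgue's differentiation theorem
   recovers the dissipation from the damage energy. *)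

(* The main obstacle is null sets. Displacements are classes modulo null sets, and an estimate in X
   holds at each time off a null set that depends on that time. For [u], the time-continuous
   representative lets a countable dense set of times stand for all of them. For [v] no such
   representative is given, so the kinetic energy is differentiated along sequences. The rate of a
   bond is 0 by convention where gamma is not differentiable, hence not known to be measurable:
   integrals of arbitrary functions are compared, and the dissipation density is exchanged for an
   integrable function that equals it almost everywhere. The weight |y - x|^(-1/2) arises because a
   bounded velocity makes S Lipschitz in time with constant O(1/|y - x|), and the factor sqrt|y - x|
   in r takes away half a power. The Lipschitz estimates hold around each t on a neighbourhood that
   depends on t, but with a constant that does not; this uniformity bounds the dissipation on the
   whole interval. *)
Require Import Defs.
From HB Require Import structures.
From mathcomp Require Import all_boot all_order all_algebra.
From mathcomp Require Import all_classical all_reals all_analysis.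
From mathcomp Require Import measurable_realfun ess_sup_inf lra ring.
Import Order.TTheory GRing.Theory Num.Theory.
Import numFieldNormedType.Exports.
Local Open Scope classical_set_scope.
Local Open Scope ring_scope.
Set Implicit Arguments.
Unset Strict Implicit.
Unset Printing Implicit Defensive.

(** * Integrals of nonmeasurable functions *)

Section integral_arbitrary.
Context d (T : measurableType d) (R : realType).
Variable mu : {measure set T -> \bar R}.
Local Open Scope ereal_scope.
Import HBNNSimple.

(* Nothing is assumed measurable: the integral of a nonnegative function is a
   supremum over the simple functions below it. *)
Lemma ge0_ae_le_integral_arbitrary (D : set T) (f g : T -> \bar R) :
  (forall x, D x -> 0 <= f x) -> (forall x, D x -> 0 <= g x) ->
  {ae mu, forall x, D x -> f x <= g x} ->
  \int[mu]_(x in D) f x <= \int[mu]_(x in D) g x.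
Proof.
move=> f0 g0 [N [mN N0 fg]].
rewrite integral_mkcond [leRHS]integral_mkcond.
have fD0 x : 0 <= (f \_ D) x by rewrite patchE; case: ifPn => // /set_mem /f0.
have gD0 x : 0 <= (g \_ D) x by rewrite patchE; case: ifPn => // /set_mem /g0.
rewrite ge0_integralTE// ge0_integralTE//.
apply: ge_ereal_sup => /= _ [h hf <-].
have mNC : measurable (~` N) by exact: measurableC.
(* Cutting the simple function off on the null set [N] keeps its integral and puts it below [g] at
   every point. *)
pose h' := proj_nnsfun h mNC.
have h'E x : h' x = (h \_ (~` N)) x by rewrite mrestrict.
apply: ereal_sup_ge; exists (sintegral mu h').
  exists h' => // x; rewrite h'E patchE; case: ifPn => [xN|_]; last exact: gD0.
  rewrite (le_trans (hf x))// !patchE; case: ifPn => // /set_mem Dx.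
  have : ~ N x by exact: set_mem xN.
  by apply: contra_notP => xfg; apply: fg => /= /(_ Dx).
rewrite -!integralT_nnsfun le_eqVlt; apply/orP; left; apply/eqP.
apply: ae_eq_integral => //.
- exact/measurable_EFinP.
- exact/measurable_EFinP.
exists N; split => // x; apply: contraPP => xN; apply => _.
by rewrite [X in _ = X%:E]h'E patchE mem_set.
Qed.

Lemma ge0_le_integral_arbitrary (D : set T) (f g : T -> \bar R) :
  (forall x, D x -> 0 <= f x) -> (forall x, D x -> f x <= g x) ->
  \int[mu]_(x in D) f x <= \int[mu]_(x in D) g x.
Proof.
move=> f0 fg; apply: ge0_ae_le_integral_arbitrary => //; last exact/aeW.
by move=> x Dx; rewrite (le_trans (f0 x Dx))// fg.
Qed.

(** Two inequalities for the positive parts and two for the negative parts. This is what transfers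
    integrals of bond rates to measurable representatives. *)
Lemma integral_ae_eq_arbitrary (D : set T) (f g : T -> \bar R) :
  {ae mu, forall x, D x -> f x = g x} ->
  \int[mu]_(x in D) f x = \int[mu]_(x in D) g x.
Proof.
move=> fg; rewrite integralE [RHS]integralE; congr (_ - _);
  apply/eqP; rewrite eq_le; apply/andP; split;
  apply: ge0_ae_le_integral_arbitrary => //;
  by move: fg; apply: filterS => x + Dx => /(_ Dx) xfg; rewrite ?funeposE ?funenegE xfg.
Qed.

End integral_arbitrary.

Lemma Rintegral_ae_eq_arbitrary d (T : measurableType d) (R : realType)
    (mu : {measure set T -> \bar R}) (D : set T) (f g : T -> R) :
  {ae mu, forall x, D x -> f x = g x} ->
  \int[mu]_(x in D) f x = \int[mu]_(x in D) g x.
Proof.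
move=> fg; congr fine; apply: integral_ae_eq_arbitrary.
by move: fg; apply: filterS => x + Dx => ->.
Qed.

(** The positive and negative parts are exchanged, and [fine] sends both infinities to 0, so the
    sign comes out even when both parts have infinite integral. *)
Lemma RintegralN d (T : measurableType d) (R : realType)
    (mu : {measure set T -> \bar R}) (D : set T) (f : T -> R) :
  \int[mu]_(x in D) (- f x) = - \int[mu]_(x in D) f x.
Proof.
have fN : (fun x => (- f x)%:E) = (\- (EFin \o f))%E by [].
rewrite /Rintegral [in LHS]integralE [in RHS]integralE fN.
rewrite funeposN funenegN -[X in _ = - fine (X - _)%E]/(\int[mu]_(x in D) ((EFin \o f)^\+ x)%E)%E.
rewrite -[X in _ = - fine (_ - X)%E]/(\int[mu]_(x in D) ((EFin \o f)^\- x)%E)%E.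
have := @integral_ge0 _ _ _ mu D ((EFin \o f)^\+)%E (fun x _ => funepos_ge0 _ x).
have := @integral_ge0 _ _ _ mu D ((EFin \o f)^\-)%E (fun x _ => funeneg_ge0 _ x).
move: (integral _ _ _) (integral _ _ _) => [a| |] [b| |]//=; rewrite ?oppr0//.
by move=> _ _; rewrite opprB.
Qed.

Section product_le.
Context d1 d2 (T1 : measurableType d1) (T2 : measurableType d2) (R : realType).
Variables (m1 : {measure set T1 -> \bar R}) (m2 : set T2 -> \bar R).

(** The product integrates the measures of sections, and both operations are monotone on arbitrary
    sets. It is meant for the process zone, which is not known to be measurable. *)
Lemma le_product_measure1 (A B : set (T1 * T2)) :
  (forall C, 0 <= m2 C)%E -> {homo m2 : C D / C `<=` D >-> (C <= D)%E} ->
  A `<=` B -> ((m1 \x m2) A <= (m1 \x m2) B)%E.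
Proof.
move=> m20 hm2 AB; apply: ge0_le_integral_arbitrary => x _ /=; first exact: m20.
by apply: hm2 => y; rewrite !xsectionE; exact: AB.
Qed.
End product_le.

Lemma le_lebesgue_measure (R : realType) :
  {homo @lebesgue_measure R : A B / A `<=` B >-> (A <= B)%E}.
Proof. by move=> A B AB; exact: le_mu_ext. Qed.

Lemma le_lebesgue_rV (R : realType) n :
  {homo @lebesgue_rV R n : A B / A `<=` B >-> (A <= B)%E}.
Proof.
elim: n => [|n IH] A B AB /=.
  rewrite /dirac /= lee_fin !indicE.
  have [/set_mem/AB A0|//] := boolP (_ \in A).
  by rewrite mem_set.
apply: le_product_measure1 => //.
- exact: le_lebesgue_measure.
- by move=> p /=; exact: AB.
Qed.

(** * Geometry and measure of row vectors *)

Section rV_geometry.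
Context (R : realType) (n : nat).
Local Notation E := 'rV[R]_n.
Implicit Types x y : E.

(** The sigma-algebra is the one generated by the coordinates, so an open set is written as the
    countable union of the rational boxes that it contains. *)
Lemma open_measurable_rV (A : set E) : open A -> measurable A.
Proof.
move=> oA.
pose box (q : 'rV[rat]_n * rat) :=
  [set y : E | forall i, `]ratr (q.1 ord0 i) - ratr q.2, ratr (q.1 ord0 i) + ratr q.2[%classic (y ord0 i)].
pose F q := if `[< box q `<=` A >] then box q else set0.
have -> : A = \bigcup_q F q.
  apply/seteqP; split => [x Ax|x [q _]]; last first.
    by rewrite /F; case: asboolP => // + ?; apply.
  move: oA; rewrite openE => /(_ x Ax); rewrite /interior => /nbhs_ballP[e /= e0 xeA].
  have [r /[!in_itv]/= /andP[r0 re]] : exists r, ratr r \in `](0:R), e / 2[.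
    by apply: rat_in_itvoo; rewrite divr_gt0.
  (* With a centre within [r] of [x] in each coordinate, the box of half-width [r] contains [x] and
     stays within 2r < e of it. *)
  have /choice[q qx] : forall i, exists q : rat, `|x ord0 i - ratr q| < ratr r.
    move=> i; have [q /[!in_itv]/= /andP[qa qb]] :
        exists q, ratr q \in `]x ord0 i - ratr r, x ord0 i + ratr r[.
      by apply: rat_in_itvoo; lra.
    by exists q; rewrite ltr_distlC; apply/andP; split; lra.
  exists ((\row_i q i), r) => //; rewrite /F; case: asboolP => [_ i|].
    by rewrite /= mxE in_itv/=; have := qx i; rewrite ltr_distl => /andP[]; lra.
  case=> y /= yb; apply: xeA; split => // i j; rewrite (ord1 i) /ball/=.
  have := yb j; rewrite /= in_itv/= mxE => /andP[y1 y2].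
  have := qx j; rewrite ltr_distl => /andP[x1 x2].
  by rewrite ltr_distl; apply/andP; split; lra.
apply: countable_bigcupT_measurable => [|q]; first exact: countableP.
rewrite /F; case: asboolP => // _.
apply: (@measurable_rV_box R n (fun i => `]ratr (q.1 ord0 i) - ratr q.2, ratr (q.1 ord0 i) + ratr q.2[%classic)).
by move=> i; exact: measurable_itv.
Qed.

Lemma coord_le_enorm x i : `|x ord0 i| <= enorm x.
Proof.
rewrite /enorm -sqrtr_sqr ler_sqrt ?sqr_ge0//.
  by rewrite /dotv (bigD1 i)//= -expr2 lerDl sumr_ge0// => j _; rewrite -expr2 sqr_ge0.
by apply: sumr_ge0 => j _; rewrite -expr2 sqr_ge0.
Qed.

Lemma enorm_ge0 x : 0 <= enorm x. Proof. exact: sqrtr_ge0. Qed.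

Lemma dotv_ge0 x : 0 <= dotv x x.
Proof. by apply: sumr_ge0 => i _; rewrite -expr2 sqr_ge0. Qed.

Lemma sqr_enorm x : enorm x ^+ 2 = dotv x x.
Proof. by rewrite sqr_sqrtr// dotv_ge0. Qed.

Lemma enormN x : enorm (- x) = enorm x.
Proof. by congr Num.sqrt; apply: eq_bigr => i _; rewrite !mxE mulrNN. Qed.

Lemma enorm_le_coord x (c : R) : 0 <= c -> (forall i, `|x ord0 i| <= c) ->
  enorm x <= n%:R * c.
Proof.
move=> c0 xc.
rewrite -(@ler_pXn2r _ 2)// ?nnegrE ?enorm_ge0 ?mulr_ge0// sqr_enorm.
apply: (@le_trans _ _ (\sum_(i < n) c ^+ 2)).
  apply: ler_sum => i _; rewrite -expr2 -real_normK ?num_real//.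
  by rewrite ler_pXn2r ?nnegrE.
rewrite sumr_const card_ord exprMn -[_ *+ _]mulr_natl ler_wpM2r ?sqr_ge0//.
by rewrite -natrX ler_nat -mulnn; case: (n) => // m; rewrite leq_pmull.
Qed.

End rV_geometry.

Section rV_measure.
Context (R : realType) (n : nat).
Local Notation E := 'rV[R]_n.
Local Notation leb := (@lebesgue_rV R n).

Lemma measurable_coordB i :
  measurable_fun setT (fun p : E * E => (p.2 - p.1) ord0 i).
Proof.
under eq_fun do rewrite !mxE.
apply: measurable_funB.
  by apply: (@measurableT_comp _ _ _ _ _ _ (fun x : E => x ord0 i)) => //; exact: measurable_coord.
by apply: (@measurableT_comp _ _ _ _ _ _ (fun x : E => x ord0 i)) => //; exact: measurable_coord.
Qed.

Lemma measurable_sqrt d (T : measurableType d) (D : set T) (f : T -> R) :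
  measurable_fun D f -> measurable_fun D (fun x => Num.sqrt (f x)).
Proof.
move=> mf; apply: (@measurableT_comp _ _ _ _ _ _ (@Num.sqrt R)) => //.
by apply: continuous_measurable_fun; exact: sqrt_continuous.
Qed.

Lemma measurable_inv d (T : measurableType d) (D : set T) (f : T -> R) :
  measurable_fun D f -> measurable_fun D (fun x => (f x)^-1).
Proof.
move=> mf; apply: (@measurableT_comp _ _ _ _ _ _ (@GRing.inv R)) => //.
rewrite -(setUv [set 0]); apply/measurable_funU => //; first exact: measurableC.
split; first exact: measurable_fun_set1.
have o0 : open (~` [set (0 : R)]) by rewrite openC; exact/accessible_closed_set1/hausdorff_accessible/Rhausdorff.
apply: open_continuous_measurable_fun => // x; rewrite inE /= => /eqP x0.
exact: inv_continuous.
Qed.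

Lemma measurable_enormB :
  measurable_fun setT (fun p : E * E => enorm (p.2 - p.1)).
Proof.
apply: measurable_sqrt; apply: measurable_sum => i.
by apply: measurable_funM; exact: measurable_coordB.
Qed.

Lemma bounded_set_coord (A : set E) : bounded_set A ->
  exists2 c : R, 0 < c & forall x i, A x -> `|x ord0 i| <= c.
Proof.
move=> [M [_ MA]]; exists (`|M| + 1); first by rewrite ltr_wpDl.
move=> x i Ax; apply: (@le_trans _ _ `|x|).
  have := @coord_le_enorm _ _ x i.
  rewrite /Num.norm/= mx_normrE => _.
  by apply/bigmax_geP; right; exists (ord0, i).
by apply: MA => //; rewrite (le_lt_trans (ler_norm _))// ltrDl.
Qed.

Lemma lebesgue_rV_cube (a b : R) : a <= b ->
  leb [set x | forall i, `[a, b]%classic (x ord0 i)] = ((b - a) ^+ n)%:E.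
Proof.
move=> ab; rewrite (lebesgue_rV_box (A := fun=> `[a, b]%classic))//.
under eq_bigr do rewrite lebesgue_measure_itv/= lte_fin.
have -> : (if (a < b)%R then b%:E - a%:E else 0)%E = (b - a)%:E.
  by case: ltP => // ba; rewrite (@le_anti _ _ a b) ?subrr// ab.
by rewrite prodEFin prodr_const card_ord.
Qed.

Lemma bounded_lebesgue_rV_lty (A : set E) : bounded_set A -> (leb A < +oo)%E.
Proof.
move=> /bounded_set_coord[c c0 Ac].
have : (leb A <= leb [set x : E | forall i, `[(- c)%R, c]%classic (x ord0 i)])%E.
  by apply: le_lebesgue_rV => x Ax i /=; rewrite in_itv/= -ler_norml Ac.
by rewrite lebesgue_rV_cube; [move/le_lt_trans; apply; rewrite ltry|lra].
Qed.

Lemma unit_ball_volume_gt0 : 0 < unit_ball_volume R n.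
Proof.
apply: fine_gt0; apply/andP; split; last first.
  apply: bounded_lebesgue_rV_lty; exists 1; split => // M M1 x /= x1.
  rewrite [leLHS]mx_normrE; apply/bigmax_leP; split => /=; first lra.
  move=> [i j] _ /=; rewrite ord1 (le_trans (coord_le_enorm _ _))//; lra.
(* On the cube of side 1/(n+1), [enorm_le_coord] bounds the Euclidean norm by n/(n+1) < 1. *)
pose c : R := (n.+1)%:R^-1.
have c0 : 0 < c by rewrite invr_gt0.
have : (leb [set x : E | forall i, `[0%R, c]%classic (x ord0 i)] <= leb [set y : E | (enorm y < 1)%R])%E.
  apply: le_lebesgue_rV => x /= xc.
  apply: (@le_lt_trans _ _ (n%:R * c)).
    apply: enorm_le_coord => [|i]; first exact: ltW.
    have := xc i; rewrite in_itv/= => /andP[x0 x1].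
    by rewrite ger0_norm.
  by rewrite ltr_pdivrMr ?mul1r ?ltr_nat.
rewrite (lebesgue_rV_cube (ltW c0)) subr0; apply: lt_le_trans.
by rewrite lte_fin exprn_gt0.
Qed.

End rV_measure.

(** * Product measures and the weakly singular kernel *)

Section product_ae.
Context d1 d2 (T1 : measurableType d1) (T2 : measurableType d2) (R : realType).
Variables (m1 : {sigma_finite_measure set T1 -> \bar R})
          (m2 : {sigma_finite_measure set T2 -> \bar R}).
Local Notation m12 := (m1 \x m2)%E.

Lemma ae_product1 (P : T1 -> Prop) : {ae m1, forall x, P x} ->
  {ae m12, forall p, P p.1}.
Proof.
move=> [N [mN N0 PN]]; exists (N `*` setT); split => //.
- exact: measurableX.
- transitivity (m1 N * m2 setT)%E; first exact: product_measure1E.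
  by rewrite N0 mul0e.
- by move=> p /= Pp; split => //; exact: PN.
Qed.

Lemma ae_product2 (P : T2 -> Prop) : {ae m2, forall x, P x} ->
  {ae m12, forall p, P p.2}.
Proof.
move=> [N [mN N0 PN]]; exists (setT `*` N); split => //.
- exact: measurableX.
- transitivity (m1 setT * m2 N)%E; first exact: product_measure1E.
  by rewrite N0 mule0.
- by move=> p /= Pp; split => //; exact: PN.
Qed.

(** The measures of the sections of a null set integrate to 0, so almost all of them vanish. *)
Lemma ae_product (P : T1 * T2 -> Prop) : {ae m12, forall p, P p} ->
  {ae m1, forall x, {ae m2, forall y, P (x, y)}}.
Proof.
move=> [N [mN N0 PN]].
have mx : measurable_fun setT (m2 \o xsection N) by exact: measurable_fun_xsection.
have : {ae m1, forall x, setT x -> (m2 \o xsection N) x = (cst 0%E) x}.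
  apply/(ae_eq_integral_abs _ measurableT mx); rewrite -[RHS]N0.
  by apply: eq_integral => x _; rewrite gee0_abs.
apply: filterS => x /(_ I) /= x0; exists (xsection N x); split => //.
  exact: measurable_xsection.
by move=> y /= Pxy; rewrite xsectionE; exact: PN.
Qed.

Variables (D1 : set T1) (D2 : set T2).
Hypotheses (mD1 : measurable D1) (mD2 : measurable D2).

Lemma Rintegral12_ae_eq (f g : T1 * T2 -> R) :
  {ae m12, forall p, (D1 `*` D2) p -> f p = g p} ->
  \int[m1]_(x in D1) \int[m2]_(y in D2) f (x, y) =
  \int[m1]_(x in D1) \int[m2]_(y in D2) g (x, y).
Proof.
move=> /ae_product fg; apply: Rintegral_ae_eq_arbitrary.
move: fg; apply: filterS => x fgx D1x; apply: Rintegral_ae_eq_arbitrary.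
by move: fgx; apply: filterS => y + D2y; apply.
Qed.

Variable f : T1 * T2 -> R.
Hypothesis intf : m12.-integrable (D1 `*` D2) (EFin \o f).

Let F := (EFin \o f) \_ (D1 `*` D2).
Let iF : m12.-integrable setT F.
Proof. by rewrite -integrable_mkcond//; exact: measurableX. Qed.

Let FE1 x : D1 x -> (fun y => F (x, y)) = (fun y => (f (x, y))%:E) \_ D2.
Proof.
move=> D1x; apply/funext => y; rewrite /F !patchE.
by rewrite in_setX/= (mem_set D1x).
Qed.

Let FE2 y : D2 y -> (fun x => F (x, y)) = (fun x => (f (x, y))%:E) \_ D1.
Proof.
move=> D2y; apply/funext => x; rewrite /F !patchE.
by rewrite in_setX/= (mem_set D2y) andbT.
Qed.

Lemma ae_integrable12 :
  {ae m1, forall x, D1 x -> m2.-integrable D2 (fun y => (f (x, y))%:E)}.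
Proof.
have := ae_integrable1 iF; apply: filterS => x + D1x; rewrite FE1//.
by rewrite -integrable_mkcond.
Qed.

(** Fubini with real values: the [fine] around the inner integral is harmless because almost every
    inner integral is finite. *)
Lemma Rintegral12_prod :
  \int[m1]_(x in D1) \int[m2]_(y in D2) f (x, y) = \int[m12]_(p in D1 `*` D2) f p.
Proof.
rewrite /Rintegral [in RHS]integral_mkcond -/F -(integral12_prod_meas1 iF).
congr fine; rewrite integral_mkcond.
apply: integral_ae_eq_arbitrary.
have := ae_integrable1 iF.
apply: filterS => x /= /(integrable_fin_num measurableT) Fx _; rewrite patchE; case: ifPn => [/set_mem D1x|D1x].
  by move: Fx; rewrite /fubini_F FE1// -integral_mkcond => /fineK.
rewrite [RHS]integral0_eq// => y _.
by rewrite /F patchE in_setX/= (negbTE D1x).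
Qed.

Lemma Rintegral21_prod :
  \int[m2]_(y in D2) \int[m1]_(x in D1) f (x, y) = \int[m12]_(p in D1 `*` D2) f p.
Proof.
rewrite /Rintegral [in RHS]integral_mkcond -/F -(integral21_prod_meas1 iF).
congr fine; rewrite integral_mkcond.
apply: integral_ae_eq_arbitrary.
have := ae_integrable2 iF.
apply: filterS => y /= /(integrable_fin_num measurableT) Fy _; rewrite patchE; case: ifPn => [/set_mem D2y|D2y].
  by move: Fy; rewrite /fubini_G FE2// -integral_mkcond => /fineK.
rewrite [RHS]integral0_eq// => x _.
by rewrite /F patchE in_setX/= (negbTE D2y) andbF.
Qed.

End product_ae.

Section singular_kernel.
Context (R : realType) (m : nat).
Local Notation n := m.+1.
Local Notation E := 'rV[R]_n.
Local Notation leb := (@lebesgue_rV R n).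
Variable (Omega : set E).
Hypotheses (mO : measurable Omega) (bO : bounded_set Omega).
Let D := Omega `*` Omega.

(* The [k]-th slab has measure O(4^-k), and [|y - x|^(-1/2) <= 2^(k+1)] off the
   [k+1]-th one, so that [|y - x|^(-1/2)] is dominated by a summable series of
   slab indicators. *)
Definition slab (k : nat) : set (E * E) :=
  [set p : E * E | `|(p.2 - p.1) ord0 ord0| <= 4^-1 ^+ k].

Lemma measurable_slab k : measurable (slab k).
Proof.
have mf : measurable_fun setT (fun p : E * E => `|(p.2 - p.1) ord0 ord0|).
  by apply: measurableT_comp => //; exact: measurable_coordB.
have := measurable_fun_ler mf (measurable_cst (4^-1 ^+ k : R)).
move=> /(_ measurableT [set true] I); rewrite setTI.
by congr measurable; apply/seteqP; split => p /=.
Qed.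

(** If [Omega] lies in [-c, c]^n, the section of a slab at x lies in a box of width 2 * 4^-k in
    coordinate 0 and 2c in the others; integrating over x multiplies by the measure of [Omega]. *)
Lemma slab_measure : exists2 C : R, 0 <= C &
  forall k, ((leb \x leb) (D `&` slab k) <= (C * 4^-1 ^+ k)%:E)%E.
Proof.
have [c c0 Oc] := bounded_set_coord bO.
have lO := bounded_lebesgue_rV_lty bO.
exists (fine (leb Omega) * (2 * (c - - c) ^+ m)).
  by rewrite mulr_ge0 ?fine_ge0// mulr_ge0// exprn_ge0//; lra.
move=> k; pose r : R := 4^-1 ^+ k.
have r0 : 0 < r by rewrite exprn_gt0// invr_gt0.
pose K : R := (2 * r) * (c - - c) ^+ m.
have -> : fine (leb Omega) * (2 * (c - - c) ^+ m) * 4^-1 ^+ k = K * fine (leb Omega).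
  by rewrite /K -/r; ring.
rewrite EFinM fineK ?ge0_fin_numE//.
rewrite -[leRHS](@integral_cst _ _ _ leb Omega mO K%:E) integral_mkcond.
apply: ge0_le_integral_arbitrary => [x _|x _]; first exact: measure_ge0.
rewrite patchE -[leLHS]/(leb (xsection (D `&` slab k) x)).
case: ifPn => [/set_mem Ox|]; rewrite ?notin_setE; last first.
  move=> Ox; suff -> : xsection (D `&` slab k) x = set0 by rewrite measure0; exact: lexx.
  by apply/seteqP; split => // y; rewrite xsectionE /= => -[[/= /Ox]].
pose A := fun i : 'I_n => if i == ord0 then `[x ord0 ord0 - r, x ord0 ord0 + r]%classic
   else `[- c, c]%classic.
have mA i : measurable (A i) by rewrite /A; case: ifP.
apply: (@le_trans _ _ (leb [set y : E | forall i, A i (y ord0 i)])).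
  apply: le_lebesgue_rV => y; rewrite xsectionE /= => -[[/= _ Oy]].
  rewrite /slab/= !mxE => yx i; rewrite /A; case: eqVneq => [->|_] /=.
    by rewrite in_itv/=; move: yx; rewrite ler_distl.
  by rewrite in_itv/= -ler_norml; exact: Oc.
rewrite (lebesgue_rV_box mA) big_ord_recl /A eqxx.
under eq_bigr do rewrite /=.
rewrite lebesgue_measure_itv/= lte_fin ifT; last lra.
rewrite (eq_bigr (fun=> (c - - c)%:E)); last first.
  by move=> i _; rewrite lebesgue_measure_itv/= lte_fin ifT//; lra.
rewrite prodEFin prodr_const card_ord -EFinB -EFinM lee_fin /K ler_wpM2r ?exprn_ge0//; lra.
Qed.

Lemma integrable_inv_sqrt : (leb \x leb)%E.-integrable D
  (fun p => (Num.sqrt (enorm (p.2 - p.1)))^-1%:E).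
Proof.
have mD : measurable D by exact: measurableX.
have mf : measurable_fun setT (fun p : E * E => (Num.sqrt (enorm (p.2 - p.1)))^-1).
  by apply: measurable_inv; apply: measurable_sqrt; exact: measurable_enormB.
apply/integrableP; split; first by apply/measurable_EFinP; exact: measurable_funTS.
have [C C0 slabC] := slab_measure.
have lO := bounded_lebesgue_rV_lty bO.
have lD : ((leb \x leb) D < +oo)%E.
  apply: (@le_lt_trans _ _ (leb Omega * leb Omega)%E).
    by rewrite -(product_measure1E leb leb mO mO).
  by rewrite lte_mul_pinfty// ge0_fin_numE.
pose g k (p : E * E) : \bar R := ((2 ^+ k.+1)%:E * (\1_(slab k) p)%:E)%E.
have g0 k p : (0 <= g k p)%E by rewrite /g mule_ge0// lee_fin.
have mg k : measurable_fun D (g k).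
  apply: measurable_funTS; apply: emeasurable_funM => //.
  by apply/measurable_EFinP; apply: measurable_indic; exact: measurable_slab.
apply: (@le_lt_trans _ _ (\int[(leb \x leb)%E]_(p in D) (2%:E + \sum_(0 <= k <oo) g k p))%E).
  apply: ge0_le_integral_arbitrary => // p Dp.
  have [N fN] : exists N, (Num.sqrt (enorm (p.2 - p.1)))^-1 <= 2 ^+ N.+1.
    set a := _^-1; exists (Num.truncn a).+1.
    apply/ltW/(lt_le_trans (truncnS_gt _)).
    rewrite -natrX ler_nat ltnW// (leq_trans (ltn_expl _ (ltnSn 1)))// leq_exp2l//.
  (* Let N be the least such exponent. If N > 0, failure at N - 1 gives |y - x| <= 4^-N, so p lies
     in the slab of index N, whose coefficient is 2^(N+1). The case N = 0 is absorbed by the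
     constant 2; it includes the diagonal, where the inverse of 0 is 0. *)
  have := ex_minnP (ex_intro (fun N => (Num.sqrt (enorm (p.2 - p.1)))^-1 <= 2 ^+ N.+1) N fN).
  move=> {N fN}[[|N] fN minN]; rewrite gee0_abs ?lee_fin ?invr_ge0 ?sqrtr_ge0//.
    apply: (@le_trans _ _ 2%:E); first by rewrite lee_fin (le_trans fN)// expr1.
    by rewrite leeDl// nneseries_ge0.
  apply: (@le_trans _ _ (g N.+1 p)); last first.
    rewrite (@le_trans _ _ (\sum_(0 <= k < N.+2) g k p)%E)//.
      by rewrite big_nat_recr//= leeDr// sume_ge0.
    apply: (@le_trans _ _ (\sum_(0 <= k <oo) g k p)%E).
      exact: nneseries_lim_ge.
    by rewrite leeDr// lee_fin.
  rewrite /g -EFinM lee_fin indicE mem_set ?mulr1//.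
  rewrite /slab /= (le_trans (coord_le_enorm _ _))//.
  have : ~~ ((Num.sqrt (enorm (p.2 - p.1)))^-1 <= 2 ^+ N.+1).
    by apply/negP => /minN; rewrite ltnn.
  rewrite -ltNge => fN'.
  have s0 : 0 < Num.sqrt (enorm (p.2 - p.1)).
    by rewrite -invr_gt0 (le_lt_trans _ fN')// exprn_ge0.
  have : Num.sqrt (enorm (p.2 - p.1)) <= 2^-1 ^+ N.+1.
    by rewrite exprVn ltW// -[ltLHS]invrK ltf_pV2 ?posrE ?exprn_gt0// invr_gt0.
  move=> sN; rewrite -(sqr_sqrtr (enorm_ge0 (p.2 - p.1))).
  have -> : (4^-1 : R) = 2^-1 ^+ 2 by field.
  by rewrite -exprM mulnC exprM ler_pXn2r// nnegrE ?sqrtr_ge0// exprn_ge0.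
rewrite ge0_integralD//; last 2 first.
- by move=> p _; exact: nneseries_ge0.
- by apply: ge0_emeasurable_sum => // k p _ _; exact: g0.
apply: lte_add_pinfty; first by rewrite integral_cst// lte_mul_pinfty// ge0_fin_numE.
rewrite integral_nneseries//.
apply: (@le_lt_trans _ _ (\sum_(0 <= k <oo) (2 * C * 2^-1 ^+ k)%:E)%E).
  apply: lee_nneseries => [k _ _|k _]; first by apply: integral_ge0 => *; exact: g0.
  rewrite /g ge0_integralZl_EFin//; last first.
    by apply/measurable_EFinP; apply: measurable_indic; exact: measurable_slab.
  rewrite integral_indic//; last exact: measurable_slab.
  rewrite setIC; apply: (@le_trans _ _ ((2 ^+ k.+1)%:E * (C * 4^-1 ^+ k)%:E)%E).
    by apply: lee_wpmul2l; [rewrite lee_fin exprn_ge0|exact: slabC].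
  rewrite -EFinM lee_fin exprS.
  have -> : (4^-1 : R) = 2^-1 * 2^-1 by field.
  rewrite exprMn le_eqVlt; apply/orP; left; apply/eqP.
  have -> : 2 * 2 ^+ k * (C * (2^-1 ^+ k * 2^-1 ^+ k)) =
    (2 ^+ k * 2^-1 ^+ k) * (2 * C * 2^-1 ^+ k) :> R by ring.
  by rewrite -exprMn divff// expr1n mul1r.
(* [cvg_geometric_eseries_half] sums over 1/2^(k+1), whence 4C in place of 2C. *)
rewrite (@eq_eseriesr _ _ (fun k => ((4 * C) / (2 ^ (k + 0.+1))%:R)%:E)); last first.
  move=> k _; congr EFin.
  by rewrite addn1 natrX exprS invfM exprVn; field; rewrite expf_neq0.
by rewrite (cvg_lim _ (@cvg_geometric_eseries_half R (4 * C) 0))// ltry.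
Qed.
End singular_kernel.

(** * Derivatives within a time interval *)

Section time_derivative.
Context (R : realType) (T : R).
Implicit Types (f : R -> R) (s t l e d : R).

Lemma near_within_punctured (t : R) (P : set R) (A : set R) :
  (\forall s \near within A t^', P s) <->
  exists2 d, 0 < d & forall s, A s -> s != t -> `|s - t| < d -> P s.
Proof.
split.
  move=> /nbhs_ballP[d /= d0 H].
  by exists d => // s As st sd; apply: H => //=; rewrite /ball/= distrC.
move=> [d d0 H]; apply/nbhs_ballP.
by exists d => //= s sd st As; apply: H => //; rewrite distrC.
Qed.

(** Clearing the denominator admits s = t and gives a form stable under sums and composition. *)
Lemma is_time_derivP f t l : is_time_deriv T f t l <->
  forall e, 0 < e -> exists2 d, 0 < d & forall s, s \in `[0, T] ->
    `|s - t| < d -> `|f s - f t - l * (s - t)| <= e * `|s - t|.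
Proof.
split.
  move=> /cvgrPdist_le h e e0; have := h e e0.
  move=> /near_within_punctured[d d0 H]; exists d => // s sT sd.
  have [->|st] := eqVneq s t; first by rewrite !subrr mulr0 subr0 normr0 mulr0.
  have st0 : s - t != 0 by rewrite subr_eq0.
  have := H s sT st sd; rewrite distrC.
  rewrite -(@ler_pM2r _ `|s - t|) ?normr_gt0// -normrM mulrBl.
  by rewrite [_^-1 * _ * _]mulrAC mulVf// mul1r.
move=> h; apply/cvgrPdist_le => e e0; apply/near_within_punctured.
have [d d0 H] := h e e0; exists d => // s sT st sd.
have st0 : s - t != 0 by rewrite subr_eq0.
rewrite distrC -(@ler_pM2r _ `|s - t|) ?normr_gt0//.
by rewrite -normrM mulrBl [_^-1 * _ * _]mulrAC mulVf// mul1r; exact: H.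
Qed.

(** The form in which dominated convergence can be applied. For the converse, a failing limit
    provides violating points at distance less than 1/(n+1) from t. *)
Lemma is_time_deriv_seqP f t l : is_time_deriv T f t l <->
  forall s_ : R^nat, (forall n, s_ n \in `[0, T]) -> (forall n, s_ n != t) ->
    s_ n @[n --> \oo] --> t ->
    (s_ n - t)^-1 * (f (s_ n) - f t) @[n --> \oo] --> l.
Proof.
split.
  move=> h s_ sT st s_t; apply: cvg_comp h => //.
  move=> A /near_within_punctured[d d0 H].
  move/cvgrPdist_lt : s_t => /(_ d d0); apply: filterS => n sd.
  by apply: H => //; [exact: sT|rewrite distrC].
move=> h; apply/cvgrPdist_le => e e0; apply/near_within_punctured.
apply: contrapT => /forall2NP H.
have /choice[s_ Hs] : forall n : nat, exists s, [/\ s \in `[0, T], s != t,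
    `|s - t| < n.+1%:R^-1 & ~ `|l - (s - t)^-1 * (f s - f t)| <= e].
  move=> n; have [|/existsNP[s /not_implyP[sT /not_implyP[st /not_implyP[sd sH]]]]] := H n.+1%:R^-1.
    by rewrite invr_gt0 ltr0n.
  by exists s.
have : s_ n @[n --> \oo] --> t.
  apply/cvgrPdist_lt => r r0.
  have := @near_infty_natSinv_lt R (PosNum r0); apply: filterS => n /= nr.
  have [_ _ + _] := Hs n; rewrite distrC => /lt_trans; apply.
  exact: nr.
move=> /(h s_ (fun n => let: And4 a _ _ _ := Hs n in a)
            (fun n => let: And4 _ a _ _ := Hs n in a)).
move/cvgrPdist_le => /(_ e e0) [N _ /(_ N (leqnn _))].
by have [_ _ _] := Hs N.
Qed.

(** Since t may be an endpoint, the step goes right in the first half of [0, T] and left in the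
    second. This makes derivatives within [0, T] unique. *)
Lemma exists_punctured t d : 0 < T -> t \in `[0, T] -> 0 < d ->
  exists s, [/\ s \in `[0, T], s != t & `|s - t| < d].
Proof.
rewrite in_itv/= => T0 /andP[t0 tT] d0.
pose m := Num.min d T / 2.
have m0 : 0 < m by rewrite divr_gt0// lt_min d0.
have md : m < d.
  by rewrite ltr_pdivrMr// (@le_lt_trans _ _ d)// ?ge_min ?lexx// mulr_natr mulr2n ltrDl.
have mT : m <= T / 2 by rewrite ler_pM2r ?ge_min ?lexx ?orbT// invr_gt0.
have [tT2|tT2] := leP t (T / 2).
  exists (t + m); rewrite in_itv/= addrAC subrr add0r gtr0_norm//; split => //.
    by apply/andP; split; lra.
  by rewrite -subr_eq0 addrAC subrr add0r gt_eqF.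
exists (t - m); rewrite in_itv/= addrAC subrr add0r normrN gtr0_norm//; split => //.
  by apply/andP; split; lra.
by rewrite -subr_eq0 addrAC subrr add0r oppr_eq0 gt_eqF.
Qed.

Lemma is_time_deriv_unique f t l l' : 0 < T -> t \in `[0, T] ->
  is_time_deriv T f t l -> is_time_deriv T f t l' -> l = l'.
Proof.
move=> T0 tT /is_time_derivP fl /is_time_derivP fl'.
apply/eqP; rewrite -subr_eq0 -normr_eq0; apply/eqP/le_anti.
rewrite normr_ge0 andbT; apply/ler_addgt0Pl => e e0; rewrite addr0.
have e2 : 0 < e / 2 by rewrite divr_gt0.
have [d d0 H] := fl _ e2; have [d' d'0 H'] := fl' _ e2.
have [|s [sT st]] := exists_punctured T0 tT (d := Num.min d d'); first by rewrite lt_min d0.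
rewrite lt_min => /andP[sd sd'].
have st0 : 0 < `|s - t| by rewrite normr_gt0 subr_eq0.
rewrite -(ler_pM2r st0) -normrM.
have -> : (l - l') * (s - t) =
  (f s - f t - l' * (s - t)) - (f s - f t - l * (s - t)) by ring.
rewrite (le_trans (ler_normB _ _))// {1}(splitr e) mulrDl.
by rewrite lerD// ?H' ?H.
Qed.

Lemma time_derivE f t l : 0 < T -> t \in `[0, T] ->
  is_time_deriv T f t l -> time_deriv T f t = l.
Proof.
move=> T0 tT fl; rewrite /time_deriv; case: xgetP => [l' -> /= fl'|/(_ l)//].
exact: (is_time_deriv_unique T0 tT fl' fl).
Qed.

Lemma time_derivP f t :
  time_deriv T f t = 0 \/ is_time_deriv T f t (time_deriv T f t).
Proof.
by rewrite /time_deriv; case: xgetP => [l -> /= fl|_]; [right|left].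
Qed.

Lemma is_time_deriv_locally_constant f t :
  (exists2 d, 0 < d & forall s, s \in `[0, T] -> `|s - t| < d -> f s = f t) ->
  is_time_deriv T f t 0.
Proof.
move=> [d d0 fd]; apply/is_time_derivP => e e0; exists d => // s sT sd.
by rewrite fd// mul0r subr0 subrr normr0 mulr_ge0// ltW.
Qed.

Lemma is_time_deriv_continuous f t l : is_time_deriv T f t l ->
  forall e, 0 < e -> exists2 d, 0 < d & forall s, s \in `[0, T] ->
    `|s - t| < d -> `|f s - f t| < e.
Proof.
move=> /is_time_derivP /(_ _ ltr01)[d d0 H] e e0.
exists (Num.min d (e / (`|l| + 1))); first by rewrite lt_min d0 divr_gt0.
move=> s sT; rewrite lt_min => /andP[/(H _ sT) sd].
rewrite ltr_pdivlMr//; apply: le_lt_trans.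
rewrite -[f s - f t](subrK (l * (s - t))) (le_trans (ler_normD _ _))//.
by rewrite normrM [leRHS]mulrC mulrDl addrC lerD2l.
Qed.

Lemma is_time_deriv_cst c t : is_time_deriv T (fun=> c) t 0.
Proof. by apply: is_time_deriv_locally_constant; exists 1. Qed.

Lemma is_time_derivD f g t l m : is_time_deriv T f t l -> is_time_deriv T g t m ->
  is_time_deriv T (fun s => f s + g s) t (l + m).
Proof.
move=> /is_time_derivP fl /is_time_derivP gm; apply/is_time_derivP => e e0.
have e2 : 0 < e / 2 by rewrite divr_gt0.
have [d d0 H] := fl _ e2; have [d' d'0 H'] := gm _ e2.
exists (Num.min d d'); first by rewrite lt_min d0.
move=> s sT; rewrite lt_min => /andP[sd sd'].
have -> : f s + g s - (f t + g t) - (l + m) * (s - t) =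
  (f s - f t - l * (s - t)) + (g s - g t - m * (s - t)) by ring.
rewrite (le_trans (ler_normD _ _))// {1}(splitr e) mulrDl.
by rewrite lerD// ?H' ?H.
Qed.

Lemma is_time_derivM f g t l m : is_time_deriv T f t l -> is_time_deriv T g t m ->
  is_time_deriv T (fun s => f s * g s) t (l * g t + f t * m).
Proof.
move=> fl gm; rewrite /is_time_deriv.
have gc : g s @[s --> within `[0, T]%classic t^'] --> g t.
  apply/cvgrPdist_lt => e e0; apply/near_within_punctured.
  have [d d0 H] := is_time_deriv_continuous gm e0.
  by exists d => // s sT st sd; rewrite distrC; exact: H.
rewrite (_ : (fun s => _) = (fun s => (s - t)^-1 * (f s - f t) * g s +
    f t * ((s - t)^-1 * (g s - g t)))); last by apply/funext => s; ring.
exact: cvgD (cvgM fl gc) (cvgM (cvg_cst (f t)) gm).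
Qed.

Lemma is_time_derivZ c f t l : is_time_deriv T f t l ->
  is_time_deriv T (fun s => c * f s) t (c * l).
Proof.
move=> fl; have := is_time_derivM (is_time_deriv_cst c t) fl.
by rewrite mul0r add0r.
Qed.

Lemma is_time_derivB f g t l m : is_time_deriv T f t l -> is_time_deriv T g t m ->
  is_time_deriv T (fun s => f s - g s) t (l - m).
Proof.
move=> fl gm; have := is_time_derivD fl (@is_time_derivZ (-1) _ _ _ gm).
by rewrite mulN1r; under eq_fun do rewrite mulN1r.
Qed.

Lemma is_time_deriv_sum (I : Type) (r : seq I) (f : I -> R -> R) t (l : I -> R) :
  (forall i, is_time_deriv T (f i) t (l i)) ->
  is_time_deriv T (fun s => \sum_(i <- r) f i s) t (\sum_(i <- r) l i).
Proof.
move=> fl; elim: r => [|i r IH].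
  by rewrite big_nil; under eq_fun do rewrite big_nil; exact: is_time_deriv_cst.
rewrite big_cons; under eq_fun do rewrite big_cons.
exact: is_time_derivD.
Qed.

Lemma derivable_approx (h : R -> R) x : derivable h x 1 ->
  forall e, 0 < e -> exists2 d, 0 < d & forall z, `|z - x| < d ->
    `|h z - h x - h^`()%classic x * (z - x)| <= e * `|z - x|.
Proof.
move=> dh e e0.
have : (fun k => k^-1 *: ((h \o shift x) (k *: 1) - h x)) @ 0^' --> h^`()%classic x.
  by rewrite derive1E; exact: dh.
move=> /cvgrPdist_le /(_ e e0) => /nbhs_ballP[d /= d0 H].
exists d => // z zd.
have [->|zx] := eqVneq z x; first by rewrite !subrr mulr0 subr0 normr0 mulr0.
have zx0 : z - x != 0 by rewrite subr_eq0.
have := H (z - x); rewrite /ball/= sub0r normrN => /(_ zd zx0).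
rewrite /shift/= [_ *: 1]mulr1 subrK distrC /GRing.scale/=.
rewrite -(@ler_pM2r _ `|z - x|) ?normr_gt0// -normrM mulrBl.
by rewrite [_^-1 * _ * _]mulrAC mulVf// mul1r.
Qed.

Lemma is_time_deriv_comp (h : R -> R) f t l : is_time_deriv T f t l ->
  derivable h (f t) 1 ->
  is_time_deriv T (fun s => h (f s)) t (h^`()%classic (f t) * l).
Proof.
move=> fl dh; apply/is_time_derivP => e e0.
set h' := h^`()%classic (f t).
(* [e1] pays for the remainder of [h], measured against |f s - f t| <= (|l| + 1)|s - t|; the second
   entry of the next minimum pays for the remainder of [f] multiplied by h', and its first entry, 1,
   yields that Lipschitz bound. *)
have e1 : 0 < e / 2 / (`|l| + 1) by rewrite !divr_gt0.
have e2 : 0 < Num.min 1 (e / 2 / (`|h'| + 1)) by rewrite lt_min ltr01 !divr_gt0.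
have [d d0 H] := derivable_approx dh e1.
have [d1 d10 H1] := is_time_deriv_continuous fl d0.
have [d2 d20 H2] := (is_time_derivP _ _ _).1 fl _ e2.
exists (Num.min d1 d2); first by rewrite lt_min d10.
move=> s sT; rewrite lt_min => /andP[sd1 sd2].
have := H2 s sT sd2; set A := f s - f t - _ => A2.
have A21 : `|A| <= `|s - t|.
  by rewrite (le_trans A2)// ler_piMl// ge_min lexx.
have A22 : (`|h'| + 1) * `|A| <= e / 2 * `|s - t|.
  rewrite mulrC -ler_pdivlMr// (le_trans A2)// [leRHS]mulrAC ler_wpM2r//.
  by rewrite ge_min lexx orbT.
have fL : `|f s - f t| <= (`|l| + 1) * `|s - t|.
  rewrite -[f s - f t](subrK (l * (s - t))) (le_trans (ler_normD _ _))//.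
  by rewrite normrM mulrDl mul1r addrC lerD2l.
have -> : h (f s) - h (f t) - h' * l * (s - t) =
  (h (f s) - h (f t) - h' * (f s - f t)) + h' * A by rewrite /A; ring.
rewrite (le_trans (ler_normD _ _))// {1}(splitr e) mulrDl lerD//.
  rewrite (le_trans (H _ (H1 _ sT sd1)))//.
  by rewrite (le_trans (ler_wpM2l (ltW e1) fL))// mulrA divfK ?lt0r_neq0.
by rewrite normrM (le_trans _ A22)// ler_wpM2r// lerDl.
Qed.

Lemma is_time_deriv_le0 f t l : 0 < T -> t \in `[0, T] ->
  (forall s s', s \in `[0, T] -> s' \in `[0, T] -> s <= s' -> f s' <= f s) ->
  is_time_deriv T f t l -> l <= 0.
Proof.
move=> T0 tT fd fl; rewrite leNgt; apply/negP => l0.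
have l2 : 0 < l / 2 by rewrite divr_gt0.
have [d d0 H] := (is_time_derivP _ _ _).1 fl _ l2.
have [s [sT st sd]] := exists_punctured T0 tT d0.
have := H s sT sd; rewrite ler_norml => /andP[].
have [st'|st'] := leP s t.
  rewrite ler0_norm ?subr_le0// => _; have := fd s t sT tT st'.
  have : 0 < t - s by rewrite subr_gt0 lt_neqAle st.
  by move: l0; nra.
rewrite gtr0_norm ?subr_gt0// => + _; have := fd t s tT sT (ltW st').
by move: l0; rewrite -subr_gt0 in st'; nra.
Qed.

End time_derivative.

(** * Running maxima *)

Section running_maximum.
Context (R : realType).
Implicit Types (T s t e c : R) (f : R -> R).

Definition runmax f t : R := sup [set f tau | tau in `[0, t]%classic].

Lemma within_continuousP T f : {within `[0, T]%classic, continuous f} <->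
  forall t, t \in `[0, T] -> forall e, 0 < e ->
    exists2 d, 0 < d & forall s, s \in `[0, T] -> `|s - t| < d -> `|f s - f t| < e.
Proof.
split.
  move=> /subspace_continuousP fc t tT e e0.
  have := fc t tT => /cvgrPdist_lt /(_ e e0) /nbhs_ballP[d /= d0 H].
  exists d => // s sT sd; rewrite distrC; apply: H => //.
  by rewrite /ball/= distrC.
move=> H; apply/subspace_continuousP => t tT; apply/cvgrPdist_lt => e e0.
have [d d0 Hd] := H t tT e e0; apply/nbhs_ballP; exists d => //= s sd sT.
by rewrite distrC; apply: Hd => //; rewrite distrC.
Qed.

Definition clip t r : R := Num.max 0 (Num.min t r).

Lemma clip_itv t r : 0 <= t -> clip t r \in `[0, t].
Proof.
by move=> t0; rewrite in_itv/= /clip le_max lexx/= ge_max t0/= ge_min lexx.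
Qed.

Lemma clip_dist t r tau : tau \in `[0, t] -> `|clip t r - tau| <= `|r - tau|.
Proof.
rewrite in_itv/= /clip => /andP[tau0 taut].
have [tr|rt] := leP t r.
  rewrite max_r ?(le_trans tau0)// !ger0_norm ?subr_ge0 ?(le_trans taut)//.
  by rewrite lerD2r.
have [r0|r0] := leP r 0; last by [].
rewrite sub0r normrN ger0_norm// ler0_norm ?subr_le0 ?(le_trans r0)//; lra.
Qed.

(** The rationals, enumerated by [unpickle] and projected onto [0, t]: a dense sequence that never
    leaves the interval. It reduces suprema and almost-everywhere statements over all times to
    countable ones. *)
Definition clip_seq t (k : nat) : R := clip t (ratr (odflt 0 (unpickle k : option rat))).

Lemma clip_seq_itv t k : 0 <= t -> clip_seq t k \in `[0, t].
Proof. exact: clip_itv. Qed.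

Lemma clip_seq_dense t tau e : tau \in `[0, t] -> 0 < e ->
  exists k, `|clip_seq t k - tau| < e.
Proof.
move=> taut e0.
have [q] : exists q : rat, ratr q \in `]tau - e, tau + e[.
  by apply: rat_in_itvoo; lra.
rewrite in_itv/= => /andP[q1 q2].
exists (pickle q); rewrite /clip_seq pickleK/=.
by rewrite (le_lt_trans (clip_dist _ taut))// ltr_distl q1.
Qed.

Section fixed_function.
Variables (T : R) (f : R -> R).
Hypothesis fc : {within `[0, T]%classic, continuous f}.

Lemma has_sup_runmax t : t \in `[0, T] ->
  has_sup [set f tau | tau in `[0, t]%classic].
Proof.
rewrite in_itv/= => /andP[t0 tT]; split.
  by exists (f 0), 0 => //=; rewrite in_itv/= lexx.
have [c _ fcM] := EVT_max (le_trans t0 tT) fc.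
exists (f c) => _ [tau /= taut <-]; apply: fcM.
by move: taut; rewrite !in_itv/= => /andP[-> /le_trans]; exact.
Qed.

Lemma runmax_ub t tau : t \in `[0, T] -> tau \in `[0, t] -> f tau <= runmax f t.
Proof.
move=> /has_sup_runmax tT taut; apply: sup_ubound; first exact: (proj2 tT).
by exists tau.
Qed.

Lemma runmax_le t c : t \in `[0, T] ->
  (forall tau, tau \in `[0, t] -> f tau <= c) -> runmax f t <= c.
Proof.
move=> /has_sup_runmax tT fcc; apply: ge_sup; first exact: (proj1 tT).
by move=> _ [tau taut <-]; exact: fcc.
Qed.

Lemma runmax_homo s t : s \in `[0, T] -> t \in `[0, T] -> s <= t ->
  runmax f s <= runmax f t.
Proof.
move=> sT tT st; apply: runmax_le => // tau taus; apply: runmax_ub => //.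
by move: taus; rewrite !in_itv/= => /andP[-> /le_trans]; exact.
Qed.

Lemma runmax_split s t c : s \in `[0, T] -> t \in `[0, T] -> s <= t ->
  runmax f s <= c -> (forall tau, s <= tau -> tau <= t -> f tau <= c) ->
  runmax f t <= c.
Proof.
move=> sT tT st sc stc; apply: runmax_le => // tau; rewrite in_itv/= => /andP[tau0 taut].
have [taus|taus] := leP tau s; last by apply: stc => //; exact: ltW.
by rewrite (le_trans _ sc)// runmax_ub// in_itv/= tau0.
Qed.

(** The hypothesis compares [f] with its value at the single point t, so for s < t two values of [f]
    are compared through f t; hence the factor 2. *)
Lemma runmax_local_lipschitz t L d : t \in `[0, T] ->
  (forall s, s \in `[0, T] -> `|s - t| < d -> `|f s - f t| <= L * `|s - t|) ->
  forall s, s \in `[0, T] -> `|s - t| < d ->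
    `|runmax f s - runmax f t| <= 2 * L * `|s - t|.
Proof.
move=> tT fL s sT sd.
have L0 : 0 <= L * `|s - t| by rewrite (le_trans _ (fL s sT sd)).
have [st|ts] := leP s t.
  rewrite ler0_norm ?subr_le0 ?runmax_homo// opprB lerBlDl.
  apply: (runmax_split sT tT st); first by rewrite lerDl -mulrA mulr_ge0.
  move=> tau stau taut.
  have tauT : tau \in `[0, T].
    by move: sT tT; rewrite !in_itv/= => /andP[? ?] /andP[? ?]; apply/andP; split; lra.
  have tauS : `|tau - t| <= `|s - t|.
    by rewrite !ler0_norm ?subr_le0//; lra.
  have Mfs : f s <= runmax f s.
    by apply: runmax_ub => //; move: sT; rewrite !in_itv/= lexx => /andP[->].
  have := fL _ tauT (le_lt_trans tauS sd); have := fL _ sT sd.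
  rewrite ler_distl ler_distl => /andP[sl _] /andP[_ tl].
  have : L * `|tau - t| <= L * `|s - t|.
    (* Only the product of [L] and |s - t| is known to be nonnegative, so for s = t the sign of [L]
       is open and the claim is checked directly. *)
    have [st'|st'] := eqVneq s t.
      have -> : tau = t by apply/le_anti; rewrite taut -[X in X <= _]st' stau.
      by rewrite st'.
    apply: ler_wpM2l => //; move: L0; rewrite pmulr_lge0// normr_gt0 subr_eq0//.
  lra.
rewrite ger0_norm; last by rewrite subr_ge0; apply: runmax_homo => //; exact: ltW.
rewrite lerBlDl.
apply: (runmax_split tT sT (ltW ts)); first by rewrite lerDl -mulrA mulr_ge0.
move=> tau ttau taus.
have tauT : tau \in `[0, T].
  by move: sT tT; rewrite !in_itv/= => /andP[? ?] /andP[? ?]; apply/andP; split; lra.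
have tauS : `|tau - t| <= `|s - t|.
  by rewrite !ger0_norm ?subr_ge0//; [lra|exact: ltW].
have Mft : f t <= runmax f t.
  by apply: runmax_ub => //; move: tT; rewrite !in_itv/= lexx => /andP[->].
have := fL _ tauT (le_lt_trans tauS sd).
rewrite ler_distl => /andP[_ tl].
have : L * `|tau - t| <= L * `|s - t|.
  apply: ler_wpM2l => //; move: L0; rewrite pmulr_lge0// normr_gt0 subr_eq0 gt_eqF//.
lra.
Qed.

(** Meant for a = sqrt|y - x| and c = r^+: the profile of case (b) is 1 up to r^+, hence sees the
    running maximum only through this truncation. *)
Lemma runmax_max_locally_constant t a c d : 0 <= a -> t \in `[0, T] ->
  (forall s, s \in `[0, T] -> `|s - t| < d -> a * f s <= c) ->
  forall s, s \in `[0, T] -> `|s - t| < d ->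
    Num.max (a * runmax f s) c = Num.max (a * runmax f t) c.
Proof.
move=> a0 tT fac.
suff H s s' : s \in `[0, T] -> s' \in `[0, T] -> s <= s' ->
    (forall tau, s <= tau -> tau <= s' -> a * f tau <= c) ->
    Num.max (a * runmax f s) c = Num.max (a * runmax f s') c.
  move=> s sT sd; have [st|ts] := leP s t; [|apply/esym]; apply: H => //; rewrite ?(ltW ts)//.
    move=> tau stau taut; apply: fac.
      by move: sT tT; rewrite !in_itv/= => /andP[? ?] /andP[? ?]; apply/andP; split; lra.
    rewrite (le_lt_trans _ sd)// !ler0_norm ?subr_le0//; lra.
  move=> tau ttau taus; apply: fac.
    by move: sT tT; rewrite !in_itv/= => /andP[? ?] /andP[? ?]; apply/andP; split; lra.
  rewrite (le_lt_trans _ sd)// !ger0_norm ?subr_ge0//; [lra|exact: ltW].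
move=> sT s'T ss' ac; apply/le_anti; rewrite !ge_max !le_max !lexx !orbT !andbT.
apply/andP; split; first by rewrite ler_wpM2l// runmax_homo.
move: a0; rewrite le_eqVlt => /predU1P[<-|a0]; first by rewrite !mul0r lexx.
rewrite -le_max mulrC -ler_pdivlMr//.
apply: (runmax_split sT s'T ss').
  by rewrite ler_pdivlMr// mulrC le_max lexx.
by move=> tau tau1 tau2; rewrite ler_pdivlMr// mulrC le_max ac ?orbT.
Qed.

(* A running maximum can fail to be differentiable only at the right end of one
   of its plateaus, hence at countably many times. *)
Lemma runmax_differentiable t l : 0 < t -> t < T ->
  is_time_deriv T f t l ->
  (forall q, q \in `[0, t[ -> runmax f q < runmax f t) \/
  (exists s, [/\ t < s, s <= T & runmax f s = runmax f t]) ->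
  exists m, is_time_deriv T (runmax f) t m.
Proof.
move=> t0 tT fl plateau.
have tT' : t \in `[0, T] by rewrite in_itv/=; apply/andP; split; exact: ltW.
have tt : t \in `[0, t] by rewrite in_itv/= lexx andbT; exact: ltW.
(* If f t is below the maximum so far, the values of [f] near t do not influence the maximum, which
   is constant around t. *)
have := runmax_ub tT' tt; rewrite le_eqVlt => /predU1P[ftM|ftM]; last first.
  exists 0; apply: is_time_deriv_locally_constant.
  have [|d d0 H] := is_time_deriv_continuous fl (e := runmax f t - f t).
    by rewrite subr_gt0.
  exists (Num.min d t); first by rewrite lt_min d0.
  move=> s sT; rewrite lt_min => /andP[sd st'].
  have fM tau : tau \in `[0, T] -> `|tau - t| <= `|s - t| -> f tau < runmax f t.
    move=> tauT taus; have := H tau tauT (le_lt_trans taus sd).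
    rewrite ltr_distl; lra.
  apply/le_anti/andP; have [st|ts] := leP s t.
    split; first exact: runmax_homo.
    rewrite leNgt; apply/negP => Mst.
    have [c fcM] : exists2 c, c < runmax f t & forall tau, s <= tau -> tau <= t -> f tau <= c.
      have sub : `[s, t]%classic `<=` `[0, T]%classic.
        by move=> x; move: sT; rewrite /= !in_itv/= => /andP[? ?] /andP[? ?]; apply/andP; split; lra.
      have [c ct fcmax] := EVT_max st (continuous_subspaceW sub fc).
      exists (f c) => [|tau stau taut]; last by apply: fcmax; rewrite in_itv/= stau.
      apply: fM; first exact: sub.
      by move: ct; rewrite in_itv/= => /andP[? ?]; rewrite !ler0_norm ?subr_le0//; lra.
    move=> Hc; have : runmax f t <= Num.max (runmax f s) c.
      apply: (runmax_split sT tT' st); first by rewrite le_max lexx.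
      by move=> tau t1 t2; rewrite le_max Hc ?orbT.
    by rewrite leNgt gt_max Mst fcM.
  split; last by apply: runmax_homo => //; exact: ltW.
  apply: (runmax_split tT' sT (ltW ts)) => // tau ttau taus; apply/ltW/fM.
    by move: sT; rewrite !in_itv/= => /andP[? ?]; apply/andP; split; lra.
  by rewrite !ger0_norm ?subr_ge0//; [lra|exact: ltW].
have M_ge s : s \in `[0, T] -> f s <= runmax f s.
  by move=> sT; apply: runmax_ub => //; move: sT; rewrite !in_itv/= lexx => /andP[->].
have fle s : s \in `[0, t] -> f s <= f t by rewrite ftM; exact: runmax_ub.
move: (fl) => /is_time_derivP fl'.
(* Now f t is the largest value on [0, t], so difference quotients from the left are nonnegative. *)
have l0 : 0 <= l.
  rewrite leNgt; apply/negP => l0.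
  have [|d d0 H] := fl' (- l / 2); first by rewrite divr_gt0// oppr_gt0.
  pose s := t - Num.min (d / 2) t.
  have m0 : 0 < Num.min (d / 2) t by rewrite lt_min t0 divr_gt0.
  have md : Num.min (d / 2) t <= d / 2 by rewrite ge_min lexx.
  have mt : Num.min (d / 2) t <= t by rewrite ge_min lexx orbT.
  have st : `|s - t| = Num.min (d / 2) t by rewrite /s addrAC subrr add0r normrN gtr0_norm.
  have sT : s \in `[0, T] by rewrite in_itv/= /s; apply/andP; split; lra.
  have := H s sT; rewrite st => /(_ ltac:(lra)).
  have : f s <= f t by apply: fle; rewrite in_itv/= /s; apply/andP; split; lra.
  rewrite ler_norml => fst /andP[+ _].
  have -> : s - t = - Num.min (d / 2) t by rewrite /s; ring.
  by move: m0 fst l0; move: (Num.min _ _) => m *; nra.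
(* Lower bounds for the running maximum come from [f] itself, and the upper bound to the right of t
   from l >= 0; only an upper bound to the left is left to show. *)
suff : (forall e, 0 < e -> exists2 d, 0 < d & forall s, 0 <= s -> s <= t ->
    `|s - t| < d -> runmax f s <= f t - (l - e) * (t - s)).
  move=> left; exists l; apply/is_time_derivP => e e0.
  have [d1 d10 H1] := left e e0; have [d2 d20 H2] := fl' e e0.
  exists (Num.min d1 d2); first by rewrite lt_min d10.
  move=> s sT; rewrite lt_min => /andP[sd1 sd2]; rewrite -ftM.
  have := H2 s sT sd2; rewrite !ler_norml => /andP[fs1 _].
  have := M_ge s sT; have [st|ts] := leP s t => Ms.
    have s0 : 0 <= s by move: sT; rewrite in_itv/= => /andP[].
    have := H1 s s0 st sd1; move: fs1; rewrite ler0_norm ?subr_le0// => *.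
    apply/andP; split; lra.
  move: fs1; rewrite gtr0_norm ?subr_gt0// => fs1; apply/andP; split; first lra.
  rewrite lerBlDr lerBlDr.
  apply: (runmax_split tT' sT (ltW ts)).
    rewrite -ftM addrC lerDl; apply: addr_ge0; apply: mulr_ge0 => //; lra.
  move=> tau ttau taus.
  have tauT : tau \in `[0, T].
    by move: sT; rewrite !in_itv/= => /andP[? ?]; apply/andP; split; lra.
  have taud : `|tau - t| < d2.
    by apply: le_lt_trans sd2; rewrite !ger0_norm ?subr_ge0//; [lra|exact: ltW].
  have := H2 tau tauT taud; rewrite ler_norml => /andP[_].
  rewrite ger0_norm ?subr_ge0// => ftau.
  have : l * (tau - t) <= l * (s - t) by rewrite ler_wpM2l// lerD2r.
  have : e * (tau - t) <= e * (s - t) by apply: ler_wpM2l; [exact: ltW|rewrite lerD2r].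
  lra.
move=> e e0; have [le|el] := leP l e.
  exists 1 => // s s0 st _; have sT : s \in `[0, T] by rewrite in_itv/= s0/=; lra.
  have : runmax f s <= f t by rewrite ftM runmax_homo.
  have : (l - e) * (t - s) <= 0 by rewrite mulr_le0_ge0 ?subr_le0 ?subr_ge0.
  lra.
case: plateau => [noplat|[s' [ts' s'T Ms']]]; last first.
  (* here [l = 0] *)
  suff : l <= 0 by lra.
  rewrite leNgt; apply/negP => lpos.
  have [|d d0 H] := fl' (l / 2); first by rewrite divr_gt0.
  pose m := Num.min (d / 2) (s' - t).
  have m0 : 0 < m by rewrite lt_min subr_gt0 ts' divr_gt0.
  have md : m <= d / 2 by rewrite ge_min lexx.
  have ms' : m <= s' - t by rewrite ge_min lexx orbT.
  have st : `|t + m - t| = m by rewrite addrAC subrr add0r gtr0_norm.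
  have sT : t + m \in `[0, T] by rewrite in_itv/=; apply/andP; split; lra.
  have := H _ sT; rewrite st => /(_ ltac:(lra)).
  have : f (t + m) <= f t.
    by rewrite ftM -Ms'; apply: runmax_ub => //; rewrite in_itv/=; apply/andP; split; lra.
  rewrite ler_norml => fst /andP[+ _].
  have -> : t + m - t = m by ring.
  by move: m0 fst lpos; nra.
(* Here the maximum at the earlier time [q] is strictly below f t. For s close to t this gap exceeds
   (l - e)(t - s), which controls the times before [q]; between [q] and s the expansion of [f] at t
   does. *)
have [d d0 H] := fl' e e0.
pose q := t - Num.min (d / 2) t.
have m0 : 0 < Num.min (d / 2) t by rewrite lt_min t0 divr_gt0.
have md : Num.min (d / 2) t <= d / 2 by rewrite ge_min lexx.
have mt : Num.min (d / 2) t <= t by rewrite ge_min lexx orbT.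
have q0 : 0 <= q by rewrite /q; lra.
have qt : q < t by rewrite /q; lra.
have qT : q \in `[0, T] by rewrite in_itv/= q0/=; lra.
have Mq : runmax f q < f t by rewrite ftM; apply: noplat; rewrite in_itv/= q0.
have le0 : 0 < l - e by rewrite subr_gt0.
exists (Num.min (t - q) ((f t - runmax f q) / (l - e))).
  by rewrite lt_min subr_gt0 qt divr_gt0// subr_gt0.
move=> s s0 st; rewrite lt_min ler0_norm ?subr_le0// opprB => /andP[sq].
rewrite ltr_pdivlMr// => sM.
have sT : s \in `[0, T] by rewrite in_itv/= s0/=; lra.
have qs : q <= s by lra.
apply: (runmax_split qT sT qs); first by rewrite mulrC; lra.
move=> tau qtau taus.
have tauT : tau \in `[0, T] by rewrite in_itv/=; apply/andP; split; lra.
have taut : tau <= t by rewrite (le_trans taus).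
have taud : `|tau - t| < d.
  by rewrite ler0_norm ?subr_le0// opprB; move: qtau; rewrite /q; lra.
have := H tau tauT taud; rewrite [`|tau - t|]ler0_norm ?subr_le0//.
rewrite ler_norml => /andP[_].
have : (l - e) * (t - s) <= (l - e) * (t - tau) by rewrite ler_pM2l// lerD2l lerN2.
lra.
Qed.

End fixed_function.

(** By continuity in time, the supremum over [0, t] is the supremum over the sequence
    [clip_seq t]. *)
Lemma measurable_runmax d (X : measurableType d) (D : set X) (T t : R)
    (F : R -> X -> R) : t \in `[0, T] -> measurable D ->
  (forall p, D p -> {within `[0, T]%classic, continuous (F ^~ p)}) ->
  (forall s, s \in `[0, T] -> measurable_fun D (F s)) ->
  measurable_fun D (fun p => runmax (F ^~ p) t).
Proof.
move=> tT mD Fc mF.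
have t0 : 0 <= t by move: tT; rewrite in_itv/= => /andP[].
have sub s : s \in `[0, t] -> s \in `[0, T].
  by move: tT; rewrite !in_itv/= => /andP[? ?] /andP[? ?]; apply/andP; split; lra.
pose h k p := F (clip_seq t k) p.
have ub p : D p -> has_ubound (range (h ^~ p)).
  move=> Dp; exists (runmax (F ^~ p) t) => _ [k _ <-].
  exact: (runmax_ub (Fc p Dp) tT (clip_seq_itv k t0)).
apply: (eq_measurable_fun (fun p => sups (h ^~ p) 0)); last first.
  apply: measurable_fun_sups => [p Dp|k _].
    exact: ub.
  exact: (mF _ (sub _ (clip_seq_itv k t0))).
move=> p /set_mem Dp; apply/le_anti/andP; split.
  apply: ge_sup; first by exists (h 0%N p), 0%N.
  move=> _ [k _ <-]; exact: (runmax_ub (Fc p Dp) tT (clip_seq_itv k t0)).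
apply: (runmax_le (Fc p Dp) tT) => tau taut; apply/ler_addgt0Pl => e e0.
have [d0 d00 H] := (within_continuousP _ _).1 (Fc p Dp) tau (sub _ taut) e e0.
have [k kd] := clip_seq_dense taut d00.
have := H _ (sub _ (clip_seq_itv k t0)) kd; rewrite ltr_distl => /andP[+ _].
have : h k p <= sups (h ^~ p) 0.
  by apply: sup_ubound; [apply/has_ubound_sdrop; exact: ub|exists k].
rewrite /h; lra.
Qed.

End running_maximum.

(** * Differentiation and measurability of parameter integrals *)

Section dominated.
Context d (X : measurableType d) (R : realType).
Variables (mu : {measure set X -> \bar R}) (D : set X).
Hypothesis mD : measurable D.

(** The limit [f] may fail to be measurable. Multiplied by the indicator of the complement of the
    exceptional null set, it becomes an everywhere limit of measurable functions; this is [f']. *)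
Lemma dominated_convergence_ae (f_ : nat -> X -> R) (f g : X -> R) :
  (forall n, measurable_fun D (f_ n)) ->
  {ae mu, forall x, D x -> f_ n x @[n --> \oo] --> f x} ->
  mu.-integrable D (EFin \o g) ->
  (forall n, {ae mu, forall x, D x -> `|f_ n x| <= g x}) ->
  exists f' : X -> R, [/\ mu.-integrable D (EFin \o f'),
    {ae mu, forall x, D x -> f x = f' x} &
    \int[mu]_(x in D) f_ n x @[n --> \oo] --> \int[mu]_(x in D) f' x].
Proof.
move=> mf_ f_f ig f_g; have [N [mN N0 subN]] := f_f.
have mNC : measurable (~` N) by exact: measurableC.
pose f' x := f x * \1_(~` N) x.
have ff' : {ae mu, forall x, D x -> f x = f' x}.
  exists N; split => // x /= /not_implyP[Dx]; apply: contra_notP => Nx.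
  by rewrite /f' indicE mem_set// mulr1.
have mf' : measurable_fun D f'.
  apply: (@measurable_fun_cvg _ _ _ _ (fun n x => f_ n x * \1_(~` N) x)).
    move=> n; apply: measurable_funM => //; exact: measurable_indic.
  move=> x Dx; rewrite /f' indicE.
  have [/set_mem Nx|_] := boolP (x \in ~` N).
    apply: cvgM; last exact: cvg_cst.
    by apply: contrapT => H; apply: Nx; apply: subN => /= /(_ Dx).
  by under eq_fun do rewrite mulr0; rewrite mulr0; exact: cvg_cst.
have f_f' : {ae mu, forall x, D x -> (f_ n x)%:E @[n --> \oo] --> (f' x)%:E}.
  move: f_f ff'; apply: filterS2 => x f_fx fx Dx.
  by apply: cvg_EFin; [exact: nearW|rewrite -fx//; exact: f_fx].
have f_g' : {ae mu, forall x n, D x -> (`|(f_ n x)%:E| <= (g x)%:E)%E}.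
  have : {ae mu, forall x, forall n, D x -> `|f_ n x| <= g x} by exact/ae_foralln.
  by apply: filterS => x H n Dx; rewrite lee_fin H.
have mEf_ n : measurable_fun D (fun x => (f_ n x)%:E) by exact/measurable_EFinP.
have [if' _ cvgf'] := dominated_convergence mD mEf_
  ((measurable_EFinP _ _).2 mf') f_f' ig f_g'.
exists f'; split => //; apply: fine_cvg; rewrite fineK ?integrable_fin_num//.
Qed.

(* Difference quotients are taken along sequences, so that the exceptional null
   set may depend on the sequence; [l] itself need not be measurable. *)
Lemma is_time_deriv_integral (T t delta : R) (F : R -> X -> R) (l H : X -> R) :
  0 < T -> t \in `[0, T] -> 0 < delta ->
  (forall s, s \in `[0, T] -> mu.-integrable D (EFin \o F s)) ->
  (forall s_ : R^nat, (forall n, s_ n \in `[0, T]) -> (forall n, s_ n != t) ->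
    s_ n @[n --> \oo] --> t ->
    {ae mu, forall x, D x ->
      (s_ n - t)^-1 * (F (s_ n) x - F t x) @[n --> \oo] --> l x}) ->
  mu.-integrable D (EFin \o H) ->
  (forall s, s \in `[0, T] -> s != t -> `|s - t| < delta ->
    {ae mu, forall x, D x -> `|(s - t)^-1 * (F s x - F t x)| <= H x}) ->
  is_time_deriv T (fun s => \int[mu]_(x in D) F s x) t (\int[mu]_(x in D) l x) /\
  exists2 l' : X -> R, mu.-integrable D (EFin \o l') &
    {ae mu, forall x, D x -> l x = l' x}.
Proof.
move=> T0 tT delta0 iF Fl iH FH.
have key (s_ : R^nat) : (forall n, s_ n \in `[0, T]) -> (forall n, s_ n != t) ->
    s_ n @[n --> \oo] --> t -> (forall n, `|s_ n - t| < delta) ->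
    exists l' : X -> R, [/\ mu.-integrable D (EFin \o l'),
    {ae mu, forall x, D x -> l x = l' x} &
    (s_ n - t)^-1 * (\int[mu]_(x in D) F (s_ n) x - \int[mu]_(x in D) F t x)
      @[n --> \oo] --> \int[mu]_(x in D) l x].
  move=> sT st s_t sd.
  have mf n : measurable_fun D (fun x => (s_ n - t)^-1 * (F (s_ n) x - F t x)).
    apply: measurable_funM => //; apply: measurable_funB; apply/measurable_EFinP.
      exact: measurable_int (iF _ (sT n)).
    exact: measurable_int (iF _ tT).
  have [l' [il' ll' cl']] := dominated_convergence_ae mf (Fl _ sT st s_t) iH
    (fun n => FH _ (sT n) (st n) (sd n)).
  exists l'; split => //; rewrite (Rintegral_ae_eq_arbitrary ll').
  rewrite (_ : (fun n => _ * _) = (fun n => \int[mu]_(x in D)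
    ((s_ n - t)^-1 * (F (s_ n) x - F t x))))//; apply/funext => n.
  rewrite RintegralZl//; last first.
    exact: (integrableB mD (iF _ (sT n)) (iF _ tT)).
  by rewrite RintegralB//; exact: iF.
split; last first.
  have /choice[s_ Hs] : forall n : nat, exists s,
      [/\ s \in `[0, T], s != t & `|s - t| < Num.min delta n.+1%:R^-1].
    by move=> n; apply: exists_punctured => //; rewrite lt_min delta0 invr_gt0 ltr0n.
  have [| | | |l' [il' ll' _]] := key s_; last by exists l'.
  - by move=> n; have [] := Hs n.
  - by move=> n; have [] := Hs n.
  - apply/cvgrPdist_lt => r r0.
    have := @near_infty_natSinv_lt R (PosNum r0); apply: filterS => n /= nr.
    have [_ _] := Hs n; rewrite lt_min distrC => /andP[_ /lt_trans]; apply.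
    exact: nr.
  - by move=> n; have [_ _] := Hs n; rewrite lt_min => /andP[].
apply/is_time_deriv_seqP => s_ sT st s_t.
move/cvgrPdist_lt : (s_t) => /(_ _ delta0)[N _ HN].
(* The domination holds only within [delta] of t, so the first [N] terms are dropped. *)
rewrite -(cvg_shiftn N); have [| | | |l' [_ _ //]] := key (fun n => s_ (n + N)%N).
- by move=> n; exact: sT.
- by move=> n; exact: st.
- by rewrite -(cvg_shiftn N) in s_t.
- by move=> n; rewrite distrC; apply: HN => /=; exact: leq_addl.
Qed.

End dominated.

Section time_integral.
Context d (X : measurableType d) (R : realType).
Variables (D : set X) (T t : R) (F : R -> X -> R).
Hypotheses (mD : measurable D) (tT : t \in `[0, T]).
Hypothesis Fc : forall p, D p -> {within `[0, T]%classic, continuous (F ^~ p)}.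
Hypothesis mF : forall s, s \in `[0, T] -> measurable_fun D (F s).
Hypothesis F0 : forall s p, 0 <= F s p.

Let t0 : 0 <= t. Proof. by move: tT; rewrite in_itv/= => /andP[]. Qed.
Let sub s : s \in `[0, t] -> s \in `[0, T].
Proof. by move: tT; rewrite !in_itv/= => /andP[? ?] /andP[? ?]; apply/andP; split; lra. Qed.

(* [F s] is replaced by its value at a nearby point of the dense sequence
   [clip_seq t], which depends measurably on [s]. *)
Let A n k : set R := `]clip_seq t k - n.+1%:R^-1, clip_seq t k + n.+1%:R^-1[%classic.
Let K n tau : nat := xget 0%N [set k | seqDU (A n) k tau].

Let KP n tau : tau \in `[0, t] -> seqDU (A n) (K n tau) tau.
Proof.
move=> taut; rewrite /K; case: xgetP => [k -> //|noK].
have [|k kn] := @clip_seq_dense _ t tau n.+1%:R^-1 taut.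
  by rewrite invr_gt0 ltr0n.
have : (\bigcup_k A n k) tau.
  by exists k => //; rewrite /A /= in_itv/=; move: kn; rewrite ltr_distlC.
by rewrite seqDU_bigcup_eq => -[j _ /noK].
Qed.

Let phi n (z : R * X) : R := F (clip_seq t (K n z.1)) z.2.

Let E : set (R * X) := `[0, t]%classic `*` D.

Let mE : measurable E. Proof. exact: measurableX. Qed.

Let mphi n : measurable_fun E (phi n).
Proof.
move=> _ B mB.
rewrite (_ : E `&` _ = \bigcup_k ((`[0, t]%classic `&` seqDU (A n) k) `*`
    (D `&` F (clip_seq t k) @^-1` B))).
  apply: bigcupT_measurable => k; apply: measurableX.
    apply: measurableI => //; apply: measurableD => //; first exact: measurable_itv.
    by apply: bigsetU_measurable => *; exact: measurable_itv.
  by apply: mF => //; apply: sub; exact: clip_seq_itv.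
apply/seteqP; split => [[tau p] [[/= taut Dp] Bp]|[tau p] [k _ [/= [taut Ak] [Dp Bp]]]].
  by exists (K n tau) => //; split => //; split => //; exact: KP.
split => //=; rewrite /phi/= (_ : K n tau = k)//.
have := @trivIset_seqDU _ (A n) (K n tau) k I I; apply.
by exists tau; split => //; exact: KP.
Qed.

Let phiF z : E z -> phi n z @[n --> \oo] --> F z.1 z.2.
Proof.
case: z => tau p [/= taut Dp]; apply/cvgrPdist_lt => e e0.
have [d0 d00 H] := (within_continuousP _ _).1 (Fc Dp) tau (sub taut) e e0.
have := @near_infty_natSinv_lt R (PosNum d00); apply: filterS => n /= nr.
rewrite distrC /phi/=; apply: H.
  by apply: sub; exact: clip_seq_itv.
have [+ _] := KP n taut; rewrite /A/= in_itv/= -ltr_distlC => /lt_trans; apply.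
exact: nr.
Qed.

(** Continuity in time and measurability in p give joint measurability, through the approximations
    [phi]; Tonelli's theorem then applies. *)
Lemma measurable_time_integral :
  measurable_fun D (fun p => \int[@lebesgue_measure R]_(s in `[0, t]) F s p).
Proof.
have mG : measurable_fun E (fun z => F z.1 z.2) by exact: measurable_fun_cvg mphi phiF.
have mG' : measurable_fun setT ((fun z => (F z.1 z.2)%:E) \_ E).
  by apply/(measurable_restrictT _ mE); exact/measurable_EFinP.
have G0 z : (0 <= ((fun z => (F z.1 z.2)%:E) \_ E) z)%E.
  by rewrite patchE; case: ifP => // _; rewrite lee_fin.
have := @measurable_fun_fubini_tonelli_G _ _ _ _ _ (@lebesgue_measure R) _ mG' G0.
move=> /(measurable_funTS (D := D)) mI.
apply: (measurableT_comp (f := fine)) => //.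
apply: (eq_measurable_fun _ _ mI) => p /set_mem Dp.
rewrite /fubini_G [RHS]integral_mkcond; apply: eq_integral => s _.
by rewrite !patchE in_setX/= (mem_set Dp) andbT.
Qed.

End time_integral.

(** * Essentially bounded displacements *)

Section Linf.
Context (R : realType) (n : nat).
Local Notation E := 'rV[R]_n.
Local Notation leb := (@lebesgue_rV R n).
Implicit Types (Omega : set E) (T t s : R) (u v : R -> E -> E).

(** [Lnorm] with exponent +oo is the essential supremum only if the whole space has positive
    measure. *)
Lemma lebesgue_rV_setT_gt0 : (0 < leb setT)%E.
Proof.
apply: (@lt_le_trans _ _ (leb [set x : E | forall i, `[0%R, 1%R]%classic (x ord0 i)])).
  by rewrite lebesgue_rV_cube// subr0 expr1n.
exact: le_lebesgue_rV.
Qed.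

Lemma Linf_norm_ae Omega (f : E -> E) (c : \bar R) : (Linf_norm Omega f <= c)%E ->
  {ae leb, forall x, Omega x -> ((enorm (f x))%:E <= c)%E}.
Proof.
rewrite /Linf_norm unlock lebesgue_rV_setT_gt0 => /ess_supP.
apply: filterS => x + Ox; rewrite /comp patchE mem_set// gee0_abs//.
by rewrite lee_fin enorm_ge0.
Qed.

Lemma Linf_norm_ge0 Omega (f : E -> E) : (0 <= Linf_norm Omega f)%E.
Proof. exact: Lnorm_ge0. Qed.

Lemma space_X_bounded Omega (f : E -> E) : space_X Omega f ->
  exists2 c : R, 0 <= c & {ae leb, forall x, Omega x -> forall i, `|f x ord0 i| <= c}.
Proof.
move=> [_ fy _]; exists (fine (Linf_norm Omega f)); first by rewrite fine_ge0// Linf_norm_ge0.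
have := Linf_norm_ae (lexx (Linf_norm Omega f)); apply: filterS => x + Ox i => /(_ Ox).
rewrite -[X in (_ <= X)%E]fineK ?ge0_fin_numE ?Linf_norm_ge0// lee_fin.
exact: le_trans (coord_le_enorm _ _).
Qed.

Lemma Linf_cvg0 (F : R -> \bar R) (G : set_system R) {FG : Filter G} e :
  F s @[s --> G] --> 0%E -> 0 < e -> \forall s \near G, (F s < e%:E)%E.
Proof.
move=> F0 e0; apply: (F0 [set z | (z < e%:E)%E]).
by apply: open_ereal_lt'; rewrite lte_fin.
Qed.

Lemma continuous_X_near Omega T u t e : continuous_X Omega T u -> t \in `[0, T] -> 0 < e ->
  exists2 d, 0 < d & forall s, s \in `[0, T] -> `|s - t| < d ->
    {ae leb, forall x, Omega x -> forall i, `|u s x ord0 i - u t x ord0 i| <= e}.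
Proof.
move=> uc tT e0; have [_ ut] := uc t tT.
have [d /= d0 H] := (nbhs_ballP _ _).1 (Linf_cvg0 ut e0); exists d => // s sT sd.
have /ltW/Linf_norm_ae : (Linf_norm Omega (fun x => u s x - u t x)%R < e%:E)%E.
  by apply: H => //; rewrite /ball/= distrC.
apply: filterS => x + Ox i => /(_ Ox); rewrite lee_fin; apply: le_trans.
by have := coord_le_enorm (u s x - u t x) i; rewrite !mxE.
Qed.

Lemma deriv_X_near Omega T u v t e : is_deriv_X Omega T u v -> t \in `[0, T] -> 0 < e ->
  exists2 d, 0 < d & forall s, s \in `[0, T] -> `|s - t| < d ->
    {ae leb, forall x, Omega x -> forall i,
     `|u s x ord0 i - u t x ord0 i - v t x ord0 i * (s - t)| <= e * `|s - t|}.
Proof.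
move=> uv tT e0.
have [d d0 H] := (near_within_punctured _ _ _).1 (Linf_cvg0 (uv t tT) e0); exists d => // s sT sd.
have [->|st] := eqVneq s t.
  by apply: aeW => x _ i; rewrite !subrr mulr0 subr0 normr0 mulr0.
have st0 : s - t != 0 by rewrite subr_eq0.
have /ltW/Linf_norm_ae := H s sT st sd.
apply: filterS => x + Ox i => /(_ Ox); rewrite lee_fin => Hx.
have := coord_le_enorm ((s - t)^-1 *: (u s x - u t x) - v t x) i.
rewrite !mxE => /le_trans/(_ Hx).
rewrite -(@ler_pM2r _ `|s - t|) ?normr_gt0// -normrM mulrBl.
by rewrite [_^-1 * _ * _]mulrAC mulVf// mul1r.
Qed.

Lemma time_continuous_coord Omega T u x i : time_continuous_version Omega T u ->
  Omega x -> {within `[0, T]%classic, continuous (fun s => u s x ord0 i)}.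
Proof.
move=> uc Ox; apply/subspace_continuousP => t tT.
have /subspace_continuousP/(_ t tT) := uc x Ox => ut.
by apply: (@cvg_comp _ _ _ (u ^~ x) (fun M : E => M ord0 i) _ _ _ ut); exact: coord_continuous.
Qed.

(** The estimate in X has a null set for each s. The countable union of those along [clip_seq T] is
    still null, and off it the continuity of the path extends the estimate to every s. *)
Lemma ae_deriv_near Omega T u v t e : is_deriv_X Omega T u v ->
  time_continuous_version Omega T u -> t \in `[0, T] -> 0 < e ->
  exists2 d, 0 < d & {ae leb, forall x, Omega x -> forall s, s \in `[0, T] ->
    `|s - t| < d -> forall i,
     `|u s x ord0 i - u t x ord0 i - v t x ord0 i * (s - t)| <= e * `|s - t|}.
Proof.
move=> uv uc tT e0; have [d d0 H] := deriv_X_near uv tT e0; exists d => //.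
have T0 : 0 <= T by move: tT; rewrite in_itv/= => /andP[/le_trans]; exact.
have : {ae leb, forall x k, `|clip_seq T k - t| < d -> Omega x -> forall i,
  `|u (clip_seq T k) x ord0 i - u t x ord0 i - v t x ord0 i * (clip_seq T k - t)|
    <= e * `|clip_seq T k - t|}.
  apply: ae_foralln => k; have [kd|kd] := ltP `|clip_seq T k - t| d.
    by have := H _ (clip_seq_itv k T0) kd; apply: filterS => x + _ Ox; exact.
  by apply: aeW.
apply: filterS => x Hx Ox s sT sd i.
apply/ler_addgt0Pl => r r0.
(* Replacing s by a point s' of the sequence costs at most (|v| + e)|s' - s| plus the oscillation of
   [u]; each of the two is kept below r/2. The summand 1 keeps [b] positive. *)
pose b := `|v t x ord0 i| + e + 1.
have b0 : 0 < b by rewrite ltr_wpDl// addr_ge0// ltW.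
have r2 : 0 < r / 2 by rewrite divr_gt0.
have [d1 d10 H1] := (within_continuousP _ _).1 (time_continuous_coord (i := i) uc Ox) s sT _ r2.
have [|k] := @clip_seq_dense _ T s (Num.min (Num.min d1 (d - `|s - t|)) (r / 2 / b)) sT.
  by rewrite !lt_min d10 subr_gt0 sd divr_gt0.
set s' := clip_seq T k; rewrite !lt_min => /andP[/andP[ks1 ksd] ksr].
have s'd : `|s' - t| < d.
  have -> : s' - t = (s' - s) + (s - t) by ring.
  by rewrite (le_lt_trans (ler_normD _ _))// -ltrBrDr.
have := Hx k s'd Ox i; rewrite -/s' => Hk.
have := H1 s' (clip_seq_itv k T0) ks1 => Hu.
have ksr' : b * `|s' - s| <= r / 2 by rewrite mulrC -ler_pdivlMr// ltW.
have -> : u s x ord0 i - u t x ord0 i - v t x ord0 i * (s - t) =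
  (u s' x ord0 i - u t x ord0 i - v t x ord0 i * (s' - t))
  - (u s' x ord0 i - u s x ord0 i) + v t x ord0 i * (s' - s) by ring.
rewrite (le_trans (ler_normD _ _))// normrM.
have := ler_normB (u s' x ord0 i - u t x ord0 i - v t x ord0 i * (s' - t))
  (u s' x ord0 i - u s x ord0 i) => Htri.
have : e * `|s' - t| <= e * `|s - t| + e * `|s' - s|.
  rewrite -mulrDr ler_wpM2l ?(ltW e0)//.
  have -> : s' - t = (s - t) + (s' - s) by ring.
  exact: ler_normD.
have : 0 <= `|s' - s| by [].
move: ksr'; rewrite /b !mulrDl mul1r; lra.
Qed.

Lemma ae_is_time_deriv Omega T u v t : is_deriv_X Omega T u v ->
  time_continuous_version Omega T u -> t \in `[0, T] ->
  {ae leb, forall x, Omega x -> forall i,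
    is_time_deriv T (fun s => u s x ord0 i) t (v t x ord0 i)}.
Proof.
move=> uv uc tT.
have : {ae leb, forall x (m : nat), Omega x -> exists2 d, 0 < d & forall s, s \in `[0, T] ->
    `|s - t| < d -> forall i,
     `|u s x ord0 i - u t x ord0 i - v t x ord0 i * (s - t)| <= m.+1%:R^-1 * `|s - t|}.
  apply: ae_foralln => m; have [|d d0] := @ae_deriv_near Omega T u v t m.+1%:R^-1 uv uc tT.
    by rewrite invr_gt0 ltr0n.
  by apply: filterS => x Hx Ox; exists d => // s sT sd; exact: Hx.
apply: filterS => x Hx Ox i; apply/is_time_derivP => e e0.
have [m _ /(_ m (leqnn _)) /= me] := @near_infty_natSinv_lt R (PosNum e0).
have [d d0 H] := Hx m Ox; exists d => // s sT sd.
by rewrite (le_trans (H s sT sd i))// ler_wpM2r// ltW.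
Qed.

(** Compactness of [0, T]: a bound c at one time gives c + 1 at all nearby times. The resulting
    bound is common to all times, the null set is not. *)
Lemma continuous_X_bounded Omega T u : continuous_X Omega T u ->
  exists2 c : R, 0 <= c & forall t, t \in `[0, T] ->
    {ae leb, forall x, Omega x -> forall i, `|u t x ord0 i| <= c}.
Proof.
move=> uc.
pose P (c t : R) := t \in `[0, T] ->
  {ae leb, forall x, Omega x -> forall i, `|u t x ord0 i| <= c}.
have [M [_ HM]] : \forall c \near +oo, `[0, T]%classic `<=` P c.
  apply: ((compact_near_coveringP _).1 (@segment_compact R 0 T) R (pinfty_nbhs R) P _).
  move=> t tT; have [c c0 Hc] := space_X_bounded (uc t tT).1.
  have [d d0 Hd] := continuous_X_near uc tT ltr01.
  exists (ball t d, [set c' | c + 1 < c']) => /=.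
    split; first exact: nbhsx_ballx.
    by exists (c + 1); split; [exact: num_real|].
  move=> [s c'] [/= sd cc'] sT.
  have := Hd s sT; rewrite distrC => /(_ sd); apply: filterS2 Hc => x Hx Hs Ox i.
  have := ler_normD (u s x ord0 i - u t x ord0 i) (u t x ord0 i); rewrite subrK.
  have := Hx Ox i; have := Hs Ox i; lra.
pose c := `|M| + 1.
exists c; first by rewrite addr_ge0.
by move=> t tT; apply: (HM c _ t) => //; rewrite /c (le_lt_trans (ler_norm _))// ltrDl.
Qed.

Lemma ae_local_lipschitz Omega T u v t c : is_deriv_X Omega T u v ->
  time_continuous_version Omega T u -> t \in `[0, T] ->
  {ae leb, forall x, Omega x -> forall i, `|v t x ord0 i| <= c} ->
  exists2 d, 0 < d & {ae leb, forall x, Omega x -> forall s, s \in `[0, T] ->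
    `|s - t| < d -> forall i, `|u s x ord0 i - u t x ord0 i| <= (c + 1) * `|s - t|}.
Proof.
move=> uv uc tT vc; have [d d0 H] := ae_deriv_near uv uc tT ltr01; exists d => //.
move: vc H; apply: filterS2 => x vx Hx Ox s sT sd i.
have := Hx Ox s sT sd i; have := vx Ox i => vxi.
have := ler_normD (u s x ord0 i - u t x ord0 i - v t x ord0 i * (s - t)) (v t x ord0 i * (s - t)).
rewrite subrK normrM.
have : `|v t x ord0 i| * `|s - t| <= c * `|s - t| by rewrite ler_wpM2r.
lra.
Qed.

End Linf.

(** * Degradation profiles and bond potentials *)

Section real_functions.
Context (R : realType).
Implicit Types (h : R -> R) (a b x y : R).

Lemma derivable_continuous h : (forall x, derivable h x 1) -> continuous h.
Proof. by move=> dh x; apply: differentiable_continuous; exact/derivable1_diffP. Qed.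

Lemma bounded_derive_lipschitz h a b B :
  (forall x, derivable h x 1) ->
  (forall x, x \in `[a, b] -> `|h^`()%classic x| <= B) ->
  forall x y, x \in `[a, b] -> y \in `[a, b] -> `|h x - h y| <= B * `|x - y|.
Proof.
move=> dh hB x y; wlog xy : x y / x <= y.
  move=> W xab yab; have [xy|/ltW yx] := leP x y; first exact: W.
  by rewrite distrC [`|x - y|]distrC; exact: W.
rewrite !in_itv/= => /andP[ax xb] /andP[ay yb].
have [z zxy hz] : exists2 z, z \in `[x, y] & h y - h x = h^`()%classic z * (y - x).
  apply: MVT_segment => // [z _|].
    by rewrite derive1E; exact: derivableP.
  by apply: continuous_subspaceT; exact: derivable_continuous.
rewrite distrC hz normrM [`|x - y|]distrC ler_wpM2r// hB//.
by move: zxy; rewrite !in_itv/= => /andP[? ?]; apply/andP; split; lra.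
Qed.

Definition clamp a b x := Num.max a (Num.min b x).

Lemma clamp_itv a b x : a <= b -> clamp a b x \in `[a, b].
Proof.
by move=> ab; rewrite in_itv/= /clamp le_max lexx/= ge_max ab/= ge_min lexx.
Qed.

Lemma clamp_dist a b x y : a <= b -> `|clamp a b x - clamp a b y| <= `|x - y|.
Proof.
move=> ab; wlog xy : x y / x <= y.
  by move=> W; have [/W//|/ltW/W] := leP x y; rewrite distrC [`|x - y|]distrC.
have -> : `|x - y| = y - x by rewrite distrC ger0_norm ?subr_ge0.
rewrite ler_norml /clamp.
by case: (leP b x) => ?; case: (leP b y) => ?; case: (leP a b) => ?; case: (leP a x) => ?;
  case: (leP a y) => ?; apply/andP; split; lra.
Qed.

(** The derivative is bounded on the compact [a, b], and [h] factors through the 1-Lipschitz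
    projection onto it. *)
Lemma clamp_lipschitz h a b : a <= b -> (forall x, derivable h x 1) ->
  continuous (h^`()%classic) ->
  (forall x, h x = h (clamp a b x)) ->
  exists2 B, 0 <= B & forall x y, `|h x - h y| <= B * `|x - y|.
Proof.
move=> ab dh ch hE.
have [c _ cmax] : exists2 c, c \in `[a, b] & forall t, t \in `[a, b] ->
    `|h^`()%classic t| <= `|h^`()%classic c|.
  apply: (@EVT_max R (fun t => `|h^`()%classic t|)) => //.
  by apply: continuous_subspaceT => x; apply: cvg_norm; exact: ch.
exists `|h^`()%classic c| => // x y; rewrite hE [h y]hE.
apply: le_trans (bounded_derive_lipschitz dh cmax _ _) _; [exact: clamp_itv|exact: clamp_itv|].
by rewrite ler_wpM2l// clamp_dist.
Qed.

Lemma continuous_measurable_comp d (X : measurableType d) (D : set X) h (f : X -> R) :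
  continuous h -> measurable_fun D f -> measurable_fun D (fun p => h (f p)).
Proof.
move=> ch mf; apply: (measurableT_comp (f := h)) => //.
exact: continuous_measurable_fun.
Qed.

End real_functions.

Section degradation_profile.
Context (R : realType) (rp : R).
Implicit Types (k : degradation R).

Definition profile k : R -> R :=
  match k with excess_integral h _ => h | peak_strain h _ => h end.

(** Both laws have one shape: 1 up to some a, nonincreasing between a and b, 0 from b on, with (a,
    b) equal to (0, x^D) in case (a) and to (r^+, r^D) in case (b). *)
Lemma profile_properties k : degradation_law rp k ->
  [/\ forall x, derivable (profile k) x 1,
      continuous ((profile k)^`()%classic),
      forall x y, x <= y -> profile k y <= profile k x,
      forall x, 0 <= profile k x <= 1 &
      exists2 B, 0 <= B & forall x y, `|profile k x - profile k y| <= B * `|x - y|].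
Proof.
have sm (h : R -> R) : smooth h -> (forall x, derivable h x 1) /\ continuous h^`()%classic.
  move=> sh; split; first exact: (sh 0%N).
  apply: derivable_continuous => x; exact: (sh 1%N).
have main (h : R -> R) (a b : R) : a < b -> smooth h -> (forall x, 0 <= h x) ->
    (forall x, x <= a -> h x = 1) -> {in `[a, b[ &, {homo h : x y /~ x <= y}} ->
    (forall x, b <= x -> h x = 0) ->
  [/\ forall x, derivable h x 1,
      continuous (h^`()%classic),
      forall x y, x <= y -> h y <= h x,
      forall x, 0 <= h x <= 1 &
      exists2 B, 0 <= B & forall x y, `|h x - h y| <= B * `|x - y|].
  move=> ab /sm[dh ch] h0 ha hab hb.
  have hmono x y : x <= y -> h y <= h x.
    move=> xy; have [by'|yb] := leP b y; first by rewrite (hb y).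
    have le1 z : a <= z -> z < b -> h z <= 1.
      by move=> az zb; rewrite -(ha a)// hab// in_itv/= ?lexx ?ab ?az.
    have [xa|ax] := leP x a.
      rewrite (ha x)//; have [ya|/ltW ay] := leP y a; [by rewrite ha|exact: le1].
    have xb : x < b by exact: le_lt_trans xy yb.
    have ay : a <= y by rewrite (le_trans (ltW ax)).
    by apply: hab => //; rewrite in_itv/= ?yb ?ay ?xb ?(ltW ax).
  split => //.
    move=> x; rewrite h0/=; have [xa|/ltW ax] := leP x a; first by rewrite ha.
    by rewrite -(ha a)// hmono.
  apply: (clamp_lipschitz (ltW ab) dh ch) => x; rewrite /clamp.
  have [bx|xb] := leP b x; first by rewrite max_r ?(ltW ab)// !hb.
  by have [ax|xa] := leP a x => //; rewrite !ha// ltW.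
case: k => [h xD|h rD] /=.
  move=> [xD0 sh h0 [hN hD h1]]; have := main h 0 xD xD0 sh h0 _ hD h1; apply => x.
  rewrite le_eqVlt => /predU1P[->|]; last exact: hN.
  have [dh _] := sm _ sh.
  (* Law (a) prescribes the value 1 only for negative arguments; at 0 it follows by continuity from
     the left. *)
  apply/eqP; rewrite -subr_eq0 -normr_eq0; apply/eqP/le_anti; rewrite normr_ge0 andbT.
  apply/ler_addgt0Pl => e e0; rewrite addr0.
  have ch : h z @[z --> (0 : R)] --> h 0 by exact: derivable_continuous.
  move/cvgrPdist_le : ch => /(_ e e0) /nbhs_ballP[d /= d0 H].
  rewrite -(hN (- (d / 2))); last by rewrite oppr_lt0 divr_gt0.
  apply: H; rewrite /ball/= sub0r opprK gtr0_norm ?divr_gt0//; lra.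
move=> [rpD sh h0 [hN hD h1]]; have := main h rp rD rpD sh h0 hN _ h1; apply.
move=> x y; rewrite !in_itv/= => /andP[? ?] /andP[? ?]; apply: hD;
  by rewrite in_itv/=; apply/andP; split; lra.
Qed.

End degradation_profile.

Section potential.
Context (R : realType) (g : R -> R) (rm re rc rp Cm Cp : R).
Hypothesis hg : bond_potential g rm re rc rp Cm Cp.

Lemma potential_derivable x : derivable g x 1.
Proof. by case: hg => _ []. Qed.

Lemma potential_deriv_continuous : continuous (g^`()%classic).
Proof. by case: hg => _ [_ dg' _ _ _] *; exact: derivable_continuous. Qed.

Lemma potential_deriv_bounded : exists2 B, 0 <= B & forall x, `|g^`()%classic x| <= B.
Proof.
by case: hg => _ [_ _ _ [B HB] _] *; exists B => //; rewrite (le_trans _ (HB 0)).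
Qed.

Lemma potential_lipschitz : exists2 B, 0 <= B & forall x y, `|g x - g y| <= B * `|x - y|.
Proof.
have [B B0 HB] := potential_deriv_bounded; exists B => // x y.
apply: (@bounded_derive_lipschitz _ g (Num.min x y) (Num.max x y)).
- exact: potential_derivable.
- by move=> z _.
- by rewrite in_itv/= ge_min lexx/= le_max lexx.
- by rewrite in_itv/= ge_min lexx orbT/= le_max lexx orbT.
Qed.

Lemma potential_bounded : exists2 C, 0 <= C & forall x, `|g x| <= C.
Proof.
have [B B0 HB] := potential_lipschitz.
have [[rmre re0 rc0 rcrp] _ gl gr _ _ _ _ [g00 _]] := hg.
exists (B * (`|rm| + `|rp|)); first by rewrite mulr_ge0 ?addr_ge0.
have key x : rm <= x -> x <= rp -> `|g x| <= B * (`|rm| + `|rp|).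
  move=> mx xp; have := HB x 0; rewrite g00 !subr0 => /le_trans; apply.
  rewrite ler_wpM2l// ler_norml; have := ler_norm rp; have := ler_norm (- rm).
  rewrite normrN => ? ?; have := normr_ge0 rm; have := normr_ge0 rp => ? ?.
  by apply/andP; split; lra.
move=> x; have [xm|/ltW mx] := leP x rm.
  by rewrite (gl x xm) -(gl rm (lexx _)); apply: key => //; lra.
have [xp|/ltW px] := leP x rp; first exact: key.
by rewrite (gr x px) -(gr rp (lexx _)); apply: key => //; lra.
Qed.

End potential.

(** * Strain and bond kernel *)

Section strain.
Context (R : realType) (n : nat).
Local Notation E := 'rV[R]_n.
Local Notation leb := (@lebesgue_rV R n).
Implicit Types (x y : E) (f : E -> E).

Lemma bond_direction_le1 y x i : `|bond_direction y x ord0 i| <= 1.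
Proof.
rewrite /bond_direction mxE normrM ger0_norm ?invr_ge0 ?enorm_ge0//.
have [->|e0] := eqVneq (enorm (y - x)) 0; first by rewrite invr0 mul0r.
rewrite mulrC ler_pdivrMr ?mul1r ?coord_le_enorm// lt_neqAle eq_sym e0.
exact: enorm_ge0.
Qed.

Lemma enormBC x y : enorm (x - y) = enorm (y - x).
Proof. by rewrite -opprB enormN. Qed.

Lemma bond_directionN y x : bond_direction y x = - bond_direction x y.
Proof. by rewrite /bond_direction enormBC -scalerN opprB. Qed.

Lemma strainE y x f : strain y x f =
  \sum_i (f y ord0 i - f x ord0 i) * ((enorm (y - x))^-1 * bond_direction y x ord0 i).
Proof. by apply: eq_bigr => i _; rewrite !mxE; ring. Qed.

Lemma strain_sym y x f : strain y x f = strain x y f.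
Proof.
rewrite !strainE; apply: eq_bigr => i _.
by rewrite (bond_directionN x y) (enormBC x y) [fun_of_matrix (- _) _ _]mxE; ring.
Qed.

Lemma strainB y x f f' : strain y x f - strain y x f' = strain y x (fun z => f z - f' z).
Proof.
by rewrite !strainE -sumrB; apply: eq_bigr => i _; rewrite !mxE; ring.
Qed.

Lemma norm_strain_le y x f c :
  (forall i, `|f y ord0 i| <= c) -> (forall i, `|f x ord0 i| <= c) ->
  `|strain y x f| <= n%:R * (2 * c) * (enorm (y - x))^-1.
Proof.
move=> fy fx; rewrite strainE (le_trans (ler_norm_sum _ _ _))//.
apply: (@le_trans _ _ (\sum_(i < n) 2 * c * (enorm (y - x))^-1)); last first.
  by rewrite sumr_const card_ord -[_ *+ _]mulr_natl mulrA.
apply: ler_sum => i _; rewrite normrM ler_pM//.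
  by rewrite (le_trans (ler_normB _ _))// mulr_natl mulr2n lerD.
rewrite normrM ger0_norm ?invr_ge0 ?enorm_ge0// ler_piMr ?invr_ge0 ?enorm_ge0//.
exact: bond_direction_le1.
Qed.

Lemma sqrt_mul_inv (r : R) : 0 <= r -> Num.sqrt r * r^-1 = (Num.sqrt r)^-1.
Proof.
move=> r0; have [->|rn0] := eqVneq r 0; first by rewrite invr0 mulr0 sqrtr0 invr0.
have s0 : Num.sqrt r != 0 by rewrite sqrtr_eq0 -ltNge lt_neqAle eq_sym rn0.
by rewrite -{2}(sqr_sqrtr r0); field.
Qed.

Lemma sqrt_strain_le y x f c :
  (forall i, `|f y ord0 i| <= c) -> (forall i, `|f x ord0 i| <= c) ->
  Num.sqrt (enorm (y - x)) * `|strain y x f| <=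
    n%:R * (2 * c) * (Num.sqrt (enorm (y - x)))^-1.
Proof.
move=> fy fx; rewrite -sqrt_mul_inv ?enorm_ge0// mulrCA ler_wpM2l ?sqrtr_ge0//.
exact: norm_strain_le.
Qed.

Lemma is_time_deriv_strain (T t : R) (u : R -> E -> E) (v : E -> E) y x :
  (forall i, is_time_deriv T (fun s => u s y ord0 i) t (v y ord0 i)) ->
  (forall i, is_time_deriv T (fun s => u s x ord0 i) t (v x ord0 i)) ->
  is_time_deriv T (fun s => strain y x (u s)) t (strain y x v).
Proof.
move=> dy dx; rewrite strainE; under eq_fun do rewrite strainE.
apply: is_time_deriv_sum => i.
have := is_time_derivM (is_time_derivB (dy i) (dx i)) (is_time_deriv_cst T
  ((enorm (y - x))^-1 * bond_direction y x ord0 i) t).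
by rewrite mulr0 addr0.
Qed.

Lemma strain_continuous (T : R) (u : R -> E -> E) (Omega : set E) y x :
  time_continuous_version Omega T u -> Omega x -> Omega y ->
  {within `[0, T]%classic, continuous (fun s => strain y x (u s))}.
Proof.
move=> uc Ox Oy.
rewrite (_ : (fun s => _) = (fun s => \sum_i (u s y ord0 i - u s x ord0 i) *
  ((enorm (y - x))^-1 * bond_direction y x ord0 i))); last first.
  by apply/funext => s; rewrite strainE.
apply/subspace_continuousP => t tT.
elim: (index_enum _) => [|i r IH].
  by rewrite (_ : (fun s => _) = cst 0) ?big_nil; [exact: cvg_cst|apply/funext => s; rewrite big_nil].
rewrite (_ : (fun s => _) = (fun s => (u s y ord0 i - u s x ord0 i) *
  ((enorm (y - x))^-1 * bond_direction y x ord0 i) +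
  \sum_(j <- r) (u s y ord0 j - u s x ord0 j) *
  ((enorm (y - x))^-1 * bond_direction y x ord0 j))); last first.
  by apply/funext => s; rewrite big_cons.
apply: cvgD IH; apply: cvgM; last exact: cvg_cst.
apply: cvgB.
  by have /subspace_continuousP := time_continuous_coord (i := i) uc Oy; exact.
by have /subspace_continuousP := time_continuous_coord (i := i) uc Ox; exact.
Qed.

Lemma measurable_bond_direction i :
  measurable_fun setT (fun p : E * E => bond_direction p.2 p.1 ord0 i).
Proof.
rewrite (_ : (fun p => _) =
  (fun p : E * E => (enorm (p.2 - p.1))^-1 * (p.2 - p.1) ord0 i)); last first.
  by apply/funext => p; rewrite /bond_direction mxE.
apply: measurable_funM; last exact: measurable_coordB.
by apply: measurable_inv; exact: measurable_enormB.
Qed.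

Lemma measurable_pair_fst (Omega : set E) (f : E -> R) : measurable Omega ->
  measurable_fun Omega f -> measurable_fun (Omega `*` Omega) (fun p : E * E => f p.1).
Proof.
move=> mO mf; apply: (measurable_comp mO _ mf); first by move=> _ [p [? _] <-].
exact: measurable_funTS.
Qed.

Lemma measurable_pair_snd (Omega : set E) (f : E -> R) : measurable Omega ->
  measurable_fun Omega f -> measurable_fun (Omega `*` Omega) (fun p : E * E => f p.2).
Proof.
move=> mO mf; apply: (measurable_comp mO _ mf); first by move=> _ [p [_ ?] <-].
exact: measurable_funTS.
Qed.

Lemma measurable_fun_coord (Omega : set E) (f : E -> E) i : measurable Omega ->
  measurable_fun Omega f -> measurable_fun Omega (fun x => f x ord0 i).
Proof.
by move=> mO mf; exact: (measurableT_comp (measurable_coord i) mf).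
Qed.

Lemma measurable_strain (Omega : set E) (f : E -> E) : measurable Omega ->
  measurable_fun Omega f ->
  measurable_fun (Omega `*` Omega) (fun p : E * E => strain p.2 p.1 f).
Proof.
move=> mO mf; under eq_fun do rewrite strainE.
apply: measurable_sum => i; apply: measurable_funM.
  apply: measurable_funB.
    by apply: (measurable_pair_snd (f := fun x => f x ord0 i)) => //; exact: measurable_fun_coord.
  by apply: (measurable_pair_fst (f := fun x => f x ord0 i)) => //; exact: measurable_fun_coord.
apply: measurable_funTS; apply: measurable_funM; last exact: measurable_bond_direction.
by apply: measurable_inv; exact: measurable_enormB.
Qed.

End strain.

Section kernel.
Context (R : realType) (n : nat).
Local Notation E := 'rV[R]_n.
Variables (Omega : set E) (eps : R) (J : R -> R) (M : R).
Hypotheses (mO : measurable Omega) (eps0 : 0 < eps) (hJ : influence_function J M).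
Local Notation kernel := (bond_kernel Omega eps J).

Let C0 : 0 < eps * (unit_ball_volume R n * eps ^+ n).
Proof. by rewrite mulr_gt0// mulr_gt0 ?unit_ball_volume_gt0// exprn_gt0. Qed.

Lemma bond_kernelE y x : Omega y -> kernel y x =
  J (enorm (y - x) / eps) / (eps * (unit_ball_volume R n * eps ^+ n)).
Proof. by move=> Oy; rewrite /bond_kernel indicE mem_set// mul1r. Qed.

Lemma bond_kernel_sym y x : Omega y -> Omega x -> kernel y x = kernel x y.
Proof. by move=> Oy Ox; rewrite !bond_kernelE// enormBC. Qed.

Lemma bond_kernel_ge0 y x : 0 <= kernel y x.
Proof.
have [J0 _ _ _ _] := hJ; rewrite /bond_kernel divr_ge0 ?(ltW C0)//.
apply: mulr_ge0; first by rewrite indicE ler0n.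
by apply: J0; rewrite divr_ge0 ?enorm_ge0// ltW.
Qed.

Lemma bond_kernel_gt0 y x : Omega y -> enorm (y - x) < eps -> 0 < kernel y x.
Proof.
move=> Oy yx; have [_ _ J1 _ _] := hJ; rewrite bond_kernelE// divr_gt0// J1//.
  by rewrite divr_ge0 ?enorm_ge0// ltW.
by rewrite ltr_pdivrMr// mul1r.
Qed.

Lemma bond_kernel_eq0 y x : eps <= enorm (y - x) -> kernel y x = 0.
Proof.
move=> yx; have [_ _ _ _ J1] := hJ; rewrite /bond_kernel J1 ?mulr0 ?mul0r//.
by rewrite ler_pdivlMr// mul1r.
Qed.

Lemma bond_kernel_bounded : exists2 C, 0 <= C & forall y x, kernel y x <= C.
Proof.
have [J0 Jd _ JM _] := hJ.
have M0 : 0 <= M by rewrite -JM J0.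
exists (M / (eps * (unit_ball_volume R n * eps ^+ n))).
  by rewrite divr_ge0// ltW.
move=> y x; rewrite /bond_kernel ler_pM2r ?invr_gt0//.
have r0 : 0 <= enorm (y - x) / eps by rewrite divr_ge0 ?enorm_ge0// ltW.
have JMr : J (enorm (y - x) / eps) <= M by rewrite -JM Jd.
rewrite indicE; case: (_ \in _); rewrite ?mul1r ?mul0r//.
Qed.

Lemma measurable_bond_kernel :
  measurable_fun setT (fun p : E * E => kernel p.2 p.1).
Proof.
have [_ Jd _ _ _] := hJ.
(* [J] is monotone on [0, +oo[ only; precomposed with max(0, r) it is monotone, hence measurable, on
   the whole line. *)
have mJ : measurable_fun setT (fun r : R => J (Num.max 0 r)).
  apply: nonincreasing_measurable => // r s rs; apply: Jd; first by rewrite le_max lexx.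
  by rewrite ge_max !le_max lexx/= rs orbT.
rewrite (_ : (fun p => _) = (fun p : E * E => \1_Omega p.2 *
    J (Num.max 0 (enorm (p.2 - p.1) / eps)) / (eps * (unit_ball_volume R n * eps ^+ n)))).
  apply: measurable_funM => //; apply: measurable_funM.
    by apply: (measurableT_comp (f := \1_Omega : E -> R)) => //; exact: measurable_indic.
  apply: (measurableT_comp (f := fun r : R => J (Num.max 0 r))) => //.
  by apply: measurable_funM => //; exact: measurable_enormB.
apply/funext => p; rewrite /bond_kernel max_r//.
by rewrite divr_ge0 ?enorm_ge0// ltW.
Qed.

End kernel.

(** * Time integrals *)

Section time_integrals.
Context (R : realType) (T : R) (f : R -> R).
Local Notation mu := (@lebesgue_measure R).
Hypothesis intf : mu.-integrable `[0, T] (EFin \o f).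
Let I t := \int[mu]_(s in `[0, t]) f s.

Lemma Rintegral_itv_approx0 a b c eta : 0 <= a -> a <= b -> b <= T ->
  (forall s, a < s -> s <= b -> `|f s - c| <= eta) ->
  `|I b - I a - c * (b - a)| <= eta * (b - a).
Proof.
move=> a0 ab bT fc.
have intb : mu.-integrable `[0, b] (EFin \o f).
  apply: integrableS intf => //; apply: subset_itvl; rewrite bnd_simp//.
have intab : mu.-integrable `]a, b] (EFin \o f).
  apply: integrableS intb => //; apply: subset_itvr; rewrite bnd_simp//.
rewrite /I Rintegral_itvB// ?bnd_simp//.
have lab : mu `]a, b] = (b - a)%:E.
  rewrite lebesgue_measure_itv/= lte_fin; case: ltP => // ba.
  by rewrite (@le_anti _ _ a b) ?subrr// ab.
have intc (z : R) : mu.-integrable `]a, b] (EFin \o cst z).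
  apply/integrableP; split; first exact/measurable_EFinP.
  by rewrite (eq_integral (cst `|z|%:E))// integral_cst// [X in (_ * X)%E]lab -EFinM ltry.
have cE (z : R) : \int[mu]_(x in `]a, b]) z = z * (b - a).
  by rewrite /Rintegral integral_cst// [X in (_ * X)%E]lab.
rewrite -(cE c) -RintegralB//; last exact: (intc c).
have intB : mu.-integrable `]a, b] (EFin \o (fun x => f x - c)).
  exact: (integrableB _ intab (intc c)).
rewrite (le_trans (le_normr_Rintegral _ intB))// -(cE eta).
apply: le_Rintegral => //; [exact: (integrable_norm intB)|exact: (intc eta)|].
by move=> s /=; rewrite in_itv/= => /andP[? ?]; exact: fc.
Qed.

(** One estimate with three uses: c = f t with small [eta] differentiates the primitive, c = eta = 0
    shows that it is locally constant, and a large [eta] gives a Lipschitz bound. *)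
Lemma Rintegral_itv_approx t s c eta : t \in `[0, T] -> s \in `[0, T] ->
  (forall r, r \in `[0, T] -> `|r - t| <= `|s - t| -> `|f r - c| <= eta) ->
  `|I s - I t - c * (s - t)| <= eta * `|s - t|.
Proof.
rewrite !in_itv/= => /andP[t0 tT] /andP[s0 sT] fc.
have [ts|/ltW st] := leP t s.
  rewrite (ger0_norm (_ : 0 <= s - t)) ?subr_ge0//.
  apply: Rintegral_itv_approx0 => // r tr rs; apply: fc.
    by rewrite in_itv/=; apply/andP; split; lra.
  by rewrite !ger0_norm ?subr_ge0//; [lra|exact: ltW].
rewrite [`|s - t|]distrC (ger0_norm (_ : 0 <= t - s)) ?subr_ge0//.
have -> : I s - I t - c * (s - t) = - (I t - I s - c * (t - s)) by ring.
rewrite normrN; apply: Rintegral_itv_approx0 => // r sr rt; apply: fc.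
  by rewrite in_itv/=; apply/andP; split; lra.
by rewrite !ler0_norm ?subr_le0//; lra.
Qed.

Lemma is_time_deriv_Rintegral t : t \in `[0, T] ->
  (forall e, 0 < e -> exists2 d, 0 < d & forall s, s \in `[0, T] ->
    `|s - t| < d -> `|f s - f t| < e) ->
  is_time_deriv T I t (f t).
Proof.
move=> tT fc; apply/is_time_derivP => e e0; have [d d0 H] := fc e e0.
exists d => // s sT sd; apply: Rintegral_itv_approx => // r rT rs.
by apply/ltW/H => //; exact: le_lt_trans sd.
Qed.

Lemma Rintegral_itv_homo a b : 0 <= a -> a <= b -> b <= T -> (forall s, 0 <= f s) ->
  I a <= I b.
Proof.
move=> a0 ab bT f0.
have intb : mu.-integrable `[0, b] (EFin \o f).
  apply: integrableS intf => //; apply: subset_itvl; rewrite bnd_simp//.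
by rewrite -subr_ge0 /I Rintegral_itvB// ?bnd_simp// Rintegral_ge0.
Qed.

End time_integrals.

Lemma within_continuous_integrable (R : realType) (T : R) (f : R -> R) :
  {within `[0, T]%classic, continuous f} ->
  (@lebesgue_measure R).-integrable `[0, T] (EFin \o f).
Proof. by move=> fc; apply: continuous_compact_integrable => //; exact: segment_compact. Qed.

(** * Plateaus of monotone families *)

Section plateaus.
Context d (X : measurableType d) (R : realType) (mu : {measure set X -> \bar R}).
Variables (D : set X) (T : R) (M : R -> X -> R).
Hypotheses (mD : measurable D) (Dfin : (mu D < +oo)%E).
Hypothesis mM : forall s, s \in `[0, T] -> measurable_fun D (M s).
Hypothesis M_homo : forall p s t, D p -> s \in `[0, T] -> t \in `[0, T] -> s <= t ->
  M s p <= M t p.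

Let P q t : set X := D `&` [set p | M q p = M t p].

Let mP q t : q \in `[0, T] -> t \in `[0, T] -> measurable (P q t).
Proof.
move=> qT tT; have := measurable_fun_eqr (mM qT) (mM tT).
move=> /(_ mD [set true] I); congr measurable.
by apply/seteqP; split => p [Dp /= /eqP].
Qed.

Let P_sub q t s : 0 <= q -> q <= t -> t <= s -> s <= T -> P q s `<=` P q t.
Proof.
move=> q0 qt ts sT p [Dp /= qs]; split => //=; apply/le_anti.
have qT : q \in `[0, T] by rewrite in_itv/=; apply/andP; split; lra.
have tT : t \in `[0, T] by rewrite in_itv/=; apply/andP; split; lra.
have sT' : s \in `[0, T] by rewrite in_itv/=; apply/andP; split; lra.
by rewrite M_homo//= qs M_homo.
Qed.

Let right_seq t (j : nat) : R := t + (T - t) / j.+1%:R.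

Let right_seq_gt t j : t < T -> t < right_seq t j <= T.
Proof.
move=> tT; rewrite /right_seq ltrDl divr_gt0 ?subr_gt0//= -lerBrDl.
by rewrite ler_pdivrMr ?ltr0n// ler_peMr ?subr_ge0 ?ler1n// ltW.
Qed.

(** The points of [D] whose plateau, begun by time [q], has its right end exactly at t: by
    monotonicity, a plateau that went on past t would contain some [right_seq t j]. *)
Let N q t : set X := P q t `\` \bigcup_j P q (right_seq t j).

Let mbig q t : 0 <= q -> q <= t -> t < T -> measurable (\bigcup_j P q (right_seq t j)).
Proof.
move=> q0 qt tT; apply: bigcupT_measurable => j; have := right_seq_gt j tT => /andP[? ?].
by apply: mP; rewrite in_itv/=; apply/andP; split; lra.
Qed.

Let mN q t : 0 <= q -> q <= t -> t < T -> measurable (N q t).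
Proof.
move=> q0 qt tT; apply: measurableD; last exact: mbig.
by apply: mP; rewrite in_itv/=; apply/andP; split; lra.
Qed.

Let bad q : set R := [set t | [/\ 0 <= q, q <= t, t < T & mu (N q t) != 0%E]].

(* The sets [N q t] are disjoint for distinct [t]; concretely, a rational can be
   inserted in the jump of [mu (P q _)] at each bad time. *)
Let countable_bad q : countable (bad q).
Proof.
have PD t : P q t `<=` D by move=> p [].
have Pfin t : 0 <= q -> q <= t -> t < T -> (mu (P q t) < +oo)%E.
  move=> q0 qt tT; apply: le_lt_trans Dfin; apply: le_measure => //; rewrite inE//.
  by apply: mP; rewrite in_itv/=; apply/andP; split; lra.
have bigsub t : 0 <= q -> q <= t -> t < T -> \bigcup_j P q (right_seq t j) `<=` P q t.
  move=> q0 qt tT p [j _]; apply: P_sub => //; have := right_seq_gt j tT => /andP[? ?] //.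
  exact: ltW.
have bigfin t : 0 <= q -> q <= t -> t < T -> (mu (\bigcup_j P q (right_seq t j)) < +oo)%E.
  move=> q0 qt tT; apply: le_lt_trans (Pfin _ q0 qt tT).
  apply: le_measure; rewrite ?inE; [exact: mbig| |exact: bigsub].
  by apply: mP; rewrite in_itv/=; apply/andP; split; lra.
have /choice[rho Hrho] : forall t, exists rho : rat, bad q t ->
    fine (mu (\bigcup_j P q (right_seq t j))) < ratr rho < fine (mu (P q t)).
  move=> t; have [[q0 qt tT Nt]|nb] := pselect (bad q t); last by exists 0.
  have : fine (mu (\bigcup_j P q (right_seq t j))) < fine (mu (P q t)).
    apply: fine_lt; rewrite ?ge0_fin_numE ?Pfin ?bigfin//.
    have -> : P q t = N q t `|` \bigcup_j P q (right_seq t j).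
      by rewrite /N setDKU//; exact: bigsub.
    rewrite measureU//; last 3 first.
    - exact: mN.
    - exact: mbig.
    - by rewrite /N setDE -setIA setICl setI0.
    by rewrite lteDr ?lt0e ?Nt ?measure_ge0// ge0_fin_numE ?bigfin.
  move=> /rat_in_itvoo[rho]; rewrite in_itv/= => rhoP.
  by exists rho.
have rho_inj t t' : bad q t -> bad q t' -> t < t' -> rho t != rho t'.
  move=> bt bt' tt'; have /andP[r1 _] := Hrho t bt; have /andP[_ r2] := Hrho t' bt'.
  have [q0 qt tT _] := bt; have [_ qt' t'T _] := bt'.
  suff : (fine (mu (P q t')) <= fine (mu (\bigcup_j P q (right_seq t j))))%R.
    move=> le12; apply/eqP => rr; move: r1 r2; rewrite rr; lra.
  apply: fine_le; rewrite ?ge0_fin_numE ?Pfin ?bigfin//.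
  apply: le_measure; rewrite ?inE; [|exact: mbig|].
    by apply: mP; rewrite in_itv/=; apply/andP; split; lra.
  (* A plateau reaching the later bad time t' has passed some [right_seq t j], so the jump at t'
     lies entirely below the jump at t. *)
  move=> p; have [j jt] : exists j, right_seq t j <= t'.
    exists (Num.truncn ((T - t) / (t' - t))); rewrite /right_seq -lerBrDl.
    rewrite ler_pdivrMr ?ltr0n// mulrC -ler_pdivrMr ?subr_gt0//.
    by rewrite ltW// truncnS_gt.
  move=> Pp; exists j => //; apply: P_sub Pp => //; last exact: ltW.
  by have := right_seq_gt j tT => /andP[? _]; lra.
apply/countable_injP; exists (pickle \o rho) => t t' /set_mem bt /set_mem bt' /=.
move=> /(pcan_inj pickleK) rr; case: (ltgtP t t') => // [tt'|t't].
  by have := rho_inj _ _ bt bt' tt'; rewrite rr eqxx.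
by have := rho_inj _ _ bt' bt t't; rewrite rr eqxx.
Qed.

(** A nondegenerate plateau ending at t contains a rational time before t, so the bad times of
    rational starting points suffice. *)
Lemma countable_plateau_ends : exists2 B : set R, countable B &
  forall t, 0 < t -> t < T -> ~ B t -> {ae mu, forall p, D p ->
    (forall q, q \in `[0, t[ -> M q p < M t p) \/
    (exists s, [/\ t < s, s <= T & M s p = M t p])}.
Proof.
exists (\bigcup_(q : rat) bad (ratr q)).
  by apply: bigcup_countable => // q _; exact: countable_bad.
move=> t t0 tT nB.
have : {ae mu, forall p (k : nat), let q := ratr (odflt 0 (unpickle k : option rat)) : R in
    0 <= q -> q <= t -> ~ N q t p}.
  apply: ae_foralln => k /=; set q := ratr _.
  have [q0|_] := leP 0 q; last by apply: aeW.
  have [qt|_] := leP q t; last by apply: aeW => p _ [].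
  have N0 : mu (N q t) = 0%E.
    apply: contrapT => /eqP N0; apply: nB; exists (odflt 0 (unpickle k : option rat)) => //.
  by exists (N q t); split => //; [exact: mN|move=> p /= /not_implyP[_ /not_implyP[_ /contrapT]]].
apply: filterS => p Hp Dp.
have [|/existsNP[q /not_implyP[qt Mq]]] := pselect (forall q, q \in `[0, t[ -> M q p < M t p).
  by left.
right; move: qt; rewrite in_itv/= => /andP[q0 qt].
have qT : q \in `[0, T] by rewrite in_itv/=; apply/andP; split; lra.
have tT' : t \in `[0, T] by rewrite in_itv/=; apply/andP; split; lra.
have Mqt : M q p = M t p.
  by apply/le_anti; rewrite M_homo ?(ltW qt)//= leNgt; apply/negP.
have [q'] := rat_in_itvoo qt; rewrite in_itv/= => /andP[qq' q't].
have q'T : ratr q' \in `[0, T] by rewrite in_itv/=; apply/andP; split; lra.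
have Mq't : M (ratr q') p = M t p.
  by apply/le_anti; rewrite M_homo ?(ltW q't)//= -Mqt M_homo ?(ltW qq').
have [j _ [_ /= Mj]] : (\bigcup_j P (ratr q') (right_seq t j)) p.
  apply: contrapT => nbig; have := Hp (pickle q'); rewrite pickleK/=.
  by move=> /(_ (ltW (le_lt_trans q0 qq')) (ltW q't)); apply; split.
have /andP[tj jT] := right_seq_gt j tT.
by exists (right_seq t j); split => //; rewrite -Mj.
Qed.

End plateaus.

(** * Degradation of bonds *)

Section bonds.
Context (R : realType) (m : nat).
Local Notation n := m.+1.
Local Notation E := 'rV[R]_n.
Local Notation leb := (@lebesgue_rV R n).
Local Notation mu := (leb \x leb)%E.
Variables (Omega : set E) (T rp : R) (u v : R -> E -> E) (k : degradation R).
Hypotheses (T0 : 0 < T) (mO : measurable Omega) (bO : bounded_set Omega).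
Hypotheses (uX : continuous_X Omega T u) (vX : continuous_X Omega T v).
Hypotheses (uv : is_deriv_X Omega T u v) (uc : time_continuous_version Omega T u).
Hypotheses (rp0 : 0 < rp) (hk : degradation_law rp k).
Let D := Omega `*` Omega.
Local Notation r p s := (scaled_strain u p.2 p.1 s).
Local Notation gam p s := (degradation_factor rp k u p.2 p.1 s).
Local Notation rate p s := (degradation_rate T rp k u p.2 p.1 s).

Definition inv_sqrt_dist (p : E * E) : R := (Num.sqrt (enorm (p.2 - p.1)))^-1.
Local Notation w := inv_sqrt_dist.

Lemma inv_sqrt_dist_ge0 p : 0 <= w p.
Proof. by rewrite invr_ge0 sqrtr_ge0. Qed.

Let mD : measurable D. Proof. exact: measurableX. Qed.

Lemma finite_pairs : (mu D < +oo)%E.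
Proof.
have lO := bounded_lebesgue_rV_lty bO.
apply: (@le_lt_trans _ _ (leb Omega * leb Omega)%E).
  by rewrite -(product_measure1E leb leb mO mO).
by rewrite lte_mul_pinfty// ge0_fin_numE.
Qed.

Lemma ae_pairs (P : E -> Prop) : {ae leb, forall x, Omega x -> P x} ->
  {ae mu, forall p, D p -> P p.1 /\ P p.2}.
Proof.
move=> H; have H1 := ae_product1 leb H; have H2 := ae_product2 leb H.
by move: H1 H2; apply: filterS2 => p H1 H2 [x1 x2]; split; [exact: H1|exact: H2].
Qed.

Lemma scaled_strain_sym y x : scaled_strain u y x = scaled_strain u x y.
Proof. by apply/funext => s; rewrite /scaled_strain strain_sym enormBC. Qed.

Lemma degradation_factor_sym y x :
  degradation_factor rp k u y x = degradation_factor rp k u x y.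
Proof.
apply/funext => s; case: (k) => h c /=; first by rewrite scaled_strain_sym.
rewrite /max_strain enormBC (_ : (fun tau => strain y x (u tau)) = (fun tau => strain x y (u tau)))//.
by apply/funext => tau; exact: strain_sym.
Qed.

Lemma max_strainE y x t : max_strain u y x t = runmax (fun tau => strain y x (u tau)) t.
Proof. by []. Qed.

Lemma measurable_sqrt_dist (A : set (E * E)) :
  measurable_fun A (fun p : E * E => Num.sqrt (enorm (p.2 - p.1))).
Proof.
by apply: measurable_funTS; apply: measurable_sqrt; exact: measurable_enormB.
Qed.

Lemma measurable_scaled_strain s : s \in `[0, T] -> measurable_fun D (fun p => r p s).
Proof.
move=> sT; apply: measurable_funM; first exact: measurable_sqrt_dist.
by apply: measurable_strain => //; have [[]] := uX sT.
Qed.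

Lemma scaled_strain_continuous p : D p ->
  {within `[0, T]%classic, continuous (fun s => r p s)}.
Proof.
move=> [x1 x2]; apply/subspace_continuousP => t tT; apply: cvgM; first exact: cvg_cst.
by have /subspace_continuousP := @strain_continuous _ _ T u _ p.2 p.1 uc x1 x2; exact.
Qed.

Lemma ae_strain_deriv t : t \in `[0, T] -> {ae mu, forall p, D p ->
  is_time_deriv T (fun s => strain p.2 p.1 (u s)) t (strain p.2 p.1 (v t))}.
Proof.
move=> tT; have := ae_pairs (ae_is_time_deriv uv uc tT).
by apply: filterS => p + Dp => /(_ Dp)[d1 d2]; exact: is_time_deriv_strain.
Qed.

Lemma ae_strain_lipschitz : exists2 L, 0 <= L & forall t, t \in `[0, T] ->
  exists2 d, 0 < d & {ae mu, forall p, D p -> forall s, s \in `[0, T] -> `|s - t| < d ->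
    `|strain p.2 p.1 (u s) - strain p.2 p.1 (u t)| <=
       L * (enorm (p.2 - p.1))^-1 * `|s - t|}.
Proof.
have [c c0 vc] := continuous_X_bounded vX.
exists (n%:R * (2 * (c + 1))); first by rewrite !mulr_ge0// addr_ge0.
move=> t tT; have [d d0 H] := ae_local_lipschitz uv uc tT (vc t tT).
exists d => //; have := ae_pairs H; apply: filterS => p + Dp s sT sd => /(_ Dp)[H1 H2].
rewrite strainB (le_trans (norm_strain_le (c := (c + 1) * `|s - t|) _ _))//.
- by move=> i; rewrite !mxE; exact: H2.
- by move=> i; rewrite !mxE; exact: H1.
- by rewrite le_eqVlt; apply/orP; left; apply/eqP; ring.
Qed.

Lemma sqrt_inv_dist (p : E * E) :
  Num.sqrt (enorm (p.2 - p.1)) * (enorm (p.2 - p.1))^-1 = w p.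
Proof. by rewrite sqrt_mul_inv// enorm_ge0. Qed.

Lemma ae_scaled_strain_lipschitz : exists2 L, 0 <= L & forall t, t \in `[0, T] ->
  exists2 d, 0 < d & {ae mu, forall p, D p -> forall s, s \in `[0, T] -> `|s - t| < d ->
    `|r p s - r p t| <= L * w p * `|s - t|}.
Proof.
have [L L0 H] := ae_strain_lipschitz; exists L => // t tT.
have [d d0 Hd] := H t tT; exists d => //; move: Hd; apply: filterS => p + Dp s sT sd.
move=> /(_ Dp s sT sd) Hs.
rewrite /scaled_strain -mulrBr normrM ger0_norm ?sqrtr_ge0//.
rewrite (le_trans (ler_wpM2l (sqrtr_ge0 _) Hs))// -sqrt_inv_dist.
by rewrite le_eqVlt; apply/orP; left; apply/eqP; ring.
Qed.

Lemma ae_scaled_strain_bounded : exists2 C, 0 <= C & forall t, t \in `[0, T] ->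
  {ae mu, forall p, D p -> `|r p t| <= C * w p}.
Proof.
have [c c0 hc] := continuous_X_bounded uX.
exists (n%:R * (2 * c)); first by rewrite !mulr_ge0.
move=> t tT; have := ae_pairs (hc t tT); apply: filterS => p + Dp => /(_ Dp)[H1 H2].
rewrite /scaled_strain normrM ger0_norm ?sqrtr_ge0//.
exact: sqrt_strain_le.
Qed.

Let excess p s := Num.max (r p s - rp) 0.

Let excess_ge0 p s : 0 <= excess p s.
Proof. by rewrite /excess le_max lexx orbT. Qed.

Let excess_lipschitz p s t : `|excess p s - excess p t| <= `|r p s - r p t|.
Proof.
rewrite /excess ler_norml.
have := ler_norm (r p s - r p t); have := ler_norm (- (r p s - r p t)); rewrite normrN.
by case: (leP (r p s - rp)) => ?; case: (leP (r p t - rp)) => ? ? ?; apply/andP; split; lra.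
Qed.

Let excess_continuous p : D p -> {within `[0, T]%classic, continuous (excess p)}.
Proof.
move=> Dp; apply/within_continuousP => t tT e e0.
have [d d0 H] := (within_continuousP _ _).1 (scaled_strain_continuous Dp) t tT e e0.
exists d => // s sT sd; exact: le_lt_trans (excess_lipschitz _ _ _) (H s sT sd).
Qed.

Let excess_integrable p : D p -> (@lebesgue_measure R).-integrable `[0, T] (EFin \o excess p).
Proof. by move=> Dp; apply: within_continuous_integrable; exact: excess_continuous. Qed.

Let J p t := \int[@lebesgue_measure R]_(tau in `[0, t]) excess p tau.

Lemma measurable_degradation_factor t : t \in `[0, T] ->
  measurable_fun D (fun p => gam p t).
Proof.
move=> tT; have [dh _ _ _ _] := profile_properties hk.
case: k dh => h c /= dh; apply: continuous_measurable_comp;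
  try exact: derivable_continuous.
  apply: (@measurable_time_integral _ _ _ D T t (fun s p => excess p s)) => //.
  move=> s sT; apply: measurable_maxr => //; apply: measurable_funB => //.
  exact: measurable_scaled_strain.
apply: measurable_funM; first exact: measurable_sqrt_dist.
apply: (@measurable_runmax _ _ _ D T t (fun s p => strain p.2 p.1 (u s))) => //.
- by move=> p [x1 x2]; exact: strain_continuous uc x1 x2.
- by move=> s sT; apply: measurable_strain => //; have [[]] := uX sT.
Qed.

Lemma degradation_factor01 p t : 0 <= gam p t <= 1.
Proof. by have [_ _ _ h01 _] := profile_properties hk; case: k h01 => h c /= ->. Qed.

Lemma degradation_factor_homo p s t : D p -> s \in `[0, T] -> t \in `[0, T] ->
  s <= t -> gam p t <= gam p s.
Proof.
move=> Dp sT tT st; have [_ _ hd _ _] := profile_properties hk.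
case: k hd => h c /= hd; apply: hd.
  move: sT tT; rewrite !in_itv/= => /andP[s0 _] /andP[_ tT].
  apply: (Rintegral_itv_homo (excess_integrable Dp)) => //; exact: excess_ge0.
rewrite ler_wpM2l ?sqrtr_ge0//; have [x1 x2] := Dp.
by rewrite !max_strainE; exact: (runmax_homo (strain_continuous uc x1 x2) sT tT st).
Qed.

Lemma profile_peak h c : k = peak_strain h c -> forall x, h x = h (Num.max x rp).
Proof.
move=> kE x; move: hk; rewrite kE /= => -[_ _ _ [h1 _ _]].
by have [xr|//] := leP x rp; rewrite !h1.
Qed.

(** Near t the strain stays at most r^+. In case (a) the integrand then vanishes; in case (b) the
    maximum truncated at r^+ does not move. *)
Lemma degradation_factor_locally_constant p t : D p -> t \in `[0, T] -> r p t < rp ->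
  exists2 d, 0 < d & forall s, s \in `[0, T] -> `|s - t| < d -> gam p s = gam p t.
Proof.
move=> Dp tT rt; have [x1 x2] := Dp.
have [|d d0 H] := (within_continuousP _ _).1 (scaled_strain_continuous Dp) t tT (rp - r p t).
  by rewrite subr_gt0.
have rs s : s \in `[0, T] -> `|s - t| < d -> r p s <= rp.
  by move=> sT sd; have := H s sT sd; rewrite ltr_distl => /andP[_]; lra.
exists d => // s sT sd; case kE : k => [h c|h c] /=.
  congr (h _).
  have := @Rintegral_itv_approx R T _ (excess_integrable Dp) t s 0 0 tT sT.
  rewrite !mul0r subr0 normr_le0 subr_eq0 => /(_ _)/eqP; apply => r' r'T r's.
  have := rs r' r'T (le_lt_trans r's sd).
  by rewrite /excess subr0 => rr; rewrite max_r ?normr0// subr_le0.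
rewrite (profile_peak kE) [RHS](profile_peak kE); congr (h _).
exact: (runmax_max_locally_constant (strain_continuous uc x1 x2) (sqrtr_ge0 _) tT rs sT sd).
Qed.

Lemma degradation_rate_le0 p t : D p -> t \in `[0, T] -> rate p t <= 0.
Proof.
move=> Dp tT; rewrite /degradation_rate.
have [->//|] := time_derivP T (degradation_factor rp k u p.2 p.1) t.
apply: is_time_deriv_le0 => // s s' sT s'T ss'.
exact: (@degradation_factor_homo p s s' Dp).
Qed.

Lemma degradation_rate_neq0 p t : D p -> t \in `[0, T] -> rate p t != 0 -> rp <= r p t.
Proof.
move=> Dp tT; apply: contraR; rewrite -ltNge => rt; apply/eqP.
apply: time_derivE => //; apply: is_time_deriv_locally_constant.
exact: degradation_factor_locally_constant.
Qed.

(** In case (a) the constant bounds the excess near t, in case (b) it is the one of the running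
    maximum; both are multiplied by the Lipschitz constant [B] of the profile. The radius [d]
    depends on t, the constant [C] does not. *)
Lemma ae_degradation_factor_lipschitz : exists2 C, 0 <= C & forall t, t \in `[0, T] ->
  exists2 d, 0 < d & {ae mu, forall p, D p -> forall s, s \in `[0, T] -> `|s - t| < d ->
    `|gam p s - gam p t| <= C * w p * `|s - t|}.
Proof.
have [_ _ _ _ [B B0 hB]] := profile_properties hk.
case: k hB => h c /= hB.
  have [L L0 HL] := ae_scaled_strain_lipschitz.
  have [C C0 HC] := ae_scaled_strain_bounded.
  exists (B * (C + L)); first by rewrite mulr_ge0// addr_ge0.
  (* The bound |s - t| < 1 turns the variation L w |s - t| of the excess into L w. *)
  move=> t tT; have [d d0 Hd] := HL t tT; exists (Num.min d 1); first by rewrite lt_min d0 ltr01.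
  move: (HC t tT) Hd; apply: filterS2 => p HCp HLp Dp s sT; rewrite lt_min => /andP[sd s1].
  have {}HCp := HCp Dp; have {}HLp := HLp Dp.
  rewrite (le_trans (hB _ _))// -!mulrA ler_wpM2l//.
  (* As r^+ is positive, the excess is at most |r|. *)
  have ext : `|excess p t| <= C * w p.
    rewrite ger0_norm// (le_trans _ HCp)// /excess ge_max normr_ge0 andbT.
    by rewrite (le_trans _ (ler_norm _))// lerBlDr lerDl ltW.
  have exr r' : r' \in `[0, T] -> `|r' - t| <= `|s - t| -> `|excess p r' - excess p t| <= L * w p.
    move=> r'T r's; rewrite (le_trans (excess_lipschitz _ _ _))//.
    rewrite (le_trans (HLp _ r'T (le_lt_trans r's sd)))//.
    by rewrite ler_piMr ?mulr_ge0 ?inv_sqrt_dist_ge0// (le_trans r's)// ltW.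
  have := Rintegral_itv_approx (excess_integrable Dp) tT sT exr.
  move=> aE; rewrite -[X in `|X| <= _](subrK (excess p t * (s - t))).
  rewrite (le_trans (ler_normD _ _))// mulrDl addrC lerD//; last by rewrite mulrA.
  by rewrite normrM mulrA ler_wpM2r.
have [L L0 HL] := ae_strain_lipschitz.
exists (B * (2 * L)); first by rewrite mulr_ge0// mulr_ge0.
move=> t tT; have [d d0 Hd] := HL t tT; exists d => //.
move: Hd; apply: filterS => p + Dp s sT sd; move=> /(_ Dp) Hp; have [x1 x2] := Dp.
rewrite (le_trans (hB _ _))// -!mulrA ler_wpM2l// -mulrBr normrM ger0_norm ?sqrtr_ge0//.
rewrite !max_strainE.
have := runmax_local_lipschitz (strain_continuous uc x1 x2) tT Hp sT sd.
move=> /(ler_wpM2l (sqrtr_ge0 (enorm (p.2 - p.1))))/le_trans; apply.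
rewrite -sqrt_inv_dist le_eqVlt; apply/orP; left; apply/eqP; ring.
Qed.

Lemma is_time_deriv_excess h c p t : k = excess_integral h c -> D p -> t \in `[0, T] ->
  is_time_deriv T (degradation_factor rp k u p.2 p.1) t
    (h^`()%classic (J p t) * excess p t).
Proof.
move=> kE Dp tT; have [dh _ _ _ _] := profile_properties hk.
rewrite kE /= in dh *.
apply: (@is_time_deriv_comp _ _ h) => //.
apply: (is_time_deriv_Rintegral (excess_integrable Dp) tT).
exact/((within_continuousP _ _).1 (excess_continuous Dp)).
Qed.

Lemma degradation_rate_continuous p : is_excess_integral k -> D p ->
  {within `[0, T]%classic, continuous (degradation_rate T rp k u p.2 p.1)}.
Proof.
case kE : k => [h c|//] _ Dp; rewrite -kE.
have rateE s : s \in `[0, T] -> rate p s = h^`()%classic (J p s) * excess p s.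
  by move=> sT; exact: (time_derivE T0 sT (is_time_deriv_excess kE Dp sT)).
apply/subspace_continuousP => t tT.
have [_ dh' _ _ _] := profile_properties hk; rewrite kE /= in dh'.
have Jc : {within `[0, T]%classic, continuous (J p)}.
  apply/within_continuousP => s sT.
  apply: is_time_deriv_continuous; apply: (is_time_deriv_Rintegral (excess_integrable Dp) sT).
  exact/((within_continuousP _ _).1 (excess_continuous Dp)).
have : h^`()%classic (J p s) * excess p s @[s --> within `[0, T]%classic (nbhs t)]
    --> h^`()%classic (J p t) * excess p t.
  apply: cvgM.
    apply: (@cvg_comp _ _ _ (J p) h^`()%classic _ (nbhs (J p t))); last exact: dh'.
    by have /subspace_continuousP := Jc; exact.
  by have /subspace_continuousP := excess_continuous Dp; exact.
rewrite -rateE//; apply: cvg_trans; apply: near_eq_cvg.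
rewrite near_withinE; apply: nearW => s sT; exact/esym/rateE.
Qed.

Lemma ae_degradation_differentiable : exists B : set R, [/\ countable B,
  forall t, t \in `[0, T] -> ~ B t ->
    {ae mu, forall p, D p -> exists l,
      is_time_deriv T (degradation_factor rp k u p.2 p.1) t l} &
  is_excess_integral k -> B = set0].
Proof.
case kE : k => [h c|h c].
  exists set0; split => // t tT _; apply: aeW => p Dp; rewrite -kE.
  by eexists; exact: (is_time_deriv_excess kE Dp tT).
have [dh _ _ _ _] := profile_properties hk; rewrite kE /= in dh.
have [||B cB HB] := @countable_plateau_ends _ _ _ mu D T
  (fun s p => runmax (fun tau => strain p.2 p.1 (u tau)) s) mD finite_pairs.
- move=> s sT; apply: (@measurable_runmax _ _ _ D T s (fun s p => strain p.2 p.1 (u s))) => //.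
    by move=> p [x1 x2]; exact: strain_continuous uc x1 x2.
  by move=> s' s'T; apply: measurable_strain => //; have [[]] := uX s'T.
- by move=> p s t [x1 x2] sT tT st; exact: (runmax_homo (strain_continuous uc x1 x2) sT tT st).
(* The plateau ends together with 0 and T, since the running maximum is differentiated at interior
   times only. *)
exists (\bigcup_(i in [set: bool]) if i then B else [set 0; T]); split => //.
  apply: bigcup_countable => // -[] _ //; exact: finite_set_countable.
move=> t tT nB.
have t0 : 0 < t.
  move: tT; rewrite in_itv/= => /andP[t0 _]; rewrite lt_neqAle t0 andbT.
  by apply/eqP => t0'; apply: nB; exists false => //; left.
have tT' : t < T.
  move: tT; rewrite in_itv/= => /andP[_ tT]; rewrite lt_neqAle tT andbT.
  by apply/eqP => tT'; apply: nB; exists false => //; right.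
have {}nB : ~ B t by move=> Bt; apply: nB; exists true.
move: (HB t t0 tT' nB) (ae_strain_deriv tT); apply: filterS2 => p Hp ds Dp.
have [x1 x2] := Dp.
have [l Hl] := runmax_differentiable (strain_continuous uc x1 x2) t0 tT' (ds Dp) (Hp Dp).
eexists; apply: (@is_time_deriv_comp _ _ h) => //.
exact: is_time_derivZ Hl.
Qed.

End bonds.

(** * Energy balance *)

Section integral_tools.
Context d (X : measurableType d) (R : realType).
Variables (mu : {measure set X -> \bar R}) (D : set X).
Hypothesis mD : measurable D.

Lemma integrable_ae_bound (f h : X -> R) : measurable_fun D f ->
  mu.-integrable D (EFin \o h) -> {ae mu, forall x, D x -> `|f x| <= h x} ->
  mu.-integrable D (EFin \o f).
Proof.
move=> mf ih fh; apply/integrableP; split; first exact/measurable_EFinP.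
have [mh hfin] := integrableP _ _ _ ih; apply: le_lt_trans hfin.
apply: ge0_ae_le_integral_arbitrary => //.
move: fh; apply: filterS => x + Dx => /(_ Dx) fhx /=.
by rewrite lee_fin (le_trans fhx)// ler_norm.
Qed.

Lemma integrable_bounded (f : X -> R) (C : R) : (mu D < +oo)%E -> measurable_fun D f ->
  {ae mu, forall x, D x -> `|f x| <= C} -> mu.-integrable D (EFin \o f).
Proof.
move=> Dfin mf fC; apply: (@integrable_ae_bound f (cst C)) => //.
apply/integrableP; split; first exact/measurable_EFinP.
rewrite (eq_integral (cst `|C|%:E))// integral_cst// lte_mul_pinfty//.
Qed.

Lemma is_time_deriv_integral_pointwise (T t delta : R) (F : R -> X -> R) (l H : X -> R) :
  0 < T -> t \in `[0, T] -> 0 < delta ->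
  (forall s, s \in `[0, T] -> mu.-integrable D (EFin \o F s)) ->
  {ae mu, forall x, D x -> is_time_deriv T (F ^~ x) t (l x)} ->
  mu.-integrable D (EFin \o H) ->
  {ae mu, forall x, D x -> forall s, s \in `[0, T] -> `|s - t| < delta ->
    `|F s x - F t x| <= H x * `|s - t|} ->
  is_time_deriv T (fun s => \int[mu]_(x in D) F s x) t (\int[mu]_(x in D) l x) /\
  exists2 l' : X -> R, mu.-integrable D (EFin \o l') &
    {ae mu, forall x, D x -> l x = l' x}.
Proof.
move=> T0 tT d0 iF Fl iH FH.
apply: (@is_time_deriv_integral _ X R mu D mD T t delta F l H) => //.
  move=> s_ sT st s_t; move: Fl; apply: filterS => x + Dx => /(_ Dx).
  by move=> /is_time_deriv_seqP; exact.
move=> s sT st sd; move: FH; apply: filterS => x + Dx => /(_ Dx s sT sd) Hx.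
by rewrite normrM normfV mulrC ler_pdivrMr// normr_gt0 subr_eq0.
Qed.

Lemma Rintegral_sum (I : Type) (s : seq I) (f : I -> X -> R) :
  (forall i, mu.-integrable D (EFin \o f i)) ->
  \int[mu]_(x in D) (\sum_(i <- s) f i x) = \sum_(i <- s) \int[mu]_(x in D) f i x.
Proof.
move=> fi; elim: s => [|i s IH].
  rewrite big_nil /Rintegral (eq_integral (cst 0%E)) ?integral0// => x _.
  by rewrite big_nil.
rewrite big_cons -IH -RintegralD//.
  by apply: eq_Rintegral => x _; rewrite big_cons.
apply: (eq_integrable mD (fun x => (\sum_(j <- s) (f j x)%:E)%E)).
  by move=> x _ /=; rewrite sumEFin.
apply: integrable_sum => // j _; exact: fi.
Qed.

End integral_tools.

Lemma is_time_deriv_bound (R : realType) (T t d L l : R) (f : R -> R) : 0 < T -> t \in `[0, T] ->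
  0 < d -> (forall s, s \in `[0, T] -> `|s - t| < d -> `|f s - f t| <= L * `|s - t|) ->
  is_time_deriv T f t l -> `|l| <= L.
Proof.
move=> T0 tT d0 fL /is_time_derivP fl; apply/ler_addgt0Pl => e e0.
have [d1 d10 H] := fl e e0.
have [|s [sT st]] := exists_punctured T0 tT (d := Num.min d d1); first by rewrite lt_min d0.
rewrite lt_min => /andP[sd sd1].
have st0 : 0 < `|s - t| by rewrite normr_gt0 subr_eq0.
rewrite -(ler_pM2r st0) -normrM mulrDl.
have -> : l * (s - t) = (f s - f t) - (f s - f t - l * (s - t)) by ring.
by rewrite (le_trans (ler_normB _ _))// addrC lerD// ?H// fL.
Qed.

Lemma is_time_deriv_eq (R : realType) (T t l : R) (f h : R -> R) : t \in `[0, T] ->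
  (forall s, s \in `[0, T] -> f s = h s) -> is_time_deriv T f t l -> is_time_deriv T h t l.
Proof.
move=> tT fh /is_time_derivP fl; apply/is_time_derivP => e e0.
by have [d d0 H] := fl e e0; exists d => // s sT sd; rewrite -!fh//; exact: H.
Qed.

Lemma countable_lebesgue_negligible (R : realType) (A : set R) :
  countable A -> (@lebesgue_measure R).-negligible A.
Proof.
move=> cA; exists A; split => //; last exact: countable_lebesgue_measure0.
by apply: countable_measurable => // x; exact: measurable_set1.
Qed.

Lemma ae_is_time_deriv_Rintegral (R : realType) (T : R) (f : R -> R) :
  (@lebesgue_measure R).-integrable setT (EFin \o f) ->
  {ae @lebesgue_measure R, forall t, t \in `[0, T] ->
    is_time_deriv T (fun t => \int[@lebesgue_measure R]_(s in `[0, t]) f s) t (f t)}.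
Proof.
move=> intf.
have locf : locally_integrable setT f by apply: open_integrable_locally => //; exact: openT.
have inty y : (@lebesgue_measure R).-integrable [set` Interval (BLeft 0) (BRight y)] (EFin \o f).
  by apply: integrableS intf => //.
(* The differentiation theorem speaks of points beyond the lower end 0 of integration. *)
have n0 : {ae @lebesgue_measure R, forall t : R, t != 0}.
  have : (@lebesgue_measure R).-negligible [set 0] by exact: countable_lebesgue_negligible (countable1 _).
  by apply: negligibleS => t /= /negP; rewrite negbK => /eqP.
have := FTC1 inty locf; move: n0; apply: filterS2; first exact: (ae_filter_ringOfSetsType (@lebesgue_measure R)).
move=> t t0 HF; rewrite in_itv/= => /andP[t0' _].
have [|dF dFE] := HF; first by rewrite lte_fin lt_neqAle eq_sym t0.
apply/is_time_derivP => e e0; have [d d0 H] := derivable_approx dF e0.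
by exists d => // s sT sd; have := H s sd; rewrite dFE.
Qed.

(** * Derivatives of the dissipated, elastic and kinetic energies *)

Section balance.
Context (R : realType) (m : nat).
Local Notation n := m.+1.
Local Notation E := 'rV[R]_n.
Local Notation leb := (@lebesgue_rV R n).
Local Notation mu := (leb \x leb)%E.
Variables (Omega : set E) (T eps rho : R) (J : R -> R) (M : R).
Variables (g : R -> R) (rm re rc rp Cm Cp : R) (k : degradation R).
Variables (b : R -> E -> E) (u v acc : R -> E -> E).
Hypotheses (T0 : 0 < T) (eps0 : 0 < eps) (rho0 : 0 < rho).
Hypotheses (mO : measurable Omega) (bO : bounded_set Omega).
Hypothesis hJ : influence_function J M.
Hypothesis hg : bond_potential g rm re rc rp Cm Cp.
Hypothesis hk : degradation_law rp k.
Hypotheses (uX : continuous_X Omega T u) (vX : continuous_X Omega T v)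
  (aX : continuous_X Omega T acc) (bX : continuous_X Omega T b).
Hypotheses (uv : is_deriv_X Omega T u v) (va : is_deriv_X Omega T v acc).
Hypothesis uc : time_continuous_version Omega T u.
Let D := Omega `*` Omega.
Local Notation r p s := (scaled_strain u p.2 p.1 s).
Local Notation gam p s := (degradation_factor rp k u p.2 p.1 s).
Local Notation rate p s := (degradation_rate T rp k u p.2 p.1 s).
Local Notation w := (@inv_sqrt_dist R m).
Local Notation K p := (bond_kernel Omega eps J p.2 p.1).
Local Notation density t p := (dissipation_density Omega T eps J rp k Cp u t p.2 p.1).
Local Notation diss := (dissipation Omega T eps J rp k Cp u).

Let mD : measurable D. Proof. exact: measurableX. Qed.
Let Dfin := finite_pairs mO bO.
Let Cp0 : 0 < Cp. Proof. by case: hg. Qed.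
Let rp0 : 0 < rp. Proof. by case: hg => -[? ? ? ?] *; lra. Qed.
Let K0 p : 0 <= K p. Proof. exact: (bond_kernel_ge0 _ eps0 hJ). Qed.
Let mK (A : set (E * E)) : measurable_fun A (fun p => K p).
Proof. apply: measurable_funTS; exact: (measurable_bond_kernel mO eps0 hJ). Qed.

Let int_w : mu.-integrable D (EFin \o w).
Proof. exact: (integrable_inv_sqrt mO bO). Qed.

Let int_Zw (C : R) : mu.-integrable D (EFin \o (fun p => C * w p)).
Proof. exact: (integrableZl mD C int_w). Qed.

(** The condition in which the two cases differ: it holds at every time in case (a) and outside a
    countable set of times in case (b). *)
Definition differentiable_at t := {ae mu, forall p, D p -> exists l,
  is_time_deriv T (degradation_factor rp k u p.2 p.1) t l}.

Lemma ae_degradation_rate t : t \in `[0, T] -> differentiable_at t ->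
  {ae mu, forall p, D p ->
    is_time_deriv T (degradation_factor rp k u p.2 p.1) t (rate p t)}.
Proof.
move=> tT; apply: filterS => p + Dp => /(_ Dp)[l Hl].
by rewrite /degradation_rate (time_derivE T0 tT Hl).
Qed.

Lemma dissipation_density_ge0 t p : D p -> t \in `[0, T] -> 0 <= density t p.
Proof.
move=> Dp tT; apply: mulr_ge0; first by rewrite mulr_ge0// ltW.
by rewrite oppr_ge0; exact: (degradation_rate_le0 T0 uc hk Dp tT).
Qed.

(** A primitive of the dissipation that does not mention the rates: monotone in time, with
    measurable integrands. *)
Definition dissipated s := \int[mu]_(p in D) (K p * Cp * - gam p s).

(** Differentiation under the integral with dominating function a multiple of w. Fubini is applied
    to the integrable representative [l'] of the density. The bound [Cd] is the integral of the
    dominating function, hence the same for all t. *)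
Lemma dissipation_derivative : exists2 Cd, 0 <= Cd & forall t, t \in `[0, T] -> differentiable_at t ->
  is_time_deriv T dissipated t (diss t) /\
  exists l' : E * E -> R, [/\ mu.-integrable D (EFin \o l'),
    {ae mu, forall p, D p -> density t p = l' p},
    diss t = \int[mu]_(p in D) l' p & diss t <= Cd].
Proof.
have [C C0 HC] := ae_degradation_factor_lipschitz uX vX uv uc rp0 hk.
have [Ck Ck0 HCk] := bond_kernel_bounded Omega eps0 hJ.
pose H p := Ck * Cp * C * w p.
have KCp0 p : 0 <= K p * Cp by apply: mulr_ge0 => //; exact: ltW.
have KCpC p : K p * Cp <= Ck * Cp by apply: ler_wpM2r => //; exact: ltW.
have H0 p : 0 <= H p.
  by rewrite !mulr_ge0// ?inv_sqrt_dist_ge0// ltW.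
exists (\int[mu]_(p in D) H p); first by apply: Rintegral_ge0 => p _; exact: H0.
move=> t tT dt; have [d d0 Hd] := HC t tT.
have dr := ae_degradation_rate tT dt.
have [] := @is_time_deriv_integral_pointwise _ _ R mu D mD T t d
  (fun s p => K p * Cp * - gam p s) (fun p => density t p) H T0 tT d0.
- move=> s sT; apply: (@integrable_bounded _ _ _ _ _ mD _ (Ck * Cp)) => //.
    apply: measurable_funM; first exact: measurable_funM.
    by apply: measurable_funN; exact: (measurable_degradation_factor mO uX uc hk sT).
  apply: aeW => p Dp; rewrite normrM normrN !ger0_norm.
  + have /andP[? ?] := degradation_factor01 u hk p s.
    by rewrite -[leRHS]mulr1; apply: ler_pM; rewrite ?KCp0 ?KCpC.
  + by have /andP[] := degradation_factor01 u hk p s.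
  + exact: KCp0.
- move: dr; apply: filterS => p + Dp => /(_ Dp) drp.
  rewrite /dissipation_density; apply: is_time_derivZ.
  by rewrite -[- rate p t]mulN1r; under eq_fun do rewrite -mulN1r; exact: is_time_derivZ.
- exact: (int_Zw (Ck * Cp * C)).
- move: Hd; apply: filterS => p + Dp s sT sd => /(_ Dp s sT sd) Hp.
  have -> : K p * Cp * - gam p s - K p * Cp * - gam p t =
    - (K p * Cp * (gam p s - gam p t)) by ring.
  have -> : H p * `|s - t| = Ck * Cp * (C * w p * `|s - t|) by rewrite /H; ring.
  rewrite normrN normrM (ger0_norm (KCp0 p)); apply: ler_pM => //; exact: KCpC.
move=> dG [l' il' ll'].
have dissE : diss t = \int[mu]_(p in D) l' p.
  rewrite -(Rintegral12_prod mO mO il') /dissipation.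
  exact: (@Rintegral12_ae_eq _ _ E E R leb leb Omega Omega (fun p => density t p) l').
split; first by move: dG; rewrite (Rintegral_ae_eq_arbitrary ll') -dissE.
exists l'; split => //; rewrite dissE.
rewrite /Rintegral fine_le ?integrable_fin_num//; first exact: (int_Zw (Ck * Cp * C)).
rewrite -(integral_ae_eq_arbitrary (f := fun p => (density t p)%:E)); last first.
  by move: ll'; apply: filterS => p + Dp => ->.
apply: ge0_ae_le_integral_arbitrary.
- by move=> p Dp; rewrite lee_fin dissipation_density_ge0.
- by move=> p Dp; rewrite lee_fin H0.
move: dr Hd; apply: filterS2 => p drp Hp Dp; rewrite lee_fin /dissipation_density /H.
have := is_time_deriv_bound T0 tT d0 (Hp Dp) (drp Dp).
rewrite -[X in _ -> X <= _]ger0_norm; last exact: dissipation_density_ge0.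
move=> rb; have -> : Ck * Cp * C * w p = Ck * Cp * (C * w p) by ring.
rewrite normrM normrN (ger0_norm (KCp0 p)); apply: ler_pM => //; exact: KCpC.
Qed.

Lemma ae_density_bound : exists2 C, 0 <= C & forall t, t \in `[0, T] -> differentiable_at t ->
  {ae mu, forall p, D p -> `|density t p| <= C * w p}.
Proof.
have [C C0 HC] := ae_degradation_factor_lipschitz uX vX uv uc rp0 hk.
have [Ck Ck0 HCk] := bond_kernel_bounded Omega eps0 hJ.
exists (Ck * Cp * C) => [|t tT dt]; first by rewrite !mulr_ge0// ltW.
have [d d0 Hd] := HC t tT.
move: (ae_degradation_rate tT dt) Hd; apply: filterS2 => p drp Hp Dp.
have := is_time_deriv_bound T0 tT d0 (Hp Dp) (drp Dp) => rb.
have KCp0 : 0 <= K p * Cp by apply: mulr_ge0 => //; exact: ltW.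
rewrite /dissipation_density normrM normrN (ger0_norm KCp0) -mulrA; apply: ler_pM => //.
by apply: ler_wpM2r; [exact: ltW|exact: HCk].
Qed.

(** The part of the derivative of the elastic integrand in which gamma is held fixed; the last
    factor is the time derivative of r. *)
Definition power_density t (p : E * E) : R := K p * gam p t * g^`()%classic (r p t) *
  (Num.sqrt (enorm (p.2 - p.1)) * strain p.2 p.1 (v t)).

Lemma elastic_derivative t : t \in `[0, T] -> differentiable_at t ->
  is_time_deriv T (elastic_energy Omega eps J g rp k u) t
    (\int[mu]_(p in D) power_density t p - diss t).
Proof.
move=> tT dt.
have [C C0 HC] := ae_degradation_factor_lipschitz uX vX uv uc rp0 hk.
have [L L0 HL] := ae_scaled_strain_lipschitz vX uv uc.
have [Ck Ck0 HCk] := bond_kernel_bounded Omega eps0 hJ.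
have [Bg Bg0 HBg] := potential_lipschitz hg.
have [Cg Cg0 HCg] := potential_bounded hg.
have [Cd Cd0 /(_ t tT dt)[_ [d' [id' dd' dissE _]]]] := dissipation_derivative.
have [d1 d10 Hd1] := HC t tT; have [d2 d20 Hd2] := HL t tT.
have dr := ae_degradation_rate tT dt.
have iF s : s \in `[0, T] -> mu.-integrable D (EFin \o (fun p => K p * gam p s * g (r p s))).
  move=> sT; apply: (@integrable_bounded _ _ _ _ _ mD _ (Ck * Cg)) => //.
    apply: measurable_funM; first apply: measurable_funM => //.
      exact: (measurable_degradation_factor mO uX uc hk sT).
    apply: continuous_measurable_comp; last exact: (measurable_scaled_strain mO uX sT).
    by apply: derivable_continuous; exact: (potential_derivable hg).
  apply: aeW => p Dp; have /andP[g0 g1] := degradation_factor01 u hk p s.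
  have Kg0 : 0 <= K p * gam p s by exact: mulr_ge0.
  have KgC : K p * gam p s <= Ck.
    by rewrite -[leRHS]mulr1; apply: ler_pM => //; exact: HCk.
  by rewrite normrM (ger0_norm Kg0); apply: ler_pM.
have d0 : 0 < Num.min d1 d2 by rewrite lt_min d10.
have [] := @is_time_deriv_integral_pointwise _ _ R mu D mD T t (Num.min d1 d2)
  (fun s p => K p * gam p s * g (r p s))
  (fun p => K p * (rate p t * g (r p t) + gam p t * (g^`()%classic (r p t) *
     (Num.sqrt (enorm (p.2 - p.1)) * strain p.2 p.1 (v t)))))
  (fun p => Ck * (C * Cg + Bg * L) * w p) T0 tT d0 iF.
- move: dr (ae_strain_deriv uv uc tT); apply: filterS2 => p drp dsp Dp.
  under eq_fun do rewrite -mulrA.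
  apply: is_time_derivZ; apply: is_time_derivM; first exact: drp.
  apply: is_time_deriv_comp; last exact: (potential_derivable hg).
  by apply: is_time_derivZ; exact: dsp.
- exact: int_Zw.
- move: Hd1 Hd2; apply: filterS2 => p Hp1 Hp2 Dp s sT; rewrite lt_min => /andP[sd1 sd2].
  have {}Hp1 := Hp1 Dp s sT sd1; have {}Hp2 := Hp2 Dp s sT sd2.
  have /andP[g0 g1] := degradation_factor01 u hk p s.
  (* Discrete product rule: in each summand one factor is bounded, by [Cg] or by 1, and the other is
     Lipschitz in time with a multiple of w. *)
  have -> : K p * gam p s * g (r p s) - K p * gam p t * g (r p t) =
    K p * ((gam p s - gam p t) * g (r p t) + gam p s * (g (r p s) - g (r p t))) by ring.
  have -> : Ck * (C * Cg + Bg * L) * w p * `|s - t| =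
    Ck * ((C * w p * `|s - t|) * Cg + 1 * (Bg * (L * w p * `|s - t|))) by ring.
  rewrite normrM ger0_norm//; apply: ler_pM => //.
  rewrite (le_trans (ler_normD _ _))// !normrM (ger0_norm g0) lerD//.
    by apply: ler_pM.
  apply: ler_pM => //; rewrite (le_trans (HBg _ _))//.
  exact: ler_wpM2l.
move=> dE [l' il' ll'].
apply: (is_time_deriv_eq (f := fun s => \int[mu]_(p in D) (K p * gam p s * g (r p s))) tT).
  by move=> s sT; rewrite -(Rintegral12_prod mO mO (iF s sT)).
suff -> : \int[mu]_(p in D) power_density t p - diss t = \int[mu]_(p in D) l' p.
  by rewrite -(Rintegral_ae_eq_arbitrary ll').
rewrite (@Rintegral_ae_eq_arbitrary _ _ R mu D (power_density t) (fun p => l' p + d' p)).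
  by rewrite RintegralD// dissE addrK.
move: ll' dd'; apply: filterS2 => p Hl Hd Dp; rewrite -Hl// -Hd//.
rewrite /dissipation_density.
(* A nonzero rate forces r >= r^+, where g = C^+; so the second summand of the product rule is minus
   the density. *)
have [r0|rn0] := eqVneq (rate p t) 0; first by rewrite r0 /power_density; ring.
have rpr := degradation_rate_neq0 T0 uc hk Dp tT rn0.
have -> : g (r p t) = Cp by case: hg => _ _ _ + *; exact.
by rewrite /power_density; ring.
Qed.

(** The path of [v] at a fixed x need not be continuous, so the convergence of difference quotients
    is established for each sequence of times, off a null set that depends on the sequence. *)
Lemma kinetic_derivative t : t \in `[0, T] ->
  is_time_deriv T (kinetic_energy Omega rho v) t
    (\int[leb]_(x in Omega) (rho * dotv (v t x) (acc t x))).
Proof.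
move=> tT.
have [cv cv0 Hcv] := continuous_X_bounded vX.
have [ca ca0 Hca] := continuous_X_bounded aX.
have lO := bounded_lebesgue_rV_lty bO.
have mv s i : s \in `[0, T] -> measurable_fun Omega (fun x => v s x ord0 i).
  by move=> sT; apply: measurable_fun_coord => //; have [[]] := vX sT.
have FE s x : rho * (enorm (v s x) ^+ 2 / 2) = rho / 2 * \sum_i v s x ord0 i ^+ 2.
  rewrite sqr_enorm /dotv; under eq_bigr do rewrite -expr2.
  by field.
have [d d0 Hd] : exists2 d, 0 < d & forall s, s \in `[0, T] -> `|s - t| < d ->
    {ae leb, forall x, Omega x -> forall i,
      `|v s x ord0 i - v t x ord0 i - acc t x ord0 i * (s - t)| <= 1 * `|s - t|}.
  exact: deriv_X_near va tT ltr01.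
have [] := @is_time_deriv_integral _ _ R leb Omega mO T t d
  (fun s x => rho * (enorm (v s x) ^+ 2 / 2)) (fun x => rho * dotv (v t x) (acc t x))
  (cst (rho / 2 * (n%:R * ((ca + 1) * (2 * cv))))) T0 tT d0; last by [].
- move=> s sT.
  apply: (@integrable_bounded _ _ _ _ _ mO _ (rho / 2 * (n%:R * cv ^+ 2))) => //.
    under eq_fun do rewrite FE.
    apply: measurable_funM => //; apply: measurable_sum => i.
    by apply: measurable_funX; exact: mv.
  have := Hcv s sT; apply: filterS => x + Ox => /(_ Ox) Hx; rewrite FE normrM.
  rewrite ger0_norm ?divr_ge0 ?(ltW rho0)//; apply: ler_wpM2l.
    by rewrite divr_ge0 ?(ltW rho0).
  rewrite ger0_norm; last by apply: sumr_ge0 => i _; exact: sqr_ge0.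
  apply: (@le_trans _ _ (\sum_(i < n) cv ^+ 2)).
    by apply: ler_sum => i _; rewrite -real_normK ?num_real// ler_pXn2r ?nnegrE.
  by rewrite sumr_const card_ord -[_ *+ _]mulr_natl.
- move=> s_ sT st s_t.
  (* Tolerances 1/(j+1) with radii [dd j]: the exceptional sets, indexed by tolerances and terms of
     the sequence, are countably many. *)
  have /choice[dd Hdd] : forall j : nat, exists d1, 0 < d1 /\ forall s, s \in `[0, T] ->
      `|s - t| < d1 -> {ae leb, forall x, Omega x -> forall i,
      `|v s x ord0 i - v t x ord0 i - acc t x ord0 i * (s - t)| <= j.+1%:R^-1 * `|s - t|}.
    move=> j; have [|d1 d10 H] := @deriv_X_near _ _ _ _ _ _ t j.+1%:R^-1 va tT.
      by rewrite invr_gt0 ltr0n.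
    by exists d1.
  have : {ae leb, forall x (j N : nat), Omega x -> `|s_ N - t| < dd j -> forall i,
      `|v (s_ N) x ord0 i - v t x ord0 i - acc t x ord0 i * (s_ N - t)|
        <= j.+1%:R^-1 * `|s_ N - t|}.
    apply: ae_foralln => j; apply: ae_foralln => N.
    have [sd|_] := ltP `|s_ N - t| (dd j); last by apply: aeW.
    have [_ H] := Hdd j; have := H _ (sT N) sd.
    by apply: filterS => x + Ox _; exact.
  apply: filterS => x Hx Ox.
  have qv i : (s_ N - t)^-1 * (v (s_ N) x ord0 i - v t x ord0 i) @[N --> \oo]
      --> acc t x ord0 i.
    apply/cvgrPdist_le => e e0.
    have [j _ /(_ j (leqnn _)) /= je] := @near_infty_natSinv_lt R (PosNum e0).
    have [ddj _] := Hdd j.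
    move/cvgrPdist_lt : s_t => /(_ _ ddj); apply: filterS => N sd.
    have := Hx j N Ox _ i; rewrite distrC in sd => /(_ sd) HN.
    have st0 : 0 < `|s_ N - t| by rewrite normr_gt0 subr_eq0.
    rewrite distrC -(ler_pM2r st0) -normrM mulrBl [_^-1 * _ * _]mulrAC mulVf ?subr_eq0//.
    rewrite mul1r (le_trans HN)// ler_wpM2r// ltW//.
  have vc i : v (s_ N) x ord0 i @[N --> \oo] --> v t x ord0 i.
    rewrite -[X in _ --> X]add0r -[X in X + _](mul0r (acc t x ord0 i)).
    rewrite (_ : (fun N => _) = (fun N => (s_ N - t) *
      ((s_ N - t)^-1 * (v (s_ N) x ord0 i - v t x ord0 i)) + v t x ord0 i)); last first.
      by apply/funext => N; rewrite mulrA mulfV ?subr_eq0// mul1r subrK.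
    apply: cvgD; last exact: cvg_cst.
    by apply: cvgM (qv i); rewrite -(subrr t); apply: cvgB => //; exact: cvg_cst.
  rewrite (_ : (fun N => _) = (fun N => rho / 2 * \sum_i
    ((s_ N - t)^-1 * (v (s_ N) x ord0 i - v t x ord0 i)) *
      (v (s_ N) x ord0 i + v t x ord0 i))); last first.
    apply/funext => N; rewrite !FE -mulrBr -sumrB mulrCA mulr_sumr; congr (_ * _).
    by apply: eq_bigr => i _; ring.
  have -> : rho * dotv (v t x) (acc t x) = rho / 2 *
      \sum_i acc t x ord0 i * (v t x ord0 i + v t x ord0 i).
    rewrite -mulrA; congr (_ * _); rewrite /dotv mulr_sumr.
    by apply: eq_bigr => i _; field.
  apply: cvgM; first exact: cvg_cst.
  elim: (index_enum _) => [|i s IH].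
    by rewrite big_nil; under eq_fun do rewrite big_nil; exact: cvg_cst.
  rewrite big_cons; under eq_fun do rewrite big_cons.
  by apply: cvgD IH; apply: cvgM => //; apply: cvgD => //; exact: cvg_cst.
- by apply: (@integrable_bounded _ _ _ _ _ mO _
    `|rho / 2 * (n%:R * ((ca + 1) * (2 * cv)))|) => //; apply: aeW.
move=> s sT st sd; have st0 : 0 < `|s - t| by rewrite normr_gt0 subr_eq0.
have Hst : {ae leb, forall x, Omega x -> forall i, `|v s x ord0 i| <= cv /\ `|v t x ord0 i| <= cv}.
  by move: (Hcv s sT) (Hcv t tT); apply: filterS2 => x Hs Ht Ox i; split; [exact: Hs|exact: Ht].
move: Hst (Hca t tT) (Hd s sT sd); apply: filterS3 => x Hst Ha Hq Ox.
have Hs i : `|v s x ord0 i| <= cv by have [] := Hst Ox i.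
have Ht i : `|v t x ord0 i| <= cv by have [] := Hst Ox i.
have rho2 : 0 <= rho / 2 by rewrite divr_ge0 ?(ltW rho0).
rewrite !FE -mulrBr -sumrB normrM normfV mulrC ler_pdivrMr//= normrM (ger0_norm rho2).
rewrite -[leRHS]mulrA.
apply: ler_wpM2l => //; rewrite (le_trans (ler_norm_sum _ _ _))//.
apply: (@le_trans _ _ (\sum_(i < n) (ca + 1) * (2 * cv) * `|s - t|)); last first.
  by rewrite sumr_const card_ord -[_ *+ _]mulr_natl mulrA.
apply: ler_sum => i _.
have -> : v s x ord0 i ^+ 2 - v t x ord0 i ^+ 2 =
  (v s x ord0 i - v t x ord0 i) * (v s x ord0 i + v t x ord0 i) by ring.
rewrite normrM mulrAC; apply: ler_pM => //; last first.
  by rewrite (le_trans (ler_normD _ _))// mulr_natl mulr2n; apply: lerD; [exact: Hs|exact: Ht].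
rewrite -[X in `|X|](subrK (acc t x ord0 i * (s - t))) (le_trans (ler_normD _ _))//.
rewrite mulrDl addrC lerD//; last exact: Hq.
by rewrite normrM ler_wpM2r//; exact: Ha.
Qed.

(** * Work of the bond forces *)

Section work.
Variable t : R.
Hypothesis tT : t \in `[0, T].

(** Half of the integrand of [force_density], without its leading minus sign, at p = (x, y). *)
Definition bond_force (i : 'I_n) (p : E * E) : R :=
  K p * gam p t * g^`()%classic (r p t) * (w p * bond_direction p.2 p.1 ord0 i).

Definition left_power (p : E * E) : R := \sum_i bond_force i p * v t p.1 ord0 i.
Definition right_power (p : E * E) : R := \sum_i bond_force i p * v t p.2 ord0 i.

Lemma power_densityE p : power_density t p = right_power p - left_power p.
Proof.
rewrite /power_density strainE mulr_sumr mulr_sumr -sumrB; apply: eq_bigr => i _.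
by rewrite /bond_force -(@sqrt_inv_dist R m); ring.
Qed.

Lemma bond_force_swap i x y : Omega x -> Omega y -> bond_force i (x, y) = - bond_force i (y, x).
Proof.
move=> Ox Oy; rewrite /bond_force /= (bond_kernel_sym _ _ Oy Ox).
rewrite degradation_factor_sym scaled_strain_sym /inv_sqrt_dist /= enormBC.
by rewrite bond_directionN [fun_of_matrix (- _) _ _]mxE; ring.
Qed.

Let measurable_bond_force i : measurable_fun D (bond_force i).
Proof.
apply: measurable_funM.
  apply: measurable_funM; first apply: measurable_funM => //.
    exact: (measurable_degradation_factor mO uX uc hk tT).
  apply: continuous_measurable_comp; last exact: (measurable_scaled_strain mO uX tT).
  exact: (potential_deriv_continuous hg).
apply: measurable_funTS; apply: measurable_funM; last exact: measurable_bond_direction.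
by apply: measurable_inv; exact: measurable_sqrt_dist.
Qed.

Let bond_force_bound : exists2 C, 0 <= C & forall i p, `|bond_force i p| <= C * w p.
Proof.
have [Ck Ck0 HCk] := bond_kernel_bounded Omega eps0 hJ.
have [Bg Bg0 HBg] := potential_deriv_bounded hg.
exists (Ck * Bg) => [|i p]; first exact: mulr_ge0.
have /andP[g0 g1] := degradation_factor01 u hk p t.
have Kg0 : 0 <= K p * gam p t by exact: mulr_ge0.
have KgC : K p * gam p t <= Ck.
  by rewrite -[leRHS]mulr1; apply: ler_pM => //; exact: HCk.
rewrite /bond_force normrM (normrM (w p)) (normrM (K p * gam p t)) (ger0_norm Kg0).
apply: ler_pM => //; first exact: mulr_ge0.
  exact: ler_pM.
rewrite (ger0_norm (inv_sqrt_dist_ge0 p)) -[leRHS]mulr1; apply: ler_pM => //.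
  exact: inv_sqrt_dist_ge0.
exact: bond_direction_le1.
Qed.

Let int_bond_force i : mu.-integrable D (EFin \o bond_force i).
Proof.
have [C C0 HC] := bond_force_bound.
apply: (@integrable_ae_bound _ _ R mu D _ _ (measurable_bond_force i) (int_Zw C)).
by apply: aeW => p _; exact: HC.
Qed.

Let mvt i : measurable_fun Omega (fun x => v t x ord0 i).
Proof. by apply: measurable_fun_coord => //; have [[]] := vX tT. Qed.

Let int_left_power : mu.-integrable D (EFin \o left_power).
Proof.
have [C C0 HC] := bond_force_bound.
have [c c0 Hc] := continuous_X_bounded vX.
apply: (@integrable_ae_bound _ _ R mu D _ _ _ (int_Zw (n%:R * (C * c)))).
  apply: measurable_sum => i; apply: measurable_funM; first exact: measurable_bond_force.
  exact: (measurable_pair_fst (f := fun x => v t x ord0 i)).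
have := ae_pairs (Hc t tT); apply: filterS => p + Dp => /(_ Dp)[Hp _].
rewrite (le_trans (ler_norm_sum _ _ _))//.
apply: (@le_trans _ _ (\sum_(i < n) C * w p * c)).
  by apply: ler_sum => i _; rewrite normrM; apply: ler_pM.
by rewrite sumr_const card_ord -[_ *+ _]mulr_natl le_eqVlt; apply/orP; left; apply/eqP; ring.
Qed.

Let int_right_power : mu.-integrable D (EFin \o right_power).
Proof.
have [C C0 HC] := bond_force_bound.
have [c c0 Hc] := continuous_X_bounded vX.
apply: (@integrable_ae_bound _ _ R mu D _ _ _ (int_Zw (n%:R * (C * c)))).
  apply: measurable_sum => i; apply: measurable_funM; first exact: measurable_bond_force.
  exact: (measurable_pair_snd (f := fun x => v t x ord0 i)).
have := ae_pairs (Hc t tT); apply: filterS => p + Dp => /(_ Dp)[_ Hp].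
rewrite (le_trans (ler_norm_sum _ _ _))//.
apply: (@le_trans _ _ (\sum_(i < n) C * w p * c)).
  by apply: ler_sum => i _; rewrite normrM; apply: ler_pM.
by rewrite sumr_const card_ord -[_ *+ _]mulr_natl le_eqVlt; apply/orP; left; apply/eqP; ring.
Qed.

(** The two product integrals are iterated in opposite orders; renaming the variables then exchanges
    the ends of the bond, and oddness gives the sign. *)
Lemma Rintegral_right_power :
  \int[mu]_(p in D) right_power p = - \int[mu]_(p in D) left_power p.
Proof.
rewrite -(Rintegral21_prod mO mO int_right_power) -(Rintegral12_prod mO mO int_left_power).
rewrite -RintegralN; apply: eq_Rintegral => y /set_mem Oy.
rewrite -RintegralN; apply: eq_Rintegral => x /set_mem Ox.
rewrite /right_power /left_power -sumrN; apply: eq_bigr => i _ /=.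
by rewrite bond_force_swap// mulNr.
Qed.

Lemma Rintegral_power : \int[mu]_(p in D) power_density t p =
  - (2 * \int[mu]_(p in D) left_power p).
Proof.
under eq_Rintegral do rewrite power_densityE.
by rewrite RintegralB// Rintegral_right_power; ring.
Qed.

Let force := force_density Omega eps J g rp k u t.

Lemma force_densityE x i :
  force x ord0 i = - \int[leb]_(y in Omega) (2 * bond_force i (x, y)).
Proof.
rewrite /force /force_density mxE mxE; congr (- _); apply: eq_Rintegral => y _.
by rewrite /bond_force /inv_sqrt_dist /=; ring.
Qed.

(** The factor 2 in the force density accounts for the two ends of a bond, whose contributions to
    the power are equal after integration. *)
Lemma force_work : \int[leb]_(x in Omega) dotv (force x) (v t x) =
  \int[mu]_(p in D) power_density t p.
Proof.
rewrite Rintegral_power -RintegralZl// -RintegralN.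
have int2 : mu.-integrable D (EFin \o (fun p => - (2 * left_power p))).
  apply: (@integrable_ae_bound _ _ R mu D _ (fun p => 2 * `|left_power p|)).
  - apply: measurable_funN; apply: measurable_funM => //.
    by apply/measurable_EFinP; exact: measurable_int int_left_power.
  - exact: (integrableZl mD 2 (integrable_norm int_left_power)).
  - by apply: aeW => p _; rewrite normrN normrM ger0_norm.
rewrite -(Rintegral12_prod mO mO int2); apply: Rintegral_ae_eq_arbitrary.
(* The coordinates are indexed through [inord] by natural numbers, so that one null set serves all
   of them. *)
have : {ae leb, forall x (j : nat), Omega x ->
    leb.-integrable Omega (fun y => (bond_force (inord j) (x, y))%:E)}.
  by apply: ae_foralln => j; exact: (ae_integrable12 mO mO (int_bond_force (inord j))).
apply: filterS => x Hx Ox.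
have intx i : leb.-integrable Omega (EFin \o (fun y => 2 * bond_force i (x, y))).
  have := Hx i Ox; rewrite inord_val => Hi; exact: (integrableZl mO 2 Hi).
rewrite RintegralN /dotv; under eq_bigr do rewrite force_densityE mulNr -RintegralZr//.
rewrite sumrN -Rintegral_sum//; last first.
  by move=> i; exact: (integrableZr mO (v t x ord0 i) (intx i)).
congr (- _); apply: eq_Rintegral => y _.
by rewrite /left_power mulr_sumr; apply: eq_bigr => i _ /=; rewrite mulrA.
Qed.

Lemma work_balance :
  eqX Omega (fun x => rho *: acc t x + force x) (b t) ->
  \int[mu]_(p in D) power_density t p =
    \int[leb]_(x in Omega) dotv (b t x) (v t x) -
    \int[leb]_(x in Omega) (rho * dotv (v t x) (acc t x)).
Proof.
move=> eqb; have lO := bounded_lebesgue_rV_lty bO.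
have int_dot (f h : R -> E -> E) : continuous_X Omega T f -> continuous_X Omega T h ->
    leb.-integrable Omega (EFin \o (fun x => dotv (f t x) (h t x))).
  move=> fX hX; have [cf cf0 Hf] := continuous_X_bounded fX.
  have [ch ch0 Hh] := continuous_X_bounded hX.
  apply: (@integrable_bounded _ _ _ _ _ mO _ (n%:R * (cf * ch))) => //.
    apply: measurable_sum => i; apply: measurable_funM; apply: measurable_fun_coord => //.
      by have [[]] := fX t tT.
    by have [[]] := hX t tT.
  move: (Hf t tT) (Hh t tT); apply: filterS2 => x Hfx Hhx Ox.
  rewrite (le_trans (ler_norm_sum _ _ _))//.
  apply: (@le_trans _ _ (\sum_(i < n) cf * ch)).
    by apply: ler_sum => i _; rewrite normrM; apply: ler_pM => //; [exact: Hfx|exact: Hhx].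
  by rewrite sumr_const card_ord -[_ *+ _]mulr_natl.
have intva : leb.-integrable Omega (EFin \o (fun x => rho * dotv (v t x) (acc t x))).
  exact: (integrableZl mO rho (int_dot _ _ vX aX)).
rewrite -RintegralB//; last exact: int_dot.
rewrite -force_work; apply: Rintegral_ae_eq_arbitrary.
move: eqb; apply: filterS => x + Ox => /(_ Ox) <-.
rewrite /dotv mulr_sumr -sumrB; apply: eq_bigr => i _.
by rewrite !mxE; ring.
Qed.

End work.

(** * The process zone and the sign of the dissipation *)

Lemma process_zoneE t p : t \in `[0, T] ->
  process_zone Omega T eps rp k u t p <-> D p /\ 0 < density t p.
Proof.
move=> tT; case: p => x y; split.
  move=> [/= Ox Oy xy rxy]; split => //.
  apply: mulr_gt0 => //; apply: mulr_gt0 => //; exact: (bond_kernel_gt0 eps0 hJ).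
move=> [[/= Ox Oy]]; rewrite /dissipation_density /= => dxy; split => //=.
  (* Beyond the horizon the kernel vanishes, so a positive density implies |y - x| < eps. *)
  rewrite ltNge; apply/negP => yx; move: dxy.
  by rewrite (bond_kernel_eq0 _ eps0 hJ)// !mul0r ltxx.
rewrite lt_neqAle oppr_ge0 (@degradation_rate_le0 _ _ _ _ _ _ _ T0 uc hk (x, y))// andbT.
by apply/eqP => r0; move: dxy; rewrite -r0 mulr0 ltxx.
Qed.

Lemma density_eq0 t p : t \in `[0, T] -> D p ->
  ~ process_zone Omega T eps rp k u t p -> density t p = 0.
Proof.
move=> tT Dp; rewrite process_zoneE// => nd.
apply/le_anti; rewrite dissipation_density_ge0// andbT leNgt; apply/negP => d0.
by apply: nd.
Qed.

(* The process zone need not be measurable: its measure is compared, by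
   monotonicity on arbitrary sets, with that of the measurable set [l' p != 0],
   where [l'] is a.e. equal to the density. *)
Lemma dissipation_gt0P t : t \in `[0, T] -> differentiable_at t ->
  ((0 < mu (process_zone Omega T eps rp k u t))%E -> 0 < diss t) /\
  (~ (0 < mu (process_zone Omega T eps rp k u t))%E -> diss t = 0).
Proof.
move=> tT dt; have [_ _ /(_ t tT dt)[_ [l' [il' ll' dE _]]]] := dissipation_derivative.
have le_mu (A B : set (E * E)) : A `<=` B -> (mu A <= mu B)%E.
  by apply: le_product_measure1; [exact: measure_ge0|exact: le_lebesgue_rV].
have dint : diss t = fine (\int[mu]_(p in D) `|(l' p)%:E|)%E.
  rewrite dE; congr fine; apply: integral_ae_eq_arbitrary.
  move: ll'; apply: filterS => p + Dp => <- //.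
  by rewrite abse_EFin ger0_norm// dissipation_density_ge0.
have ml' := measurable_int _ il'.
have iafin : (\int[mu]_(p in D) `|(l' p)%:E|)%E \is a fin_num.
  by rewrite ge0_fin_numE ?integral_ge0//; have /integrableP[] := il'.
have [N [mN N0 HN]] := ll'.
split => [PZ0|PZ0].
  (* If the dissipation were 0, [l'] would vanish off a null set [N'], and the process zone would
     lie in the null set formed by [N] and [N']. *)
  rewrite lt_neqAle dint fine_ge0 ?integral_ge0// andbT eq_sym; apply/eqP => i0.
  have : (\int[mu]_(p in D) `|(l' p)%:E|)%E = 0%E by rewrite -(fineK iafin) i0.
  move=> /(ae_eq_integral_abs _ mD ml')[N' [mN' N'0 HN']].
  have : (mu (process_zone Omega T eps rp k u t) <= mu (N `|` N'))%E.
    apply: le_mu => p; rewrite process_zoneE// => -[Dp dp].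
    have [lp|lp] := eqVneq (l' p) 0; [left|right].
      by apply: HN => /= /(_ Dp) dl; move: dp; rewrite dl lp ltxx.
    by apply: HN' => /= /(_ Dp) [] /eqP; rewrite (negbTE lp).
  have NN' : mu (N `|` N') = 0%E.
    by rewrite measureU0; [exact: N0|exact: mN|exact: mN'|exact: N'0].
  by rewrite NN' leNgt PZ0.
suff : ae_eq mu D (EFin \o l') (cst 0%E).
  by move=> /(ae_eq_integral_abs _ mD ml') l0; rewrite dint l0.
have mP : measurable (D `&` [set p | l' p != 0]).
  have := (measurable_EFinP _ _).1 ml' mD (~` [set 0]) (measurableC (measurable_set1 0)).
  by congr measurable; apply/seteqP; split => p [Dp /= /eqP].
exists (D `&` [set p | l' p != 0] `|` N); split.
- exact: measurableU.
- rewrite measureU0; [|exact: mP|exact: mN|exact: N0].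
  apply/le_anti/andP; split; last exact: measure_ge0.
  have mPN : measurable ((D `&` [set p | l' p != 0]) `\` N) by exact: measurableD.
  have : (mu (D `&` [set p | (l' p != 0)%R]) <= mu (((D `&` [set p | (l' p != 0)%R]) `\` N) `|` N))%E.
    by apply: le_mu => p Pp; have [Np|Np] := pselect (N p); [right|left; split].
  move=> /le_trans; apply; rewrite measureU0; [|exact: mPN|exact: mN|exact: N0].
  rewrite leNgt; apply/negP => P0; apply: PZ0; apply: (lt_le_trans P0).
  (* Off [N], the density equals [l'], and being nonnegative it is positive where [l'] is not 0. *)
  apply: le_mu => p [[Dp /= lp] Np]; rewrite process_zoneE//; split => //.
  rewrite lt_neqAle dissipation_density_ge0// andbT eq_sym.
  suff -> : density t p = l' p by [].
  by apply: contrapT => dl; apply: Np; apply: HN => /= /(_ Dp).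
by move=> p /= /not_implyP[Dp lp]; left; split => //=; apply/eqP => lp0; apply: lp; rewrite lp0.
Qed.

(** * Differentiation of the damage energy *)

Lemma damage_energyE t : t \in `[0, T] -> damage_energy Omega T eps J g rp k u t =
  \int[@lebesgue_measure R]_(s in `[0, t]) diss s.
Proof.
move=> tT; rewrite /damage_energy -RintegralN; apply: eq_Rintegral => s /set_mem /=.
rewrite in_itv/= => /andP[s0 st].
have sT : s \in `[0, T].
  by move: tT; rewrite !in_itv/= => /andP[? ?]; apply/andP; split; lra.
rewrite -RintegralN; apply: eq_Rintegral => x /set_mem Ox.
rewrite -RintegralN; apply: eq_Rintegral => y /set_mem Oy.
have Dxy : D (x, y) by [].
rewrite /dissipation_density.
(* The integrands agree for every pair: the rate is 0, possibly by the default value, or r >= r^+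
   and g = C^+. *)
have [-> |rn0] := eqVneq (degradation_rate T rp k u y x s) 0; first by ring.
have rpr := degradation_rate_neq0 T0 uc hk Dxy sT rn0.
have -> : g (scaled_strain u y x s) = Cp by case: hg => _ _ _ + *; exact.
by ring.
Qed.

(** In case (a) the rate of each bond is continuous in time, and the densities are dominated by one
    multiple of w; dominated convergence is applied to their measurable representatives. *)
Lemma dissipation_cvg (s_ : R^nat) t : is_excess_integral k ->
  (forall s, s \in `[0, T] -> differentiable_at s) ->
  (forall j, s_ j \in `[0, T]) -> t \in `[0, T] -> s_ j @[j --> \oo] --> t ->
  diss (s_ j) @[j --> \oo] --> diss t.
Proof.
move=> kex dT sT tT s_t.
have [Cd Cd0 Hd] := dissipation_derivative.
have [C C0 HC] := ae_density_bound.
have /choice[l' Hl'] : forall j, exists l' : E * E -> R,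
    [/\ mu.-integrable D (EFin \o l'),
        {ae mu, forall p, D p -> density (s_ j) p = l' p} &
        diss (s_ j) = \int[mu]_(p in D) l' p].
  by move=> j; have [_ [l' [? ? ? _]]] := Hd (s_ j) (sT j) (dT _ (sT j)); exists l'.
have [_ [lt [ilt llt dt _]]] := Hd t tT (dT _ tT).
have ml' j : measurable_fun D (l' j).
  by have [il' _ _] := Hl' j; apply/measurable_EFinP; exact: measurable_int il'.
have ll' : {ae mu, forall p j, D p -> density (s_ j) p = l' j p}.
  by apply: ae_foralln => j; have [] := Hl' j.
have cl' : {ae mu, forall p, D p -> l' j p @[j --> \oo] --> density t p}.
  move: ll'; apply: filterS => p Hp Dp.
  rewrite (_ : (fun j => _) = (fun j => density (s_ j) p)); last first.
    by apply/funext => j; rewrite Hp.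
  apply: cvgM; first exact: cvg_cst; apply: cvgN.
  have /subspace_continuousP/(_ t tT) := degradation_rate_continuous T0 uc hk kex Dp.
  move=> rc'.
  apply: (@cvg_comp _ _ _ s_ (degradation_rate T rp k u p.2 p.1) _ _ _ _ rc').
  move=> A [d /= d0 HA]; change (\forall j \near \oo, A (s_ j)).
  have : \forall j \near \oo, ball t d (s_ j) by exact: (s_t _ (nbhsx_ballx t d d0)).
  by apply: filterS => j tj; exact: (HA _ tj (sT j)).
have bl' j : {ae mu, forall p, D p -> `|l' j p| <= C * w p}.
  have [_ Hl _] := Hl' j; move: Hl (HC _ (sT j) (dT _ (sT j))).
  by apply: filterS2 => p Hl HCp Dp; rewrite -Hl//; exact: HCp.
have [f' [if' ff' cf']] := dominated_convergence_ae mD ml' cl' (int_Zw C) bl'.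
rewrite (_ : (fun j => diss (s_ j)) = (fun j => \int[mu]_(p in D) l' j p)); last first.
  by apply/funext => j; have [] := Hl' j.
suff -> : diss t = \int[mu]_(p in D) f' p by [].
rewrite dt; apply: Rintegral_ae_eq_arbitrary.
by move: llt ff'; apply: filterS2 => p H1 H2 Dp; rewrite -H1// H2.
Qed.

Lemma damage_derivative_excess : is_excess_integral k ->
  (forall s, s \in `[0, T] -> differentiable_at s) ->
  forall t, t \in `[0, T] ->
    is_time_deriv T (damage_energy Omega T eps J g rp k u) t (diss t).
Proof.
move=> kex dT t tT.
have dc : {within `[0, T]%classic, continuous diss}.
  apply/within_continuousP => s sT e e0; apply: contrapT => /forall2NP H.
  have /choice[s_ Hs] : forall j : nat, exists s', [/\ s' \in `[0, T],
      `|s' - s| < j.+1%:R^-1 & ~ `|diss s' - diss s| < e].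
    move=> j; have [|/existsNP[s' /not_implyP[s'T /not_implyP[s's ds']]]] := H j.+1%:R^-1.
      by rewrite invr_gt0 ltr0n.
    by exists s'.
  have s_s : s_ j @[j --> \oo] --> s.
    apply/cvgrPdist_lt => r' r0.
    have := @near_infty_natSinv_lt R (PosNum r0); apply: filterS => j /= jr.
    by have [_ + _] := Hs j; rewrite distrC => /lt_trans; apply.
  have s_T j : s_ j \in `[0, T] by have [] := Hs j.
  have := dissipation_cvg kex dT s_T sT s_s.
  move=> /cvgrPdist_lt/(_ e e0)[j _ /(_ j (leqnn _))] /=.
  by rewrite distrC; have [_ _] := Hs j.
apply: (is_time_deriv_eq (f := fun t => \int[@lebesgue_measure R]_(s in `[0, t]) diss s) tT).
  by move=> s sT; rewrite damage_energyE.
apply: (is_time_deriv_Rintegral (within_continuous_integrable dc) tT).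
exact/((within_continuousP _ _).1 dc).
Qed.

Lemma dissipated_homo s t : s \in `[0, T] -> t \in `[0, T] -> s <= t ->
  dissipated s <= dissipated t.
Proof.
move=> sT tT st.
have [Ck Ck0 HCk] := bond_kernel_bounded Omega eps0 hJ.
have KCp0 p : 0 <= K p * Cp by apply: mulr_ge0 => //; exact: ltW.
have int_d s' : s' \in `[0, T] -> mu.-integrable D (EFin \o (fun p => K p * Cp * - gam p s')).
  move=> s'T; apply: (@integrable_bounded _ _ _ _ _ mD _ (Ck * Cp)) => //.
    apply: measurable_funM; first exact: measurable_funM.
    by apply: measurable_funN; exact: (measurable_degradation_factor mO uX uc hk s'T).
  apply: aeW => p Dp; have /andP[g0 g1] := degradation_factor01 u hk p s'.
  rewrite normrM normrN (ger0_norm (KCp0 p)) (ger0_norm g0) -[leRHS]mulr1.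
  by apply: ler_pM => //; apply: ler_wpM2r; [exact: ltW|exact: HCk].
apply: le_Rintegral => //; [exact: int_d|exact: int_d|move=> p Dp].
apply: ler_wpM2l => //; rewrite lerN2.
exact: (degradation_factor_homo uc hk Dp sT tT st).
Qed.

(* The dissipation is bounded and, as a limit of difference quotients of the
   monotone function [dissipated], measurable: Lebesgue's differentiation theorem
   applies to its primitive, the damage energy. *)
Lemma ae_damage_derivative (B : set R) : countable B ->
  (forall t, t \in `[0, T] -> ~ B t -> differentiable_at t) ->
  {ae @lebesgue_measure R, forall t, t \in `[0, T] ->
    is_time_deriv T (damage_energy Omega T eps J g rp k u) t (diss t)}.
Proof.
move=> cB dB.
have [Cd Cd0 Hd] := dissipation_derivative.
pose S : set R := `]0, T[%classic `\` B.
have mB : measurable B by apply: countable_measurable => // x; exact: measurable_set1.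
have mS : measurable S by exact: measurableD.
have ST t : S t -> t \in `[0, T].
  by move=> [/= + _]; rewrite !in_itv/= => /andP[? ?]; apply/andP; split; exact: ltW.
have SD t : S t -> is_time_deriv T dissipated t (diss t).
  by move=> St; have [] := Hd t (ST t St) (dB _ (ST t St) St.2).
(* [dissipated] is extended from [0, T] to the line by projection; the extension is monotone, hence
   measurable, and so are its forward quotients [q] with step 1/(j+1). *)
have [Gc GcE] : exists Gc : R -> R, forall s, Gc s = dissipated (clip T s).
  by exists (fun s => dissipated (clip T s)).
have mGc : measurable_fun setT Gc.
  apply: nondecreasing_measurable => // s t st; rewrite !GcE; apply: dissipated_homo.
  - exact: clip_itv (ltW T0).
  - exact: clip_itv (ltW T0).
  - rewrite /clip ge_max; apply/andP; split; first by rewrite le_max lexx.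
    rewrite le_max; apply/orP; right; rewrite le_min; apply/andP.
    by split; [rewrite ge_min lexx|rewrite ge_min st orbT].
pose q (j : nat) s := j.+1%:R * (Gc (s + j.+1%:R^-1) - Gc s).
have mq j : measurable_fun S (q j).
  apply: measurable_funTS; apply: measurable_funM => //; apply: measurable_funB => //.
  by apply: (measurableT_comp mGc) => //; exact: measurable_funD.
have clipE s : s \in `[0, T] -> clip T s = s.
  by rewrite in_itv/= /clip => /andP[s0 sT]; rewrite min_r// max_r.
have qS t : S t -> q j t @[j --> \oo] --> diss t.
  move=> St; apply/cvgrPdist_le => e e0.
  have [d d0 H] := (is_time_derivP _ _ _ _).1 (SD t St) e e0.
  (* The strict inequality leaves room for the forward step t + 1/(j+1) in [0, T]. *)
  have tT : t < T by move: St => [/= + _]; rewrite in_itv/= => /andP[].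
  have m0 : 0 < Num.min d (T - t) by rewrite lt_min d0 subr_gt0.
  have := @near_infty_natSinv_lt R (PosNum m0); apply: filterS => j /=.
  rewrite lt_min => /andP[jd jT].
  have j0 : (0 : R) < j.+1%:R^-1 by rewrite invr_gt0 ltr0n.
  have tT0 := ST t St.
  have tjT : t + j.+1%:R^-1 \in `[0, T].
    move: tT0; rewrite !in_itv/= => /andP[t0' _]; apply/andP; split.
      by apply: addr_ge0 => //; exact: ltW.
    by rewrite -lerBrDl; exact: ltW.
  have tj : t + j.+1%:R^-1 - t = j.+1%:R^-1 by rewrite addrAC subrr add0r.
  have := H _ tjT; rewrite tj gtr0_norm// => /(_ jd) Hj.
  rewrite distrC /q !GcE !clipE// -(ler_pM2r j0) -[X in _ * X <= _](gtr0_norm j0) -normrM mulrBl.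
  by rewrite [_ * _ * _^-1]mulrAC mulfV ?pnatr_eq0// mul1r.
have mdS : measurable_fun S diss by exact: measurable_fun_cvg mq qS.
(* Setting the dissipation to 0 off [S] changes it on [0, T] only at countably many times and gives
   a function integrable on the whole line. *)
pose f := diss \_ S.
have fS t : S t -> f t = diss t by move=> St; rewrite /f patchE mem_set.
have intf : (@lebesgue_measure R).-integrable setT (EFin \o f).
  have -> : EFin \o f = (EFin \o diss) \_ S.
    by apply/funext => s; rewrite /f /= !patchE; case: ifP.
  rewrite -integrable_mkcond//; apply: (@integrable_bounded _ _ R (@lebesgue_measure R) S mS diss Cd) => //.
    apply: (@le_lt_trans _ _ (@lebesgue_measure R `]0, T[%classic)); first by apply: le_lebesgue_measure => x [].
    by rewrite lebesgue_measure_itv/= lte_fin T0 ltry.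
  apply: aeW => t St; have [_ [l' [_ _ _ dCd]]] := Hd t (ST t St) (dB _ (ST t St) St.2).
  rewrite ger0_norm//; apply: Rintegral_ge0 => x Ox; apply: Rintegral_ge0 => y Oy.
  exact: (@dissipation_density_ge0 t (x, y) (conj Ox Oy) (ST t St)).
have fE : {ae @lebesgue_measure R, forall s, s \in `[0, T] -> diss s = f s}.
  have : (@lebesgue_measure R).-negligible (B `|` ([set 0] `|` [set T])).
    by apply: negligibleU; [|apply: negligibleU];
      apply: countable_lebesgue_negligible; rewrite ?countable1.
  apply: negligibleS => s /= /not_implyP[sT] fs; apply: contrapT => nB; apply: fs.
  rewrite fS//; split => [/=|Bs]; last by apply: nB; left.
  move: sT; rewrite !in_itv/= => /andP[s0 sT]; apply/andP; split.
    by rewrite lt_neqAle s0 andbT; apply/eqP => s0'; apply: nB; right; left.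
  by rewrite lt_neqAle sT andbT; apply/eqP => s0'; apply: nB; right; right.
have dE t : t \in `[0, T] -> damage_energy Omega T eps J g rp k u t =
    \int[@lebesgue_measure R]_(s in `[0, t]) f s.
  move=> tT; rewrite damage_energyE//; apply: Rintegral_ae_eq_arbitrary.
  move: fE; apply: filterS; first exact: (ae_filter_ringOfSetsType (@lebesgue_measure R)).
  move=> s + st; apply.
  by move: st tT; rewrite /= !in_itv/= => /andP[? ?] /andP[? ?]; apply/andP; split; lra.
have := ae_is_time_deriv_Rintegral T intf.
move: fE; apply: filterS2; first exact: (ae_filter_ringOfSetsType (@lebesgue_measure R)).
move=> t ft Ft tT; rewrite ft//; apply: (is_time_deriv_eq tT _ (Ft tT)) => s sT.
by rewrite dE.
Qed.

End balance.

Theorem lemma4p1 (R : realType) (d : nat) (hd : d = 2%N \/ d = 3%N)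
  (Omega : set 'rV[R]_d) (hOmega : bounded_domain Omega)
  (T eps rho : R) (hT : 0 < T) (heps : 0 < eps) (hrho : 0 < rho)
  (J : R -> R) (M : R) (hJ : influence_function J M)
  (g : R -> R) (rm re rc rp Cm Cp : R)
  (hg : bond_potential g rm re rc rp Cm Cp)
  (k : degradation R) (hk : degradation_law rp k)
  (b : R -> 'rV[R]_d -> 'rV[R]_d) (u0 v0 : 'rV[R]_d -> 'rV[R]_d)
  (u v w : R -> 'rV[R]_d -> 'rV[R]_d)
  (hu : is_solution Omega T eps J g rp k rho b u0 v0 u v w) :
  let leb := @lebesgue_rV R d in
  let PZ := process_zone Omega T eps rp k u in
  let diss := dissipation Omega T eps J rp k Cp u in
  let balance_at t :=
    [/\ exists K' E' : R,
          [/\ is_time_deriv T (damage_energy Omega T eps J g rp k u) t (diss t),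
              is_time_deriv T (kinetic_energy Omega rho v) t K',
              is_time_deriv T (elastic_energy Omega eps J g rp k u) t E' &
              diss t = \int[leb]_(x in Omega) dotv (b t x) (v t x) - K' - E'],
        forall x y, Omega x -> Omega y -> ~ PZ t (x, y) ->
          dissipation_density Omega T eps J rp k Cp u t y x = 0,
        (0 < (leb \x leb) (PZ t))%E -> 0 < diss t &
        ~ (0 < (leb \x leb) (PZ t))%E -> diss t = 0] in
  {ae @lebesgue_measure R, forall t, t \in `[0, T] -> balance_at t} /\
  (is_excess_integral k -> forall t, t \in `[0, T] -> balance_at t).
Proof.
move=> leb PZ diss balance_at.
(* A successor dimension provides the coordinate 0 that defines the slabs. *)
have [m dE] : exists m, d = m.+1 by case: hd => ->; [exists 1%N|exists 2%N].
subst d; case: hOmega => oO _ _ bO; have mO := open_measurable_rV oO.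
case: hu => -[uX vX wX uv vw] uc bX _ _ ueq.
(* At a single time everything follows from two facts: gamma is differentiable for almost every
   pair, and the damage energy has derivative [diss]. The two cases differ only in the times at
   which these are available. *)
have balance t : t \in `[0, T] -> differentiable_at Omega T rp k u t ->
    is_time_deriv T (damage_energy Omega T eps J g rp k u) t (diss t) -> balance_at t.
  move=> tT dt ddam; have [PZ1 PZ2] :=
    dissipation_gt0P hT heps mO bO hJ hg hk uX vX uv uc tT dt.
  split => //; last first.
    by move=> x y Ox Oy nPZ; exact: (density_eq0 hT heps hJ hg hk uc (p := (x, y))).
  pose K' := \int[leb]_(x in Omega) (rho * dotv (v t x) (w t x)).
  pose E' := \int[(leb \x leb)%E]_(p in Omega `*` Omega)
    power_density Omega eps J g rp k u v t p - diss t.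
  exists K', E'; split => //.
  - exact: (kinetic_derivative hT hrho mO bO vX wX vw tT).
  - exact: (elastic_derivative hT heps mO bO hJ hg hk uX vX uv uc tT dt).
  - rewrite /E' (work_balance heps mO bO hJ hg hk uX vX wX bX uc tT (ueq t tT)).
    by rewrite -/K'; ring.
have [B [cB dB Bex]] := ae_degradation_differentiable mO bO uX uv uc hk.
split; last first.
  move=> kex t tT; have dT s : s \in `[0, T] -> differentiable_at Omega T rp k u s.
    by move=> sT; apply: dB => //; rewrite (Bex kex).
  apply: balance => //; first exact: dT.
  exact: (damage_derivative_excess hT heps mO bO hJ hg hk uX vX uv uc kex dT tT).
have := ae_damage_derivative hT heps mO bO hJ hg hk uX vX uv uc cB dB.
have : {ae @lebesgue_measure R, forall t, ~ B t}.
  have := countable_lebesgue_negligible cB.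
  by apply: negligibleS => t /= /contrapT.
apply: filterS2; first exact: (ae_filter_ringOfSetsType (@lebesgue_measure R)).
move=> t nB ddam tT; apply: balance => //; last exact: ddam.
exact: dB.
Qed.
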